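(* Let $\tau=\frac{-b+\sqrt{-d}}{2a}$ where $a,b,c$ are mutually coprime integers with $a>0$, $a\tau^2+b\tau+c=0$ and $-d=b^2-4ac$, and suppose $\tau$ lies in $C_{1/(1-t),\infty}$. Then $$\frac{F^2}{6}\left[(t+2)-\frac{(t-1)(t+8)}{t-4}s_2(\tau)\right]-t(t-1)\frac{d}{dt}F^2=\frac{a}{\pi\sqrt{d}}(t-1),$$ where $t=t(\tau)$, $F={}_2F_1\!\left(\frac14,\frac34;1;\frac{1}{1-t}\right)$, and $\frac{d}{dt}F^2$ denotes the derivative of $x\mapsto{}_2F_1(\frac14,\frac34;1;\frac{1}{1-x})^2$ evaluated at $x=t(\tau)$.
   Context: $\mathfrak H$ is the upper half-plane, $q=e^{2\pi i\tau}$, $E_2=1-24\sum_{n\ge1}n\frac{q^n}{1-q^n}$, $E_4=1+240\sum_{n\ge1}n^3\frac{q^n}{1-q^n}$, $E_6=1-504\sum_{n\ge1}n^5\frac{q^n}{1-q^n}$, $E_2^*(\tau)=E_2(\tau)-\frac{3}{\pi\mathrm{Im}(\tau)}$, $s_2(\tau)=\frac{E_4(\tau)}{E_6(\tau)}E_2^*(\tau)$. ${}_2F_1$ is the Gauss hypergeometric function. $t(\tau)=-\frac{1}{64}\left(\frac{\eta(\tau)}{\eta(2\tau)}\right)^{24}$ ($\eta$ the Dedekind eta function) is the Hauptmodul of $\Gamma_0(2)$. With $\mathcal{F}_{2B}=\{z\in\mathfrak{H}:|z+1/2|>1/2,|z-1/2|>1/2,|\mathrm{Re}(z)|<1/2\}$,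 $C_{1/(1-t),\infty}$ is the connected component of $\{\tau\in\mathcal F_{2B}:|1-t(\tau)|>1\}$ whose closure contains the cusp $\infty$ (i.e. containing points of arbitrarily large imaginary part). *)

(* Defs.v *)
From mathcomp Require Import all_boot all_order all_algebra.
From mathcomp Require Import complex.
From mathcomp Require Import boolp classical_sets reals topology normedtype.
From mathcomp Require Import sequences derive trigo exp.

Set Implicit Arguments.
Unset Strict Implicit.
Unset Printing Implicit Defensive.

Import Order.TTheory GRing.Theory Num.Theory.
Import numFieldNormedType.Exports.

Local Open Scope classical_set_scope.
Local Open Scope ring_scope.
Local Open Scope complex_scope.

Section Modular.
Context {R : realType}.
Implicit Types (z tau : R[i]) (k n : nat).

(* The topology and normed-space structure of [R[i]] are carried by the
   convertible alias [R[i]^o]. *)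
Definition clim (u : nat -> R[i]) : R[i] := limn (u : nat -> R[i]^o).

(* derivative of a complex function of a complex variable *)
Definition cderiv (f : R[i] -> R[i]) z : R[i] :=
  derive1 (f : R[i] -> R[i]^o) z.

Definition cexp z : R[i] :=
  (expR (complex.Re z))%:C * (cos (complex.Im z) +i* sin (complex.Im z)).

Definition qpar tau : R[i] := cexp (2 * pi%:C * 'i * tau).

Definition lambert k tau : R[i] :=
  clim (fun m =>
    \sum_(1 <= n < m) n%:R ^+ k * (qpar tau ^+ n / (1 - qpar tau ^+ n))).

Definition E2 tau : R[i] := 1 - 24 * lambert 1 tau.
Definition E4 tau : R[i] := 1 + 240 * lambert 3 tau.
Definition E6 tau : R[i] := 1 - 504 * lambert 5 tau.

Definition E2star tau : R[i] := E2 tau - 3 / (pi * complex.Im tau)%:C.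

Definition s2 tau : R[i] := E4 tau / E6 tau * E2star tau.

(* q^(1/24) means exp (2 pi i tau / 24) *)
Definition eta tau : R[i] :=
  cexp (2 * pi%:C * 'i * tau / 24) *
  clim (fun m => \prod_(1 <= n < m) (1 - qpar tau ^+ n)).

Definition hauptmodul tau : R[i] :=
  - (1 / 64) * (eta tau / eta (2 * tau)) ^+ 24.

Definition pochhammer z n : R[i] := \prod_(j < n) (z + j%:R).

(* Gauss series; only its values inside the unit disc are meaningful. *)
Definition hyp2F1 (a b c z : R[i]) : R[i] :=
  clim (fun m => \sum_(0 <= n < m)
    pochhammer a n * pochhammer b n / (pochhammer c n * n`!%:R) * z ^+ n).

Definition F2B : set R[i] :=
  [set z | [/\ 0 < complex.Im z,
               1 / 2 < `|z + 1 / 2|,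
               1 / 2 < `|z - 1 / 2| &
               `|complex.Re z| < 1 / 2]].

Definition F2B_large : set R[i] :=
  [set z | F2B z /\ 1 < `|1 - hauptmodul z|].

(* Union of the components of [F2B_large] that contain points of arbitrarily
   large imaginary part; there is exactly one such component, since
   [F2B_large] contains the half-strip |Re z| < 1/2, Im z > M for large M.
   [connected_component] is empty at points outside [F2B_large]. *)
Definition C_infty : set R[i] :=
  [set z | forall M : R, exists2 w : R[i],
     @connected_component R[i]^o F2B_large z w & M < complex.Im w].

End Modular.

(* Main.v *)
Require Import Defs.
From HB Require Import structures.
From mathcomp Require Import all_boot all_order all_algebra.
From mathcomp Require Import complex.
From mathcomp Require Import boolp classical_sets functions reals topology normedtype.
From mathcomp Require Import sequences derive realfun trigo exp.
From mathcomp Require Import ring lra zify.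
Import Order.TTheory GRing.Theory Num.Theory.
Import numFieldNormedType.Exports.
Set Implicit Arguments.
Unset Strict Implicit.
Unset Printing Implicit Defensive.
Local Open Scope classical_set_scope.
Local Open Scope ring_scope.
Local Open Scope complex_scope.

(** With z = 1 / (1 - t), Ramanujan's differential equations at levels 1 and 2 give, for P = 2 E_2(2 tau) - E_2(tau),
    E_4 = P^2 (1 + 3 z), E_6 = P^3 (1 - 9 z), q dz/dq = P z (1 - z) and q dP/dq = P (E_2 - P (1 - 3 z)) / 6.
    Hence F(z)^2 / P and its companion built from z (1 - z) F' are locally constant where |1 - t| > 1; on the
    component of the cusp their limits at q = 0 give F(z)^2 = P and z (1 - z) P F' = F (E_2 - P (1 - 3 z)) / 12,
    after which the left-hand side collapses to (E_2 - E_2^* ) (t - 1) / 6 = (t - 1) / (2 pi Im tau), while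
    sqrt d = 2 a Im tau.

    Two degenerate points need the second Frobenius solution, i.e. q = (z / 64) exp (H / F) on the component.
    It makes q real negative at z = -1/3 (t = 4), which |Re tau| < 1/2 excludes. At z = 1/9 (where E_6 = 0 and s_2 is a
    junk value) it gives tau = i up to translation, and E_2^*(i) = 0. For the latter, the inversion formula of
    E_2 on the imaginary axis comes from a double series of 1 / (m y + i j)^2 summed in both orders, and
    differentiating it gives E_6(i) = 0. *)

(** * Real-valued modulus and limits of complex functions *)

Section ComplexCalculus.
Context {R : realType}.
Implicit Types (z w l : R[i]).

(** Away from the imaginary axis no transformation law of modular forms enters. An identity between
    q-series is proved by uniqueness: both sides have the same logarithmic q-derivative, so their
    quotient has derivative zero on the punctured unit disc and equals its limit at q = 0. The
    derivatives themselves rest on an elementary double sum.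

    For the hypergeometric side this is not enough. The series F needs |z| < 1, which is the
    condition |1 - t| > 1, and on that region the first integrals are only locally constant. A
    connected set reaching q = 0 is what fixes their value, hence the component of the cusp. No
    square root of P is ever chosen, so the first two of these integrals are built from squares.

    Division by zero returns 0, so degenerate points are genuine cases. At z = 1/9, that is t = -8,
    both t + 8 and E_6 vanish: the term with s_2 drops out, and the identity holds there exactly
    because [E2star] is 0. *)

Definition nm z : R := complex.Re `|z|.

(** The norm of [R[i]] is itself a real number embedded in [R[i]], so this is definitional, and
    facts about the norm transfer to [R] through injectivity of the embedding. *)
Lemma nmE z : `|z| = (nm z)%:C. Proof. by []. Qed.

Lemma nm_ge0 z : 0 <= nm z.
Proof. by rewrite -ler0c -nmE. Qed.

Lemma nm0 : nm 0 = 0. Proof. by rewrite /nm normr0. Qed.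
Lemma nm1 : nm 1 = 1. Proof. by rewrite /nm normr1. Qed.
Lemma nm_eq0 z : (nm z == 0) = (z == 0).
Proof. by rewrite -(inj_eq (@complexI R)) -nmE rmorph0 normr_eq0. Qed.
Lemma nm_gt0 z : (0 < nm z) = (z != 0).
Proof. by rewrite lt_neqAle nm_ge0 andbT eq_sym nm_eq0. Qed.
Lemma nmM z w : nm (z * w) = nm z * nm w.
Proof. by apply: complexI; rewrite rmorphM /= -!nmE normrM. Qed.
Lemma nmX z n : nm (z ^+ n) = nm z ^+ n.
Proof. by apply: complexI; rewrite rmorphXn /= -!nmE normrX. Qed.
Lemma nmV z : nm z^-1 = (nm z)^-1.
Proof. by apply: complexI; rewrite fmorphV /= -!nmE normfV. Qed.
Lemma nmN z : nm (- z) = nm z.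
Proof. by rewrite /nm normrN. Qed.
Lemma nmB z w : nm (z - w) = nm (w - z).
Proof. by rewrite -opprB nmN. Qed.
Lemma nmD z w : nm (z + w) <= nm z + nm w.
Proof. by rewrite -lecR rmorphD /= -!nmE ler_normD. Qed.
Lemma nmDB z w : nm (z - w) <= nm z + nm w.
Proof. by rewrite -(nmN w) nmD. Qed.
Lemma nm_sub_ge z w : nm z - nm w <= nm (z - w).
Proof. by rewrite lerBlDr -{1}(subrK w z) nmD. Qed.
Lemma nm_real (x : R) : nm x%:C = `|x|.
Proof. by rewrite /nm normc_def /= expr0n addr0 sqrtr_sqr. Qed.
Lemma nm_nat n : nm n%:R = n%:R.
Proof. by rewrite -(rmorph_nat (real_complex R)) nm_real ger0_norm. Qed.
Lemma nm_sum I (s : seq I) (P : pred I) (f : I -> R[i]) :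
  nm (\sum_(i <- s | P i) f i) <= \sum_(i <- s | P i) nm (f i).
Proof.
elim/big_rec2: _ => [|i x y _ h]; first by rewrite nm0.
by rewrite (le_trans (nmD _ _)) // lerD2l.
Qed.
Lemma nm_Re z : `|complex.Re z| <= nm z.
Proof. by have := normc_ge_Re z; rewrite nmE lecR. Qed.
Lemma nm_Im z : `|complex.Im z| <= nm z.
Proof. by have := nm_Re (z * 'i%C); rewrite ReiNIm normrN nmM /nm normc_def /= expr0n expr1n add0r sqrtr1 mulr1. Qed.
Lemma nm_ReIm z : nm z <= `|complex.Re z| + `|complex.Im z|.
Proof.
rewrite [z in nm z]complexE (le_trans (nmD _ _)) // nmM !nm_real.
by rewrite {1}/nm normc_def /= expr0n expr1n add0r sqrtr1 mul1r.
Qed.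
Lemma nm_sqr z : nm z ^+ 2 = complex.Re z ^+ 2 + complex.Im z ^+ 2.
Proof. by rewrite /nm normc_def /= sqr_sqrtr // addr_ge0 // sqr_ge0. Qed.

Lemma cRe_sub z w : complex.Re (z - w) = complex.Re z - complex.Re w.
Proof. by case: z => a b; case: w. Qed.
Lemma cIm_sub z w : complex.Im (z - w) = complex.Im z - complex.Im w.
Proof. by case: z => a b; case: w. Qed.

(* Convergence of complex valued functions measured by the real valued modulus;
   [cnbhs] is the neighbourhood filter of [R[i]^o] in these terms. *)
Definition tends T (F : set_system T) (f : T -> R[i]) l :=
  forall e : R, 0 < e -> \forall x \near F, nm (f x - l) < e.

Definition cnbhs z : set_system R[i] :=
  [set P | exists2 d : R, 0 < d & forall w, nm (w - z) < d -> P w].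

Lemma nbhs_cnbhs z (P : set R[i]) :
  nbhs (z : R[i]^o) P <-> cnbhs z P.
Proof.
rewrite -nbhs_ballE; split=> -[d d0 h].
  exists (complex.Re d); first by move: d0; rewrite /= ltcE /= => /andP[].
  move=> w hw; apply: h; rewrite /ball /= distrC nmE.
  have -> : d = (complex.Re d)%:C by rewrite RRe_real // gtr0_real.
  by rewrite ltcR.
exists d%:C; first by rewrite /= ltcR.
by move=> w; rewrite /ball /= distrC nmE ltcR => /h.
Qed.

Global Instance cnbhs_filter z : ProperFilter (cnbhs z).
Proof.
split.
  by move=> [d d0 /(_ z)]; rewrite subrr nm0 => /(_ d0).
split; first by exists 1.
  move=> P Q [d d0 hd] [e e0 he]; exists (Num.min d e).
    by rewrite lt_min d0.
  by move=> w; rewrite lt_min => /andP[/hd ? /he ?].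
by move=> P Q PQ [d d0 hd]; exists d => // w /hd /PQ.
Qed.

Lemma cnbhs_self z (P : set R[i]) : cnbhs z P -> P z.
Proof. by move=> [d d0]; apply; rewrite subrr nm0. Qed.

Lemma cnbhs_ball z (r : R) : 0 < r -> \forall w \near cnbhs z, nm (w - z) < r.
Proof. by exists r. Qed.

Lemma cnbhs_open z (P : set R[i]) : cnbhs z P -> \forall w \near cnbhs z, cnbhs w P.
Proof.
move=> [d d0 h]; exists d => // w hw; exists (d - nm (w - z)); first by rewrite subr_gt0.
move=> v hv; apply: h; rewrite -(subrKA w).
by rewrite (le_lt_trans (nmD _ _)) // -ltrBrDr.
Qed.

Section Limits.
Context {T : Type} {F : set_system T} {FF : Filter F}.
Implicit Types (f g : T -> R[i]).

Lemma tends_cst l : tends F (fun=> l) l.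
Proof. by move=> e e0; near=> x; rewrite subrr nm0. Unshelve. all: by end_near. Qed.

Lemma tends_near f g l : (\forall x \near F, f x = g x) -> tends F f l -> tends F g l.
Proof. by move=> fg h e e0; near=> x; rewrite -(near fg x) //; near: x; exact: h. Unshelve. all: by end_near. Qed.

Lemma tends_squeeze f l (r : T -> R) : (\forall x \near F, nm (f x - l) <= r x) ->
  r @ F --> (0 : R) -> tends F f l.
Proof.
move=> h r0 e e0; near=> x; apply: (le_lt_trans (near h x _)) => //.
rewrite (le_lt_trans (ler_norm _)) // -normrN -(add0r (- _)).
by near: x; move/cvgrPdist_lt : r0; apply.
Unshelve. all: by end_near. Qed.

Lemma tendsD f g k l : tends F f k -> tends F g l ->
  tends F (fun x => f x + g x) (k + l).
Proof.
move=> hf hg e e0; near=> x; rewrite opprD addrACA (le_lt_trans (nmD _ _)) //.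
rewrite (splitr e) ltrD //; near: x; [apply: hf|apply: hg]; exact: divr_gt0.
Unshelve. all: by end_near. Qed.

Lemma tendsN f l : tends F f l -> tends F (fun x => - f x) (- l).
Proof. by move=> hf e e0; near=> x; rewrite -opprD nmN; near: x; exact: hf.
Unshelve. all: by end_near. Qed.

Lemma tendsB f g k l : tends F f k -> tends F g l ->
  tends F (fun x => f x - g x) (k - l).
Proof. by move=> hf /tendsN; exact: tendsD. Qed.

Lemma tends_bounded f l : tends F f l -> \forall x \near F, nm (f x) < nm l + 1.
Proof.
move=> h; near=> x; rewrite -ltrBlDl; apply: le_lt_trans (nm_sub_ge _ _) _.
by near: x; exact: h.
Unshelve. all: by end_near. Qed.

Lemma tendsM f g k l : tends F f k -> tends F g l ->
  tends F (fun x => f x * g x) (k * l).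
Proof.
move=> hf hg e e0; near=> x.
have -> : f x * g x - k * l = (f x - k) * g x + k * (g x - l) by ring.
rewrite (le_lt_trans (nmD _ _)) // !nmM (splitr e) ltr_leD //.
  have h1 : nm (f x - k) < e / 2 / (nm l + 1).
    near: x; apply: hf; rewrite !divr_gt0 //; apply: ltr_wpDl => //; exact: nm_ge0.
  have h2 : nm (g x) < nm l + 1 by near: x; exact: tends_bounded.
  have h3 : 0 < nm l + 1 by apply: ltr_wpDl => //; exact: nm_ge0.
  rewrite ltr_pdivlMr // in h1; apply: le_lt_trans h1.
  by rewrite ler_wpM2l ?nm_ge0 // ltW.
have h1 : nm (g x - l) < e / 2 / (nm k + 1).
  near: x; apply: hg; rewrite !divr_gt0 //; apply: ltr_wpDl => //; exact: nm_ge0.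
have h3 : 0 < nm k + 1 by apply: ltr_wpDl => //; exact: nm_ge0.
rewrite ltr_pdivlMr // mulrC in h1; apply: le_trans (ltW h1).
by rewrite ler_wpM2r ?nm_ge0 // lerDl.
Unshelve. all: by end_near. Qed.

Lemma tendsV f l : l != 0 -> tends F f l -> tends F (fun x => (f x)^-1) l^-1.
Proof.
move=> l0 hf e e0; have nl0 : 0 < nm l by rewrite nm_gt0.
near=> x.
have h1 : nm (f x - l) < nm l / 2 by near: x; apply: hf; exact: divr_gt0.
have h2 : nm l / 2 < nm (f x).
  have := nm_sub_ge l (l - f x); rewrite (nmB l) subKr; lra.
have f0 : f x != 0 by rewrite -nm_gt0; apply: lt_trans h2; exact: divr_gt0.
have -> : (f x)^-1 - l^-1 = (l - f x) / (f x * l) by field; apply/andP.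
rewrite nmM nmB nmV nmM ltr_pdivrMr; last by rewrite mulr_gt0 // nm_gt0.
have h3 : nm (f x - l) < e * (nm l / 2 * nm l).
  by near: x; apply: hf; rewrite !mulr_gt0 ?invr_gt0.
by apply: lt_le_trans h3 _; rewrite ler_wpM2l ?(ltW e0) // ler_wpM2r ?nm_ge0 // ltW.
Unshelve. all: by end_near. Qed.

Lemma tendsX f l n : tends F f l -> tends F (fun x => f x ^+ n) (l ^+ n).
Proof.
move=> h; elim: n => [|n ih]; first by under eq_fun do rewrite expr0; exact: tends_cst.
by rewrite exprS; under eq_fun do rewrite exprS; exact: tendsM.
Qed.

Lemma tends_sum I (s : seq I) (P : pred I) (f : I -> T -> R[i]) (l : I -> R[i]) :
  (forall i, P i -> tends F (f i) (l i)) ->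
  tends F (fun x => \sum_(i <- s | P i) f i x) (\sum_(i <- s | P i) l i).
Proof.
move=> h; elim: s => [|i s ih].
  by rewrite big_nil; under eq_fun do rewrite big_nil; exact: tends_cst.
rewrite big_cons; under eq_fun do rewrite big_cons.
by case: ifPn => // Pi; apply: tendsD => //; exact: h.
Qed.

Lemma tends_real (f : T -> R) (l : R) :
  f @ F --> l <-> tends F (fun x => (f x)%:C) l%:C.
Proof.
split=> [h|h]; last first.
  apply/cvgrPdist_lt => e e0; near=> x; rewrite distrC -nm_real rmorphB /=.
  by near: x; exact: h.
move=> e e0; near=> x; rewrite -rmorphB nm_real distrC.
by near: x; move/cvgrPdist_lt : h; apply.
Unshelve. all: by end_near. Qed.

Lemma tends_nm_le f l (r : R) : ProperFilter F -> tends F f l ->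
  (\forall x \near F, nm (f x) <= r) -> nm l <= r.
Proof.
move=> PF h hr; apply/ler_addgt0Pr => e e0.
have [x []] := @filter_ex _ _ PF _ (filterI (h e e0) hr).
by have := nm_sub_ge l (l - f x); rewrite (nmB l) subKr; lra.
Qed.

Lemma tends_unique f k l : ProperFilter F -> tends F f k -> tends F f l -> k = l.
Proof.
move=> PF /tendsB/[apply] h; apply/eqP; rewrite -subr_eq0 -nm_eq0 eq_le nm_ge0 andbT.
apply: (tends_nm_le PF h); near=> x; by rewrite subrr nm0.
Unshelve. all: by end_near. Qed.

Lemma tends_Im f l : tends F f l -> (fun x => complex.Im (f x)) @ F --> complex.Im l.
Proof.
move=> h; apply/cvgrPdist_lt => e e0; near=> x.
rewrite distrC -cIm_sub; apply: le_lt_trans (nm_Im _) _.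
by near: x; exact: h.
Unshelve. all: by end_near. Qed.

Lemma tends_ReIm f (a b : R) : (fun x => complex.Re (f x)) @ F --> a ->
  (fun x => complex.Im (f x)) @ F --> b -> tends F f (a +i* b).
Proof.
move=> ha hb.
apply: (@tends_squeeze _ _ (fun x => `|complex.Re (f x) - a| + `|complex.Im (f x) - b|)).
  by near=> x; apply: (le_trans (nm_ReIm _)); rewrite cRe_sub cIm_sub.
rewrite -[0](addr0 0); apply: cvgD.
  by rewrite -(normr0 R) -(subrr a); apply: cvg_norm; apply: cvgB => //; exact: cvg_cst.
by rewrite -(normr0 R) -(subrr b); apply: cvg_norm; apply: cvgB => //; exact: cvg_cst.
Unshelve. all: by end_near. Qed.

End Limits.
End ComplexCalculus.

(** * Complex derivatives *)

Section Differentiation.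
Context {R : realType}.
Implicit Types (z w l d e : R[i]) (f g h : R[i] -> R[i]).

Lemma tends_comp T (F : set_system T) {FF : Filter F} (f : T -> R[i]) (k : R[i] -> R[i]) l e :
  tends F f l -> tends (cnbhs l) k e -> tends F (fun x => k (f x)) e.
Proof.
move=> hf hk eps eps0; have [d d0 hd] := hk _ eps0.
by near=> x; apply: hd; near: x; exact: hf.
Unshelve. all: by end_near. Qed.

Lemma tends_cnbhs T (F : set_system T) {FF : Filter F} (f : T -> R[i]) l (P : set R[i]) :
  tends F f l -> cnbhs l P -> \forall x \near F, P (f x).
Proof.
by move=> hf [d d0 hd]; near=> x; apply: hd; near: x; exact: hf.
Unshelve. all: by end_near. Qed.

Lemma tends_id z : tends (cnbhs z) id z.
Proof. by move=> e e0; exists e. Qed.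

(* Caratheodory's form of the complex derivative. *)
Definition cdif f z d := exists2 g, tends (cnbhs z) g d &
  \forall w \near cnbhs z, f w - f z = (w - z) * g w.

Lemma cdif_cont f z d : cdif f z d -> tends (cnbhs z) f (f z).
Proof.
move=> [g gd fg]; apply: (@tends_near _ _ _ _ (fun w => f z + (w - z) * g w)).
  by near=> w; rewrite -(near fg w) // subrKC.
have -> : f z = f z + (z - z) * d by rewrite subrr mul0r addr0.
apply: tendsD; first by rewrite {1}subrr mul0r addr0; exact: tends_cst.
by apply: tendsM => //; apply: tendsB; [exact: tends_id|exact: tends_cst].
Unshelve. all: by end_near. Qed.

Lemma cdif_near f h z d : (\forall w \near cnbhs z, f w = h w) ->
  cdif f z d -> cdif h z d.
Proof.
move=> fh [g gd fg]; exists g => //; near=> w.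
by rewrite -(cnbhs_self fh) -(near fh w) // (near fg w).
Unshelve. all: by end_near. Qed.

Lemma cdif_eq f z d d' : cdif f z d -> d = d' -> cdif f z d'.
Proof. by move=> ? <-. Qed.

Lemma cdif_cst c z : cdif (fun=> c) z 0.
Proof.
by exists (fun=> 0); [exact: tends_cst|near=> w; rewrite subrr mulr0].
Unshelve. all: by end_near. Qed.

Lemma cdif_id z : cdif id z 1.
Proof.
by exists (fun=> 1); [exact: tends_cst|near=> w; rewrite mulr1].
Unshelve. all: by end_near. Qed.

Lemma cdifD f h z d e : cdif f z d -> cdif h z e -> cdif (fun w => f w + h w) z (d + e).
Proof.
move=> [g gd fg] [k ke hk]; exists (fun w => g w + k w); first exact: tendsD.
by near=> w; rewrite mulrDr -(near fg w) // -(near hk w) // opprD addrACA.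
Unshelve. all: by end_near. Qed.

Lemma cdifM f h z d e : cdif f z d -> cdif h z e ->
  cdif (fun w => f w * h w) z (d * h z + f z * e).
Proof.
move=> [g gd fg] dh; have hc := cdif_cont dh; case: dh => [k ke hk].
exists (fun w => g w * h w + f z * k w).
  by apply: tendsD; apply: tendsM => //; exact: tends_cst.
near=> w; rewrite mulrDr mulrA -(near fg w) // mulrCA -(near hk w) //; ring.
Unshelve. all: by end_near. Qed.

Lemma cdifZ c f z d : cdif f z d -> cdif (fun w => c * f w) z (c * d).
Proof.
move=> h; apply: cdif_eq (cdifM (cdif_cst c z) h) _; ring.
Qed.

Lemma cdifN f z d : cdif f z d -> cdif (fun w => - f w) z (- d).
Proof.
move=> [g gd fg]; exists (fun w => - g w); first exact: tendsN.
by near=> w; rewrite mulrN -(near fg w) // opprB opprK addrC.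
Unshelve. all: by end_near. Qed.

Lemma cdifB f h z d e : cdif f z d -> cdif h z e -> cdif (fun w => f w - h w) z (d - e).
Proof. by move=> df /cdifN; exact: cdifD. Qed.

Lemma cdifX f z d n : cdif f z d ->
  cdif (fun w => f w ^+ n) z (n%:R * f z ^+ n.-1 * d).
Proof.
move=> h; elim: n => [|n ih].
  by apply: cdif_eq (cdif_cst 1 z) _; rewrite !mul0r.
have -> : (fun w => f w ^+ n.+1) = (fun w => f w * f w ^+ n).
  by apply/funext => w; rewrite exprS.
apply: cdif_eq (cdifM h ih) _; case: n {ih} => [|n]; first by rewrite expr0; ring.
by rewrite [n.+1.-1]/= [n.+2.-1]/= exprS (mulrS _ n.+1); ring.
Qed.

Lemma cdifV f z d : f z != 0 -> cdif f z d ->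
  cdif (fun w => (f w)^-1) z (- d / f z ^+ 2).
Proof.
move=> f0 df; have fc := cdif_cont df; case: df => [g gd fg].
exists (fun w => - g w * ((f w)^-1 * (f z)^-1)).
  apply: tendsM; first exact: tendsN.
  by rewrite expr2 invfM; apply: tendsM; [exact: tendsV|exact: tends_cst].
have nz : cnbhs (f z) [set v | v != 0].
  exists (nm (f z)); first by rewrite nm_gt0.
  by move=> v; apply: contraTneq => ->; rewrite sub0r nmN ltxx.
have fnz := tends_cnbhs fc nz.
near=> w; have fw : f w != 0 by near: w; exact: fnz.
have hgw : f w - f z = (w - z) * g w by near: w; exact: fg.
by rewrite mulrA mulrN -hgw; field; apply/andP.
Unshelve. all: by end_near. Qed.

Lemma cdif_div f h z d e : h z != 0 -> cdif f z d -> cdif h z e ->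
  cdif (fun w => f w / h w) z ((d * h z - f z * e) / h z ^+ 2).
Proof.
by move=> h0 df dh; apply: cdif_eq (cdifM df (cdifV h0 dh)) _; field.
Qed.

Lemma cdif_comp h f z d e : cdif f z d -> cdif h (f z) e ->
  cdif (fun w => h (f w)) z (e * d).
Proof.
move=> df; have fc := cdif_cont df; case: df => [g gd fg] [k ke hk].
exists (fun w => k (f w) * g w); first by apply: tendsM => //; exact: tends_comp fc ke.
have hkf : \forall w \near cnbhs z, h (f w) - h (f z) = (f w - f z) * k (f w).
  exact: tends_cnbhs fc hk.
near=> w; rewrite (near hkf w) // (near fg w) //; ring.
Unshelve. all: by end_near. Qed.

(* Real points accumulate at a real point, so the derivative there is determined by the values at real points. *)
Lemma cdif_real_unique f h (x : R) d e :
  (\forall w \near cnbhs x%:C, complex.Im w = 0 -> f w = h w) ->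
  cdif f x%:C d -> cdif h x%:C e -> d = e.
Proof.
move=> fh [g gd fg] [k ke hk].
apply/eqP; rewrite -subr_eq0 -nm_eq0 eq_le nm_ge0 andbT; apply/ler_addgt0Pr => r r0; rewrite add0r.
have [s s0 hs] := filterI (filterI fh fg) (filterI hk (tendsB gd ke r0)).
pose w := (x + s / 2)%:C.
have wx : w - x%:C = (s / 2)%:C by rewrite -rmorphB addrC addKr.
have : nm (w - x%:C) < s by rewrite wx nm_real ger0_norm; lra.
move=> /hs[[/(_ erefl) fw gw] [kw]].
have w0 : w - x%:C != 0 by rewrite wx fmorph_eq0; lra.
have -> : g w = k w.
  apply: (mulfI w0); rewrite -gw -kw fw; congr (_ - _).
  by have := cnbhs_self fh => /(_ erefl).
by rewrite subrr sub0r nmN => /ltW.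
Qed.

(** The bridge to the derivative of the statement; as that is a function, it also gives uniqueness
    of [d]. *)
Lemma cderivE f z d : cdif f z d -> cderiv f z = d.
Proof.
move=> [g gd fg]; rewrite /cderiv derive1E.
apply: (@cvg_lim R[i]^o) => //.
move=> P /nbhs_cnbhs [e e0 he].
rewrite /nbhs /=.
have [s s0 hs] := filterI fg (gd _ e0).
apply/nbhs_ballP; exists s%:C; first by rewrite /= ltcR.
move=> v /=; rewrite /ball /= sub0r normrN nmE ltcR => vs v0.
apply: he => /=.
have [] := hs (v + z); first by rewrite addrK.
rewrite addrK => + h; rewrite /GRing.scale /= mulr1 => ->.
by rewrite mulKf.
Qed.

Lemma cdif_unique f z d e : cdif f z d -> cdif f z e -> d = e.
Proof. by move=> /cderivE <- /cderivE. Qed.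

End Differentiation.

(** * Series with a summable majorant *)

Section ComplexSeries.
Context {R : realType}.
Implicit Types (z w l d e : R[i]) (u v : nat -> R[i]) (M : nat -> R).

Lemma climE u l : tends \oo u l -> clim u = l.
Proof.
move=> h; apply: (@cvg_lim R[i]^o) => //.
by move=> P /nbhs_cnbhs /(tends_cnbhs h).
Qed.

Definition csum u : R[i] := clim (series u).

Lemma csumE u l : tends \oo (series u) l -> csum u = l.
Proof. exact: climE. Qed.

Definition csummable u := tends \oo (series u) (csum u).

Lemma csummable_tends u l : tends \oo (series u) l -> csummable u.
Proof. by move=> h; rewrite /csummable (csumE h). Qed.

Lemma csummable_major u M : (forall n, nm (u n) <= M n) -> cvgn (series M) -> csummable u.
Proof.
move=> uM Mc.
have part (p : R[i] -> R) : (forall z, `|p z| <= nm z) -> cvgn (series (p \o u)).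
  move=> hp; apply: normed_cvg; apply: series_le_cvg Mc => n.
  - exact: normr_ge0.
  - exact: le_trans (nm_ge0 _) (uM n).
  - exact: le_trans (hp _) (uM n).
have hRe := part _ (@nm_Re R); have hIm := part _ (@nm_Im R).
have ser (p : R[i] -> R) : p 0 = 0 -> {morph p : x y / x + y} ->
    (fun n => p (series u n)) = series (p \o u).
  by move=> p0 pD; apply/funext => n; rewrite /series /= (big_morph p pD p0).
apply: (@csummable_tends _ (limn (series (@complex.Re R \o u)) +i* limn (series (@complex.Im R \o u)))).
apply: tends_ReIm.
- by rewrite (ser (@complex.Re R)) //; case=> a b [].
- by rewrite (ser (@complex.Im R)) //; case=> a b [].
Qed.

Lemma csum_tail u M : (forall n, nm (u n) <= M n) -> cvgn (series M) ->
  forall N, nm (csum u - series u N) <= limn (series M) - series M N.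
Proof.
move=> uM Mc N.
have hu := csummable_major uM Mc.
apply: (@tends_nm_le R _ \oo _ (fun n => series u n - series u N)).
  by apply: tendsB => //; exact: tends_cst.
near=> n.
have Nn : (N <= n)%N by near: n; exact: nbhs_infty_ge.
rewrite sub_series_geq //; apply: le_trans (nm_sum _ _ _) _.
apply: (@le_trans _ _ (\sum_(N <= k < n) M k)); first exact: ler_sum.
rewrite -sub_series_geq // lerB //.
apply: nondecreasing_cvgn_le => //.
by apply: nondecreasing_series => k _ _; exact: le_trans (nm_ge0 _) (uM k).
Unshelve. all: by end_near. Qed.

(** Tannery's theorem: cut at an index where the tail of the majorant [M] is below e / 3. Termwise
    differentiation, the exchange of double sums and the partial fraction expansion all go through
    it. *)
Lemma tends_csum T (F : set_system T) {FF : ProperFilter F} (f : T -> nat -> R[i]) u M :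
  (\forall x \near F, forall n, nm (f x n) <= M n) -> cvgn (series M) ->
  (forall n, tends F (f ^~ n) (u n)) -> tends F (fun x => csum (f x)) (csum u).
Proof.
move=> fM Mc fu.
have uM n : nm (u n) <= M n.
  by apply: (tends_nm_le FF (fu n)); near=> x; exact: (near fM x).
move=> e e0; have e3 : 0 < e / 3 by lra.
move/cvgrPdist_lt : (Mc) => /(_ _ e3) [N _ hN].
have {hN} hN : limn (series M) - series M N < e / 3.
  by apply: le_lt_trans (ler_norm _) _; apply: hN => /=.
have ft : tends F (fun x => series (f x) N) (series u N) by exact: tends_sum.
near=> x.
have xM : forall n, nm (f x n) <= M n by near: x; exact: fM.
have h1 := le_lt_trans (csum_tail xM Mc N) hN.
have h2 := le_lt_trans (csum_tail uM Mc N) hN.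
have h3 : nm (series (f x) N - series u N) < e / 3 by near: x; exact: ft.
have -> : csum (f x) - csum u = (csum (f x) - series (f x) N) +
   ((series (f x) N - series u N) - (csum u - series u N)) by ring.
have h4 := nmD (csum (f x) - series (f x) N) ((series (f x) N - series u N) - (csum u - series u N)).
have h5 := nmDB (series (f x) N - series u N) (csum u - series u N).
lra.
Unshelve. all: by end_near. Qed.

Lemma csummableD u v : csummable u -> csummable v ->
  tends \oo (series (fun n => u n + v n)) (csum u + csum v).
Proof.
move=> hu hv; apply: tends_near (tendsD hu hv); near=> n.
by rewrite /series /= big_split.
Unshelve. all: by end_near. Qed.

Lemma csummableZ c u : csummable u -> tends \oo (series (fun n => c * u n)) (c * csum u).
Proof.
move=> hu; apply: tends_near (tendsM (tends_cst c) hu); near=> n.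
by rewrite /series /= mulr_sumr.
Unshelve. all: by end_near. Qed.

Lemma csumD u v : csummable u -> csummable v -> csum (fun n => u n + v n) = csum u + csum v.
Proof. by move=> hu hv; apply: csumE; exact: csummableD. Qed.

Lemma csumZ c u : csummable u -> csum (fun n => c * u n) = c * csum u.
Proof. by move=> hu; apply: csumE; exact: csummableZ. Qed.

Lemma csummable_addZ u v c : csummable u -> csummable v -> csummable (fun n => u n + c * v n).
Proof. by move=> hu hv; apply: csummable_tends (csummableD hu (csummable_tends (csummableZ c hv))). Qed.

Lemma csumDZ u v c : csummable u -> csummable v ->
  csum (fun n => u n + c * v n) = csum u + c * csum v.
Proof.
by move=> hu hv; rewrite csumD ?csumZ //; exact: csummable_tends (csummableZ c hv).
Qed.

(** In Caratheodory's form, termwise differentiation is mere continuity at [z] of the sum of the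
    difference quotients [g n]. *)
Lemma cdif_csum (f g : nat -> R[i] -> R[i]) z (d : nat -> R[i]) M :
  (\forall w \near cnbhs z, csummable (f ^~ w)) ->
  (\forall w \near cnbhs z, forall n, f n w - f n z = (w - z) * g n w) ->
  (\forall w \near cnbhs z, forall n, nm (g n w) <= M n) -> cvgn (series M) ->
  (forall n, tends (cnbhs z) (g n) (d n)) ->
  cdif (fun w => csum (f ^~ w)) z (csum d).
Proof.
move=> fs fg gM Mc gd; exists (fun w => csum (g ^~ w)).
  exact: tends_csum gM Mc gd.
have fz := cnbhs_self fs.
near=> w.
have fw : csummable (f ^~ w) by near: w; exact: fs.
have gw : csummable (g ^~ w) by apply: csummable_major Mc; near: w; exact: gM.
have e : forall n, f n w - f n z = (w - z) * g n w by near: w; exact: fg.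
rewrite -csumZ // -[csum (f ^~ z)]mul1r -mulNr -csumDZ //.
by congr csum; apply/funext => n; rewrite mulN1r e.
Unshelve. all: by end_near. Qed.

(** As a sum of n copies of x^n, the left side is at most the partial geometric sum. *)
Lemma geometric_bound (x : R) n : 0 <= x < 1 -> n%:R * x ^+ n <= (1 - x)^-1.
Proof.
move=> /andP[x0 x1].
have -> : n%:R * x ^+ n = \sum_(i < n) x ^+ n by rewrite sumr_const card_ord mulr_natl.
have : \sum_(i < n) x ^+ n <= \sum_(i < n) x ^+ i.
  apply: ler_sum => i _; apply: ler_wiXn2l; [done|exact: ltW|exact: ltnW].
move=> h; apply: le_trans h _.
rewrite -[leRHS]mul1r ler_pdivlMr ?subr_gt0 // mulrC -opprB mulNr -subrX1.
by rewrite opprB gerBl exprn_ge0.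
Qed.

Lemma cvg_polygeometric k (r : R) : 0 <= r < 1 ->
  cvgn (series (fun n => n%:R ^+ k * r ^+ n)).
Proof.
elim: k r => [|k ih] r /andP[r0 r1].
  have -> : (fun n => n%:R ^+ 0 * r ^+ n) = geometric 1 r.
    by apply/funext => n; rewrite /geometric /= expr0.
  by apply: is_cvg_geometric_series; rewrite ger0_norm.
(* With r < s < 1, one factor n is absorbed by (r / s)^n, and the induction hypothesis applies at
   the ratio s. *)
pose s := (r + 1) / 2.
have s01 : 0 <= s < 1 by rewrite /s; apply/andP; split; lra.
have s0 : 0 < s by rewrite /s; lra.
have x01 : 0 <= r / s < 1.
  by rewrite divr_ge0 ?(ltW s0) //= ltr_pdivrMr // mul1r /s; lra.
apply: (@series_le_cvg _ _ (fun n => (1 - r / s)^-1 * (n%:R ^+ k * s ^+ n))).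
- by move=> n; rewrite mulr_ge0 ?exprn_ge0.
- by move=> n; rewrite !mulr_ge0 ?exprn_ge0 ?(ltW s0) // invr_ge0; case/andP: x01 => _ h; lra.
- move=> n.
  have -> : n%:R ^+ k.+1 * r ^+ n = (n%:R * (r / s) ^+ n) * (n%:R ^+ k * s ^+ n).
    rewrite exprS expr_div_n; field.
    by rewrite expf_neq0 // gt_eqF.
  by rewrite ler_wpM2r ?geometric_bound // mulr_ge0 ?exprn_ge0 // ltW.
- have -> : (fun n => (1 - r / s)^-1 * (n%:R ^+ k * s ^+ n)) =
     (1 - r / s)^-1 *: (fun n => n%:R ^+ k * s ^+ n) :> (nat -> R) by apply/funext.
  by apply: is_cvg_seriesZ; exact: ih.
Qed.

Lemma cvg_series_scale (c : R) M : cvgn (series M) -> cvgn (series (fun n => c * M n)).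
Proof.
move=> h; have -> : (fun n => c * M n) = c *: M by apply/funext.
exact: is_cvg_seriesZ.
Qed.

End ComplexSeries.

(** * A double sum governed by the addition formula of the cotangent *)

Section CotangentIdentity.
Context {R : realType}.
Implicit Types (u h a b : nat -> R[i]).

(** The absolute difference: with truncated subtraction one summand is always 0. *)
Definition dist (m n : nat) : nat := (m - n + (n - m))%N.

Lemma distC m n : dist m n = dist n m.
Proof. by rewrite /dist addnC. Qed.

Lemma dist_ltn m n : (m < n)%N -> dist m n = (n - m)%N.
Proof. by rewrite /dist; lia. Qed.

(** The pairs k, m < M with k + m >= M. They form the error of the finite identity, and carry terms
    of size r^M. *)
Definition corner (g : nat -> nat -> R[i]) (M : nat) : R[i] :=
  \sum_(0 <= k < M) \sum_(M - k <= m < M) g k m.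

(** Passing to M + 1, the antidiagonal k + m = M leaves the corner while column and row M enter it.
    At k = 0 the entering and leaving terms coincide. *)
Lemma cornerS g M : corner g M.+1 = corner g M +
  \sum_(0 <= k < M) (g k M - g k (M - k)%N) + \sum_(1 <= m < M.+1) g M m.
Proof.
rewrite /corner big_nat_recr //= subSnn; congr (_ + _).
rewrite -big_split /= !big_nat; apply: eq_bigr => k kM.
have [-> |k0] := posnP k; first by rewrite !subn0 subrr addr0 !big_geq.
rewrite big_nat_recr /=; last by lia.
rewrite [in RHS]big_ltn /=; last by lia.
by rewrite subSn; [ring|lia].
Qed.

Section Recurrence.
Variables (u h : nat -> R[i]).
Hypotheses (u0 : u 0%N = 0) (h0 : h 0%N = 0).
Hypothesis uM : forall m n, (0 < m)%N -> (0 < n)%N ->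
  u m * u n = u (m + n)%N * (1 + u m + u n).

(* [u m * u n = u (m + n) * (1 + u m + u n)] is the addition formula of the cotangent; summed against
   [h] it turns a product of Lambert series into linear terms, and [h j = j ^ 2], [j ^ 4] and their
   alternating versions give Ramanujan's differential equations at levels 1 and 2. *)
Definition cot_term k : R[i] :=
  2 * h k * u k ^+ 2 - 2 * u k * \sum_(0 <= j < k) h j - (k%:R - 1) * h k * u k.

Lemma cot_identity_finite M :
  \sum_(0 <= m < M) \sum_(0 <= n < M) u m * u n * (h (dist m n) - h (m + n)%N) =
  series cot_term M - corner (fun k m => (2 * h k + h (k + m)%N) * (u k * u m)) M.
Proof.
elim: M => [|M ih]; first by rewrite /corner /series /= !big_geq // subrr.
rewrite big_nat_recr //= seriesSr cornerS.
under eq_bigr => m _ do rewrite big_nat_recr //=.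
rewrite big_split /= ih {ih} big_nat_recr //=.
case: M => [|M].
  rewrite /corner /cot_term u0 /series /= !big_geq //; ring.
have e1 : \sum_(0 <= i < M.+1) u M.+1 * u i * (h (dist M.+1 i) - h (M.+1 + i)%N) =
          \sum_(0 <= i < M.+1) u i * u M.+1 * (h (dist i M.+1) - h (i + M.+1)%N).
  by apply: eq_bigr => i _; rewrite distC addnC [u i * _]mulrC.
have e2 : \sum_(0 <= i < M.+1) u i * u M.+1 * (h (dist i M.+1) - h (i + M.+1)%N) =
  \sum_(0 <= i < M) u i.+1 * u M.+1 * h (M - i)%N
   - \sum_(0 <= i < M) u i.+1 * u M.+1 * h (i.+1 + M.+1)%N.
  rewrite big_nat_recl //= u0 !mul0r add0r -sumrB !big_nat.
  by apply: eq_bigr => i iM; rewrite mulrBr dist_ltn // subSS.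
(* The products u (k + 1) u (M - k) have index sum M + 1, so [uM] replaces each by a multiple of u
   (M + 1). *)
have e3 : \sum_(0 <= k < M.+1) ((2 * h k + h (k + M.+1)%N) * (u k * u M.+1) -
      (2 * h k + h (k + (M.+1 - k))%N) * (u k * u (M.+1 - k)%N)) =
  \sum_(0 <= k < M) (2 * h k.+1 * u k.+1 * u M.+1)
  + \sum_(0 <= i < M) u i.+1 * u M.+1 * h (i.+1 + M.+1)%N
  - \sum_(0 <= k < M) ((2 * h k.+1 + h M.+1) * (u M.+1 * (1 + u k.+1 + u (M - k)%N))).
  rewrite big_nat_recl //= u0 !(mul0r, mulr0) subrr add0r -big_split /= -sumrB !big_nat.
  apply: eq_bigr => k kM; rewrite subSS [u k.+1 * u (M - k)%N]uM //; last by lia.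
  have -> : (k.+1 + (M - k) = M.+1)%N by lia.
  ring.
have e4 : \sum_(1 <= m < M.+2) (2 * h M.+1 + h (M.+1 + m)%N) * (u M.+1 * u m) =
   2 * h M.+1 * u M.+1 * \sum_(0 <= k < M) u k.+1 +
   \sum_(0 <= i < M) u i.+1 * u M.+1 * h (i.+1 + M.+1)%N +
   (2 * h M.+1 + h (M.+1 + M.+1)%N) * u M.+1 ^+ 2.
  rewrite big_nat_recr //= big_add1 /= mulr_sumr -big_split /= expr2; congr (_ + _).
  by apply: eq_bigr => i _; rewrite [(M.+1 + _)%N]addnC; ring.
have e5 : \sum_(0 <= j < M.+1) h j = \sum_(0 <= k < M) h k.+1.
  by rewrite big_nat_recl //= h0 add0r.
have e6 : \sum_(0 <= k < M) ((2 * h k.+1 + h M.+1) * (u M.+1 * (1 + u k.+1 + u (M - k)%N))) =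
  2 * u M.+1 * (\sum_(0 <= k < M) h k.+1) + h M.+1 * u M.+1 * M%:R +
  \sum_(0 <= k < M) (2 * h k.+1 * u k.+1 * u M.+1) +
  h M.+1 * u M.+1 * (\sum_(0 <= k < M) u k.+1) +
  2 * (\sum_(0 <= i < M) u i.+1 * u M.+1 * h (M - i)%N) +
  h M.+1 * u M.+1 * (\sum_(0 <= k < M) u k.+1).
  have r1 : \sum_(0 <= i < M) u i.+1 * u M.+1 * h (M - i)%N =
            \sum_(0 <= i < M) u (M - i)%N * u M.+1 * h i.+1.
    rewrite big_nat_rev /= add0n !big_nat; apply: eq_bigr => i iM.
    have -> : (M - i.+1).+1 = (M - i)%N by lia.
    by have -> : (M - (M - i.+1) = i.+1)%N by lia.
  have r2 : h M.+1 * u M.+1 * (\sum_(0 <= k < M) u k.+1) =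
    \sum_(0 <= k < M) h M.+1 * u M.+1 * u (M - k)%N.
    rewrite mulr_sumr big_nat_rev /= add0n !big_nat; apply: eq_bigr => i iM.
    by have -> : (M - i.+1).+1 = (M - i)%N by lia.
  have r3 : h M.+1 * u M.+1 * M%:R = \sum_(0 <= k < M) h M.+1 * u M.+1.
    by rewrite sumr_const_nat subn0 mulr_natr.
  rewrite {2}r2 r1 r3 !mulr_sumr -!big_split /=; apply: eq_bigr => i _; ring.
rewrite e1 e3 e4 e6 e2 /cot_term e5 /dist subnn addn0 h0 -natr1; ring.
Qed.

(** The corner has at most M^2 pairs, whence the exponent p + 2 against r^M. *)
Lemma corner_tends0 (g : nat -> nat -> R[i]) (C r : R) p :
  0 <= r < 1 -> 0 <= C ->
  (forall k m M, (k < M)%N -> (m < M)%N -> (M <= k + m)%N -> nm (g k m) <= C * M%:R ^+ p * r ^+ M) ->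
  tends \oo (corner g) 0.
Proof.
move=> r01 C0 hg.
apply: (@tends_squeeze R _ _ _ _ _ (fun M => C * (M%:R ^+ p.+2 * r ^+ M))).
  near=> M; rewrite subr0 /corner; apply: le_trans (nm_sum _ _ _) _.
  apply: (@le_trans _ _ (\sum_(0 <= k < M) M%:R * (C * M%:R ^+ p * r ^+ M))).
    rewrite !big_nat; apply: ler_sum => k kM.
    apply: le_trans (nm_sum _ _ _) _.
    apply: (@le_trans _ _ (\sum_(M - k <= m < M) C * M%:R ^+ p * r ^+ M)).
      rewrite !big_nat; apply: ler_sum => m mM; apply: hg; lia.
    rewrite sumr_const_nat -[leLHS]mulr_natl; apply: ler_wpM2r; last by rewrite ler_nat; lia.
    by rewrite !mulr_ge0 ?exprn_ge0 //; case/andP: r01.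
  by rewrite sumr_const_nat subn0 -[leLHS]mulr_natl !exprS le_eqVlt; apply/orP; left; apply/eqP; ring.
rewrite -(mulr0 C); apply: cvgM; first exact: cvg_cst.
apply: cvg_series_cvg_0; exact: cvg_polygeometric.
Unshelve. all: by end_near. Qed.

(** The limit of [cot_identity_finite]: when h (|m - n|) - h (m + n) separates the variables, the
    double sum becomes a product of two series. *)
Lemma cot_identity a b (c : R[i]) (C r K : R) p :
  0 <= r < 1 -> (forall n, nm (u n) <= C * r ^+ n) -> 0 <= C ->
  0 <= K -> (forall n, nm (h n) <= K * n%:R ^+ p) ->
  (forall m n, h (dist m n) - h (m + n)%N = c * (a m * b n + b m * a n)) ->
  csummable (fun n => a n * u n) -> csummable (fun n => b n * u n) ->
  csummable cot_term ->
  2 * c * csum (fun n => a n * u n) * csum (fun n => b n * u n) = csum cot_term.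
Proof.
move=> r01 uC C0 K0 hK hab sa sb sv.
case/andP: (r01) => r0 r1.
have E0 : tends \oo (corner (fun k m => (2 * h k + h (k + m)%N) * (u k * u m))) 0.
  (* 3 = 2 + 1 from the coefficients of [h], 2^p from k + m <= 2 M, and C^2 from the product of the
     two values of [u]. *)
  apply: (@corner_tends0 _ (3 * K * 2 ^+ p * C ^+ 2) r p) => //.
    by rewrite !mulr_ge0 ?exprn_ge0.
  move=> k m M kM mM Mkm; rewrite !nmM.
  have hb n : (n <= M + M)%N -> nm (h n) <= K * (2 * M%:R) ^+ p.
    move=> nM; apply: le_trans (hK n) _; apply: ler_wpM2l => //.
    rewrite lerXn2r ?nnegrE ?mulr_ge0 // -natrM ler_nat; lia.
  have -> : 3 * K * 2 ^+ p * C ^+ 2 * M%:R ^+ p * r ^+ M =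
     (3 * (K * (2 * M%:R) ^+ p)) * (C ^+ 2 * r ^+ M) by rewrite exprMn; ring.
  apply: ler_pM; rewrite ?nm_ge0 ?mulr_ge0 ?nm_ge0 //.
    apply: le_trans (nmD _ _) _; rewrite nmM nm_nat.
    have := hb k; have := hb (k + m)%N; move=> /(_ ltac:(lia)) h1 /(_ ltac:(lia)) h2.
    lra.
  apply: (@le_trans _ _ (C * r ^+ k * (C * r ^+ m))).
    by apply: ler_pM; rewrite ?nm_ge0.
  rewrite mulrACA -expr2 -exprD ler_wpM2l ?exprn_ge0 //.
  by rewrite ler_wiXn2l // ltW.
have hL : tends \oo (fun M => 2 * c * series (fun n => a n * u n) M * series (fun n => b n * u n) M)
   (csum cot_term).
  apply: (@tends_near R _ \oo _ (fun M => series cot_term M -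
     corner (fun k m => (2 * h k + h (k + m)%N) * (u k * u m)) M)).
    near=> M; rewrite -cot_identity_finite.
    under eq_bigr => m _ do under eq_bigr => n _ do rewrite hab.
    have -> : 2 * c * series (fun n => a n * u n) M * series (fun n => b n * u n) M =
      c * (series (fun n => a n * u n) M * series (fun n => b n * u n) M) +
      c * (series (fun n => b n * u n) M * series (fun n => a n * u n) M) by ring.
    rewrite /series /= !mulr_suml !mulr_sumr -big_split /=; apply: eq_bigr => m _.
    by rewrite !mulr_sumr -big_split /=; apply: eq_bigr => n _; ring.
  by rewrite -[X in tends _ _ X]subr0; exact: tendsB.
apply: tends_unique hL; apply: tendsM => //; apply: tendsM => //; exact: tends_cst.
Unshelve. all: by end_near. Qed.

End Recurrence.
End CotangentIdentity.

(** * Terms of Lambert series *)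

Section LambertSeries.
Context {R : realType}.
Implicit Types (q w z : R[i]) (k n : nat).

Definition lam q n : R[i] := q ^+ n / (1 - q ^+ n).

Lemma lam0 q : lam q 0 = 0.
Proof. by rewrite /lam expr0 subrr invr0 mulr0. Qed.

Lemma nm_expr_lt1 q n : nm q < 1 -> (0 < n)%N -> nm (q ^+ n) <= nm q.
Proof.
by move=> q1 n0; rewrite nmX -[leRHS]expr1 ler_wiXn2l ?nm_ge0 // ltW.
Qed.

Lemma nm_1subX_ge q n (r : R) : nm q <= r -> r < 1 -> (0 < n)%N -> 1 - r <= nm (1 - q ^+ n).
Proof.
move=> qr r1 n0; apply: le_trans (nm_sub_ge _ _); rewrite nm1 lerD2l lerN2.
by apply: (le_trans _ qr); apply: nm_expr_lt1 => //; exact: le_lt_trans qr r1.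
Qed.

Lemma oneBX_neq0 q n : nm q < 1 -> (0 < n)%N -> 1 - q ^+ n != 0.
Proof.
move=> q1 n0; rewrite -nm_gt0; apply: lt_le_trans (nm_1subX_ge (lexx _) q1 n0).
by rewrite subr_gt0.
Qed.

(** For q = e^(i x), 1/2 + [lam q n] is (i / 2) cot (n x / 2), and this is the addition formula of
    the cotangent. *)
Lemma lamM q m n : nm q < 1 -> (0 < m)%N -> (0 < n)%N ->
  lam q m * lam q n = lam q (m + n) * (1 + lam q m + lam q n).
Proof.
move=> q1 m0 n0; have h1 := oneBX_neq0 q1 m0; have h2 := oneBX_neq0 q1 n0.
have h3 : 1 - q ^+ (m + n) != 0 by apply: oneBX_neq0 => //; lia.
rewrite /lam exprD; rewrite exprD in h3; move: h1 h2 h3; set a := q ^+ m; set b := q ^+ n => h1 h2 h3; field; by apply/and3P.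
Qed.

Lemma lam_bound q n : nm q < 1 -> nm (lam q n) <= (1 - nm q)^-1 * nm q ^+ n.
Proof.
move=> q1; have d0 : 0 < 1 - nm q by rewrite subr_gt0.
have [->|n0] := posnP n; first by rewrite lam0 nm0 mulr1 invr_ge0 ltW.
rewrite /lam nmM nmX mulrC nmV ler_wpM2r ?exprn_ge0 ?nm_ge0 //.
by rewrite lef_pV2 ?posrE ?nm_gt0 ?oneBX_neq0 // nm_1subX_ge.
Qed.

Lemma lam_sqr q n : nm q < 1 -> (0 < n)%N ->
  lam q n + lam q n ^+ 2 = q ^+ n / (1 - q ^+ n) ^+ 2.
Proof. by move=> q1 n0; have h := oneBX_neq0 q1 n0; rewrite /lam; field. Qed.

Lemma nm_bounded_lam (c : nat -> R[i]) k q : nm q < 1 -> (forall n, nm (c n) <= n%:R ^+ k) ->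
  csummable (fun n => c n * lam q n).
Proof.
move=> q1 hc.
apply: (@csummable_major _ _ (fun n => (1 - nm q)^-1 * (n%:R ^+ k * nm q ^+ n))).
  by move=> n; rewrite nmM mulrCA; apply: ler_pM; rewrite ?nm_ge0 ?lam_bound.
by apply/cvg_series_scale/cvg_polygeometric; rewrite nm_ge0.
Qed.

Lemma nm_bounded_lam2 (c : nat -> R[i]) k q : nm q < 1 -> (forall n, nm (c n) <= n%:R ^+ k) ->
  csummable (fun n => c n * (lam q n + lam q n ^+ 2)).
Proof.
move=> q1 hc; have d0 : 0 < 1 - nm q by rewrite subr_gt0.
pose C := (1 - nm q)^-1.
have C0 : 0 <= C by rewrite invr_ge0 ltW.
apply: (@csummable_major _ _ (fun n => (C + C ^+ 2) * (n%:R ^+ k * nm q ^+ n))).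
  move=> n; rewrite nmM mulrCA; apply: ler_pM; rewrite ?nm_ge0 //.
  apply: le_trans (nmD _ _) _; rewrite mulrDl; apply: lerD; first exact: lam_bound.
  rewrite nmX; apply: (@le_trans _ _ ((C * nm q ^+ n) ^+ 2)).
    by rewrite lerXn2r ?nnegrE ?nm_ge0 ?mulr_ge0 ?exprn_ge0 ?nm_ge0 ?lam_bound.
  rewrite exprMn ler_wpM2l ?exprn_ge0 // expr2 ler_piMr ?exprn_ge0 ?nm_ge0 //.
  by rewrite exprn_ile1 ?nm_ge0 // ltW.
by apply/cvg_series_scale/cvg_polygeometric; rewrite nm_ge0.
Qed.

Lemma nm_natX k n : nm (n%:R ^+ k) <= n%:R ^+ k :> R.
Proof. by rewrite nmX nm_nat. Qed.

Lemma nm_signX k n : nm ((-1) ^+ n * n%:R ^+ k) <= n%:R ^+ k :> R.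
Proof. by rewrite nmM !nmX nmN nm1 expr1n mul1r nm_nat. Qed.

End LambertSeries.

(** Locked, so that the limit inside stays opaque to conversion in the large algebraic goals. *)
HB.lock Definition phi {R : realType} (k : nat) (q : R[i]) : R[i] :=
  csum (fun n => n%:R ^+ k * lam q n).

(** * Ramanujan's convolution identities at levels 1 and 2 *)

Section LambertIdentities.
Context {R : realType}.
Implicit Types (q w z : R[i]) (k n : nat).

Lemma phiE k q : phi k q = csum (fun n => n%:R ^+ k * lam q n).
Proof. by rewrite phi.unlock. Qed.

(** This is [q d/dq] applied to [phi k] term by term, since it sends [lam q n] to n (lam + lam^2);
    see [qdif_phi]. *)
Definition psi k q : R[i] := csum (fun n => n%:R ^+ k.+1 * (lam q n + lam q n ^+ 2)).
Definition sphi k q : R[i] := csum (fun n => (-1) ^+ n * n%:R ^+ k * lam q n).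
Definition spsi k q : R[i] := csum (fun n => (-1) ^+ n * n%:R ^+ k.+1 * (lam q n + lam q n ^+ 2)).

Lemma phi_summable k q : nm q < 1 -> csummable (fun n => n%:R ^+ k * lam q n).
Proof. by move=> q1; apply: (nm_bounded_lam (k := k)) => // n; exact: nm_natX. Qed.
Lemma psi_summable k q : nm q < 1 ->
  csummable (fun n => n%:R ^+ k.+1 * (lam q n + lam q n ^+ 2)).
Proof. by move=> q1; apply: (nm_bounded_lam2 (k := k.+1)) => // n; exact: nm_natX. Qed.
Lemma sphi_summable k q : nm q < 1 -> csummable (fun n => (-1) ^+ n * n%:R ^+ k * lam q n).
Proof. by move=> q1; apply: (nm_bounded_lam (k := k)) => // n; exact: nm_signX. Qed.
Lemma spsi_summable k q : nm q < 1 ->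
  csummable (fun n => (-1) ^+ n * n%:R ^+ k.+1 * (lam q n + lam q n ^+ 2)).
Proof. by move=> q1; apply: (nm_bounded_lam2 (k := k.+1)) => // n; exact: nm_signX. Qed.

(** Write (-1)^n as 2 [n even] - 1 and compare partial sums of even length. With [lam_double] the
    even terms form a Lambert series at q^2, which is how level 2 arises. *)
Lemma csum_sign (a b : nat -> R[i]) : csummable a -> csummable b ->
  csummable (fun n => (-1) ^+ n * a n) -> (forall n, a n.*2 = b n) ->
  csum (fun n => (-1) ^+ n * a n) = 2 * csum b - csum a.
Proof.
move=> sa sb ss ab.
have dbl (u : nat -> R[i]) : csummable u -> tends \oo (fun n => series u n.*2) (csum u).
  move=> su e e0; have [N _ hN] := su e e0; exists N => // n /= Nn; apply: hN => /=.
  by rewrite -addnn (leq_trans Nn) ?leq_addr.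
apply: (tends_unique _ (dbl _ ss)).
apply: (@tends_near R _ \oo _ (fun n => 2 * series b n - series a n.*2)); last first.
  by apply: tendsB; [apply: tendsM => //; exact: tends_cst|exact: dbl].
near=> n; rewrite /series /=; elim: (n) => [|m ih]; first by rewrite !big_geq //; ring.
rewrite doubleS !big_nat_recr //= -ih ab -[(-1) ^+ m.*2.+1]signr_odd -[(-1) ^+ m.*2]signr_odd /=.
by rewrite odd_double /= expr0 expr1; ring.
Unshelve. all: by end_near. Qed.

Lemma lam_double q n : lam q n.*2 = lam (q ^+ 2) n.
Proof. by rewrite /lam -exprM mul2n. Qed.

Lemma nm_sqr_lt1 q : nm q < 1 -> nm (q ^+ 2) < 1.
Proof. by move=> q1; apply: (le_lt_trans _ q1); exact: nm_expr_lt1. Qed.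

Lemma sphiE k q : nm q < 1 -> sphi k q = 2 ^+ k.+1 * phi k (q ^+ 2) - phi k q.
Proof.
move=> q1; rewrite /sphi; have q2 := nm_sqr_lt1 q1.
have -> : (fun n => (-1) ^+ n * n%:R ^+ k * lam q n) = (fun n => (-1) ^+ n * (n%:R ^+ k * lam q n)).
  by apply/funext => n; rewrite -mulrA.
rewrite (@csum_sign _ (fun n => 2 ^+ k * (n%:R ^+ k * lam (q ^+ 2) n))).
- by rewrite csumZ; [rewrite -!phiE [2 ^+ k.+1]exprS mulrA|exact: phi_summable].
- exact: phi_summable.
- by apply: csummable_tends (csummableZ _ _); exact: phi_summable.
- have := sphi_summable k q1; congr csummable; apply/funext => n; by rewrite -mulrA.
- by move=> n; rewrite lam_double -muln2 natrM exprMn; ring.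
Qed.

Lemma spsiE k q : nm q < 1 -> spsi k q = 2 ^+ k.+2 * psi k (q ^+ 2) - psi k q.
Proof.
move=> q1; rewrite /spsi; have q2 := nm_sqr_lt1 q1.
have -> : (fun n => (-1) ^+ n * n%:R ^+ k.+1 * (lam q n + lam q n ^+ 2)) =
   (fun n => (-1) ^+ n * (n%:R ^+ k.+1 * (lam q n + lam q n ^+ 2))).
  by apply/funext => n; rewrite -mulrA.
rewrite (@csum_sign _ (fun n => 2 ^+ k.+1 * (n%:R ^+ k.+1 * (lam (q ^+ 2) n + lam (q ^+ 2) n ^+ 2)))).
- by rewrite csumZ; [rewrite -/(psi k (q ^+ 2)) [2 ^+ k.+2]exprS mulrA|exact: psi_summable].
- exact: psi_summable.
- by apply: csummable_tends (csummableZ _ _); exact: psi_summable.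
- have := spsi_summable k q1; congr csummable; apply/funext => n; by rewrite -mulrA.
- by move=> n; rewrite lam_double -muln2 natrM exprMn; ring.
Qed.

Lemma natr_dist (m n : nat) : (dist m n)%:R ^+ 2 = (m%:R - n%:R) ^+ 2 :> R[i].
Proof.
rewrite /dist; have [mn|/ltnW nm'] := leqP m n.
  by rewrite (eqP mn) add0n natrB // -sqrrN opprB.
by have := nm'; rewrite -subn_eq0 => /eqP ->; rewrite addn0 natrB.
Qed.

Lemma sign_dist (m n : nat) : (-1) ^+ (dist m n) = (-1) ^+ (m + n) :> R[i].
Proof.
rewrite -signr_odd -[RHS]signr_odd; congr (_ ^+ (nat_of_bool _)).
rewrite /dist; have [mn|/ltnW nm'] := leqP m n.
  by rewrite (eqP mn) add0n oddB // oddD addbC.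
by have := nm'; rewrite -subn_eq0 => /eqP ->; rewrite addn0 oddB // oddD.
Qed.

Lemma csum_comb3 (a b c d : nat -> R[i]) (x y t : R[i]) :
  csummable a -> csummable b -> csummable c -> csummable d ->
  tends \oo (series (fun n => 2 * a n + x * b n + y * c n + t * d n))
     (2 * csum a + x * csum b + y * csum c + t * csum d).
Proof.
move=> sa sb sc sd; apply: tends_near (tendsD (tendsD (tendsD (csummableZ 2 sa) (csummableZ x sb))
  (csummableZ y sc)) (csummableZ t sd)).
by near=> n; rewrite /series /= !big_split.
Unshelve. all: by end_near. Qed.

(** Weight h j = j^2: (m - n)^2 - (m + n)^2 = -4 m n, and c = -2 because [cot_identity] counts the
    product a b in both orders. [H] is Faulhaber's formula. *)
Lemma ramanujan_phi1 q : nm q < 1 ->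
  - 4 * phi 1 q * phi 1 q = 2 * psi 1 q - 5 / 3 * phi 3 q - 1 / 3 * phi 1 q.
Proof.
move=> q1; have q0 := nm_ge0 q.
have d0 : 0 < 1 - nm q by rewrite subr_gt0.
have H n : \sum_(0 <= j < n) j%:R ^+ 2 = (2 * n%:R ^+ 3 - 3 * n%:R ^+ 2 + n%:R) / 6 :> R[i].
  elim: n => [|n ih]; first by rewrite big_geq //; field.
  by rewrite big_nat_recr //= ih -natr1; field.
(* The last series has coefficient 0 and only fills the fourth place of [csum_comb3]. *)
have S := csum_comb3 (-5 / 3) (- 1 / 3) 0 (psi_summable 1 q1) (phi_summable 3 q1) (phi_summable 1 q1) (phi_summable 1 q1).
have E : cot_term (lam q) (fun n => n%:R ^+ 2) = (fun n => 2 * (n%:R ^+ 2 * (lam q n + lam q n ^+ 2))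
   + -5 / 3 * (n%:R ^+ 3 * lam q n) + - 1 / 3 * (n%:R ^+ 1 * lam q n) + 0 * (n%:R ^+ 1 * lam q n)).
  by apply/funext => n; rewrite /cot_term H; field.
rewrite -E in S.
have := @cot_identity _ (lam q) (fun n => n%:R ^+ 2) (lam0 q) _ _
  (fun n => n%:R ^+ 1) (fun n => n%:R ^+ 1) (-2) (1 - nm q)^-1 (nm q) 1 2 _ _ _ _ _ _ _ _ (csummable_tends S).
rewrite (csumE S) -!phiE -/(psi 1 q) => h.
have -> : - 4 * phi 1 q * phi 1 q = 2 * -2 * phi 1 q * phi 1 q by ring.
rewrite h ?nm_ge0 ?expr0n ?invr_ge0 ?(ltW d0) //; first by ring.
- by move=> m n m0 n0; exact: lamM.
- by move=> n; exact: lam_bound.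
- by move=> n; rewrite mul1r; exact: nm_natX.
- by move=> m n; rewrite natr_dist natrD; ring.
- exact: phi_summable.
- exact: phi_summable.
Qed.

(** Weight h j = j^4: (m - n)^4 - (m + n)^4 = -8 (m n^3 + m^3 n), so c = -8. *)
Lemma ramanujan_phi3 q : nm q < 1 ->
  - 16 * phi 1 q * phi 3 q = 2 * psi 3 q - 7 / 5 * phi 5 q - 2 / 3 * phi 3 q + 1 / 15 * phi 1 q.
Proof.
move=> q1; have q0 := nm_ge0 q.
have d0 : 0 < 1 - nm q by rewrite subr_gt0.
have H n : \sum_(0 <= j < n) j%:R ^+ 4 = n%:R ^+ 5 / 5 - n%:R ^+ 4 / 2 + n%:R ^+ 3 / 3 - n%:R / 30 :> R[i].
  elim: n => [|n ih]; first by rewrite big_geq //; field.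
  by rewrite big_nat_recr //= ih -natr1; field.
have S := csum_comb3 (-7 / 5) (- 2 / 3) (1 / 15) (psi_summable 3 q1) (phi_summable 5 q1) (phi_summable 3 q1) (phi_summable 1 q1).
have E : cot_term (lam q) (fun n => n%:R ^+ 4) = (fun n => 2 * (n%:R ^+ 4 * (lam q n + lam q n ^+ 2))
   + -7 / 5 * (n%:R ^+ 5 * lam q n) + - 2 / 3 * (n%:R ^+ 3 * lam q n) + 1 / 15 * (n%:R ^+ 1 * lam q n)).
  by apply/funext => n; rewrite /cot_term H; field.
rewrite -E in S.
have := @cot_identity _ (lam q) (fun n => n%:R ^+ 4) (lam0 q) _ _
  (fun n => n%:R ^+ 1) (fun n => n%:R ^+ 3) (-8) (1 - nm q)^-1 (nm q) 1 4 _ _ _ _ _ _ _ _ (csummable_tends S).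
rewrite (csumE S) -!phiE -/(psi 3 q) => h.
have -> : - 16 * phi 1 q * phi 3 q = 2 * -8 * phi 1 q * phi 3 q by ring.
rewrite h ?nm_ge0 ?expr0n ?invr_ge0 ?(ltW d0) //; first by ring.
- by move=> m n m0 n0; exact: lamM.
- by move=> n; exact: lam_bound.
- by move=> n; rewrite mul1r; exact: nm_natX.
- by move=> m n; rewrite -[4%N]/(2 * 2)%N exprM natr_dist natrD; ring.
- exact: phi_summable.
- exact: phi_summable.
Qed.

(** The signs separate as well, because |m - n| and m + n have the same parity; the constant c is
    that of the weight without signs. *)
Lemma ramanujan_sphi1 q : nm q < 1 ->
  - 4 * sphi 1 q * sphi 1 q = 2 * spsi 1 q - sphi 3 q - sphi 1 q.
Proof.
move=> q1; have q0 := nm_ge0 q.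
have d0 : 0 < 1 - nm q by rewrite subr_gt0.
have H n : \sum_(0 <= j < n) (-1) ^+ j * j%:R ^+ 2 = - (-1) ^+ n * (n%:R ^+ 2 - n%:R) / 2 :> R[i].
  elim: n => [|n ih]; first by rewrite big_geq //; field.
  by rewrite big_nat_recr //= ih -natr1 [(-1) ^+ n.+1]exprS; move: ((-1) ^+ n) => s; field.
have S := csum_comb3 (-1) (-1) 0 (spsi_summable 1 q1) (sphi_summable 3 q1) (sphi_summable 1 q1) (sphi_summable 1 q1).
have E : cot_term (lam q) (fun n => (-1) ^+ n * n%:R ^+ 2) = (fun n => 2 * ((-1) ^+ n * n%:R ^+ 2 * (lam q n + lam q n ^+ 2))
   + -1 * ((-1) ^+ n * n%:R ^+ 3 * lam q n) + - 1 * ((-1) ^+ n * n%:R ^+ 1 * lam q n) + 0 * ((-1) ^+ n * n%:R ^+ 1 * lam q n)).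
  by apply/funext => n; rewrite /cot_term H; move: ((-1) ^+ n) => s; field.
rewrite -E in S.
have := @cot_identity _ (lam q) (fun n => (-1) ^+ n * n%:R ^+ 2) (lam0 q) _ _
  (fun n => (-1) ^+ n * n%:R ^+ 1) (fun n => (-1) ^+ n * n%:R ^+ 1) (-2) (1 - nm q)^-1 (nm q) 1 2 _ _ _ _ _ _ _ _ (csummable_tends S).
rewrite (csumE S) -/(sphi 1 q) -/(sphi 3 q) -/(spsi 1 q) => h.
have -> : - 4 * sphi 1 q * sphi 1 q = 2 * -2 * sphi 1 q * sphi 1 q by ring.
rewrite h ?nm_ge0 ?expr0n ?mulr0 ?invr_ge0 ?(ltW d0) //; first by ring.
- by move=> m n m0 n0; exact: lamM.
- by move=> n; exact: lam_bound.
- by move=> n; rewrite mul1r; exact: nm_signX.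
- by move=> m n; rewrite natr_dist sign_dist natrD exprD; ring.
- exact: sphi_summable.
- exact: sphi_summable.
Qed.

Lemma ramanujan_sphi3 q : nm q < 1 ->
  - 16 * sphi 1 q * sphi 3 q = 2 * spsi 3 q - sphi 5 q - 2 * sphi 3 q + sphi 1 q.
Proof.
move=> q1; have q0 := nm_ge0 q.
have d0 : 0 < 1 - nm q by rewrite subr_gt0.
have H n : \sum_(0 <= j < n) (-1) ^+ j * j%:R ^+ 4 =
     - (-1) ^+ n * (n%:R ^+ 4 - 2 * n%:R ^+ 3 + n%:R) / 2 :> R[i].
  elim: n => [|n ih]; first by rewrite big_geq //; field.
  by rewrite big_nat_recr //= ih -natr1 [(-1) ^+ n.+1]exprS; move: ((-1) ^+ n) => s; field.
have S := csum_comb3 (-1) (-2) 1 (spsi_summable 3 q1) (sphi_summable 5 q1) (sphi_summable 3 q1) (sphi_summable 1 q1).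
have E : cot_term (lam q) (fun n => (-1) ^+ n * n%:R ^+ 4) = (fun n => 2 * ((-1) ^+ n * n%:R ^+ 4 * (lam q n + lam q n ^+ 2))
   + -1 * ((-1) ^+ n * n%:R ^+ 5 * lam q n) + - 2 * ((-1) ^+ n * n%:R ^+ 3 * lam q n) + 1 * ((-1) ^+ n * n%:R ^+ 1 * lam q n)).
  by apply/funext => n; rewrite /cot_term H; move: ((-1) ^+ n) => s; field.
rewrite -E in S.
have := @cot_identity _ (lam q) (fun n => (-1) ^+ n * n%:R ^+ 4) (lam0 q) _ _
  (fun n => (-1) ^+ n * n%:R ^+ 1) (fun n => (-1) ^+ n * n%:R ^+ 3) (-8) (1 - nm q)^-1 (nm q) 1 4 _ _ _ _ _ _ _ _ (csummable_tends S).
rewrite (csumE S) -/(sphi 1 q) -/(sphi 3 q) -/(sphi 5 q) -/(spsi 3 q) => h.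
have -> : - 16 * sphi 1 q * sphi 3 q = 2 * -8 * sphi 1 q * sphi 3 q by ring.
rewrite h ?nm_ge0 ?expr0n ?mulr0 ?invr_ge0 ?(ltW d0) //; first by ring.
- by move=> m n m0 n0; exact: lamM.
- by move=> n; exact: lam_bound.
- by move=> n; rewrite mul1r; exact: nm_signX.
- by move=> m n; rewrite sign_dist -[4%N]/(2 * 2)%N exprM natr_dist natrD exprD; ring.
- exact: sphi_summable.
- exact: sphi_summable.
Qed.

End LambertIdentities.

(** * The operator q d/dq, and constancy from a vanishing derivative *)

Section QDerivative.
Context {R : realType}.
Implicit Types (q w z l d e : R[i]) (f g : R[i] -> R[i]) (k n : nat).

(* [D] is the value at [q] of the operator [q d/dq] applied to [f]. *)
Definition qdif f q (D : R[i]) := exists2 d, cdif f q d & q * d = D.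

Lemma qdif_cont f q D : qdif f q D -> tends (cnbhs q) f (f q).
Proof. by case=> d /cdif_cont. Qed.
Lemma qdif_eq f q D D' : qdif f q D -> D = D' -> qdif f q D'.
Proof. by move=> h <-. Qed.
Lemma qdif_near f g q D : (\forall w \near cnbhs q, f w = g w) -> qdif f q D -> qdif g q D.
Proof. by move=> fg [d fd <-]; exists d => //; exact: cdif_near fg fd. Qed.
Lemma qdif_cst c q : qdif (fun=> c) q 0.
Proof. by exists 0; [exact: cdif_cst|rewrite mulr0]. Qed.
Lemma qdif_id q : qdif id q q.
Proof. by exists 1; [exact: cdif_id|rewrite mulr1]. Qed.
Lemma qdifD f g q D E : qdif f q D -> qdif g q E -> qdif (fun w => f w + g w) q (D + E).
Proof. by move=> [d fd <-] [e ge <-]; exists (d + e); [exact: cdifD|ring]. Qed.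
Lemma qdifB f g q D E : qdif f q D -> qdif g q E -> qdif (fun w => f w - g w) q (D - E).
Proof. by move=> [d fd <-] [e ge <-]; exists (d - e); [exact: cdifB|ring]. Qed.
Lemma qdifM f g q D E : qdif f q D -> qdif g q E ->
  qdif (fun w => f w * g w) q (D * g q + f q * E).
Proof. by move=> [d fd <-] [e ge <-]; eexists; [exact: cdifM fd ge|ring]. Qed.
Lemma qdifZ c f q D : qdif f q D -> qdif (fun w => c * f w) q (c * D).
Proof. by move=> [d fd <-]; exists (c * d); [exact: cdifZ|ring]. Qed.
Lemma qdifX f q D n : qdif f q D -> qdif (fun w => f w ^+ n) q (n%:R * f q ^+ n.-1 * D).
Proof. by move=> [d fd <-]; eexists; [exact: (cdifX n fd)|ring]. Qed.
Lemma qdif_div f g q D E : g q != 0 -> qdif f q D -> qdif g q E ->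
  qdif (fun w => f w / g w) q ((D * g q - f q * E) / g q ^+ 2).
Proof. by move=> g0 [d fd <-] [e ge <-]; eexists; [exact: (cdif_div g0 fd ge)|field]. Qed.
Lemma qdif_comp h f q D e : qdif f q D -> cdif h (f q) e -> qdif (fun w => h (f w)) q (e * D).
Proof. by move=> [d fd <-] he; eexists; [exact: cdif_comp fd he|ring]. Qed.
Lemma qdif_sqr f q D : qdif f (q ^+ 2) D -> qdif (fun w => f (w ^+ 2)) q (2 * D).
Proof.
move=> [d fd <-]; eexists; first exact: (cdif_comp (cdifX 2 (cdif_id q)) fd).
by rewrite /=; ring.
Qed.
Lemma qdif0_cdif f q : q != 0 -> qdif f q 0 -> cdif f q 0.
Proof. by move=> q0 [d fd /eqP]; rewrite mulf_eq0 (negPf q0) => /eqP <-. Qed.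

(** [p] abstracts the real and the imaginary part, so that the real mean value theorem can be
    applied to each along a segment. *)
Lemma segment_path_derive (p : R[i] -> R) f z v (s : R) :
  (forall x, `|p x| <= nm x) -> p 0 = 0 -> (forall x y, p (x - y) = p x - p y) ->
  cdif f (z + s%:C * v) 0 -> is_derive s 1 (fun s : R => p (f (z + s%:C * v))) 0.
Proof.
move=> p1 p0 pB [g g0 fg].
have hs : forall P : set R[i], cnbhs (z + s%:C * v) P ->
    exists2 d : R, 0 < d & forall h : R, `|h| < d -> P (z + (h + s)%:C * v).
  move=> P [d d0 hd]; have v1 : 0 < nm v + 1 by rewrite ltr_wpDl ?nm_ge0.
  exists (d / (nm v + 1)); first by rewrite divr_gt0.
  move=> h; rewrite ltr_pdivlMr // => hh; apply: hd.
  have -> : z + (h + s)%:C * v - (z + s%:C * v) = h%:C * v by rewrite rmorphD /=; ring.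
  rewrite nmM nm_real; apply: le_lt_trans hh; rewrite ler_wpM2l // lerDl //.
have cv : (fun h : R => h^-1 *: (p (f (z + (h *: 1 + s)%:C * v)) - p (f (z + s%:C * v)))) @ 0^' --> (0 : R).
  apply/cvgrPdist_lt => e e0.
  have v1 : 0 < nm v + 1 by rewrite ltr_wpDl ?nm_ge0.
  have ev : 0 < e / (nm v + 1) by rewrite divr_gt0.
  have [d d0 hd] := hs _ (filterI fg (g0 _ ev)).
  exists d => // h /=; rewrite sub0r normrN => /hd[fgh]; rewrite subr0 => gh h0.
  rewrite sub0r normrN /GRing.scale /= mulr1 -pB fgh.
  have -> : z + (h + s)%:C * v - (z + s%:C * v) = h%:C * v by rewrite rmorphD /=; ring.
  rewrite normrM normfV; apply: (@le_lt_trans _ _ (`|h|^-1 * nm (h%:C * v * g (z + (h + s)%:C * v)))).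
    by rewrite ler_wpM2l // invr_ge0.
  rewrite !nmM nm_real -mulrA mulKf ?normr_eq0 //.
  rewrite ltr_pdivlMr // mulrC in gh; apply: le_lt_trans gh.
  by rewrite ler_wpM2r ?nm_ge0 // lerDl.
by split; [apply/cvg_ex; exists 0|apply: cvg_lim].
Qed.

Lemma cdif0_segment f z v : (forall s : R, 0 <= s <= 1 -> cdif f (z + s%:C * v) 0) ->
  f (z + v) = f z.
Proof.
move=> h.
have part (p : R[i] -> R) : (forall x, `|p x| <= nm x) -> p 0 = 0 ->
    (forall x y, p (x - y) = p x - p y) -> p (f (z + v)) = p (f z).
  move=> p1 p0 pB; pose F (s : R) := p (f (z + s%:C * v)).
  have dF (s : R) : 0 <= s <= 1 -> is_derive s 1 F 0.
    by move=> /h; exact: segment_path_derive.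
  have [||c _] := @MVT_segment R F (fun=> 0) 0 1 ler01.
  - by move=> x; rewrite in_itv /= => /andP[x0 x1]; apply: dF; rewrite !ltW.
  - apply: derivable_within_continuous => x; rewrite in_itv /= => hx.
    by have [] := dF x hx.
  - by rewrite mul0r /F mul1r mul0r addr0 => /eqP; rewrite subr_eq0 => /eqP.
have e1 := part _ (@nm_Re R) erefl (@cRe_sub R).
have e2 := part _ (@nm_Im R) erefl (@cIm_sub R).
by move: e1 e2; case: (f (z + v)) => a b; case: (f z) => a' b' /= -> ->.
Qed.

Lemma nm_ball_segment z v r (s : R) : nm v < r -> 0 <= s <= 1 -> nm (z + s%:C * v - z) < r.
Proof.
move=> vr /andP[s0 s1]; rewrite addrC addKr nmM nm_real ger0_norm //.
by apply: le_lt_trans vr; rewrite ler_piMl ?nm_ge0.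
Qed.

Lemma cdif0_locally_cst f z : (\forall w \near cnbhs z, cdif f w 0) ->
  \forall w \near cnbhs z, f w = f z.
Proof.
move=> [r r0 hr]; exists r => // w wr; rewrite -(subrKC z w).
by apply: cdif0_segment => s hs; apply: hr; exact: nm_ball_segment.
Qed.

(* A function of derivative zero on the punctured disc is constant along each ray, hence equals its limit at the centre. *)
Lemma punctured_disc_cst f g l q : q != 0 -> nm q < 1 ->
  (forall w, w != 0 -> nm w < 1 -> cdif f w 0) ->
  tends (cnbhs 0) g l -> (\forall w \near cnbhs 0, w != 0 -> f w = g w) -> f q = l.
Proof.
move=> q0 q1 df gl fg.
have ray (s : R) : 0 < s <= 1 -> f (s%:C * q) = f q.
  move=> /andP[s0 s1].
  have -> : f q = f (s%:C * q + (1 - s)%:C * q).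
    by congr f; rewrite rmorphB rmorph1 /=; ring.
  apply/esym/cdif0_segment => x /andP[x0 x1].
  have -> : s%:C * q + x%:C * ((1 - s)%:C * q) = (s + x * (1 - s))%:C * q.
    by rewrite !(rmorphD, rmorphM, rmorphN, rmorph1) /=; ring.
  have p0 : 0 < s + x * (1 - s) by nra.
  have p1 : s + x * (1 - s) <= 1 by nra.
  apply: df; first by rewrite mulf_neq0 // fmorph_eq0 gt_eqF.
  rewrite nmM nm_real gtr0_norm //; apply: le_lt_trans q1.
  by rewrite ler_piMl ?nm_ge0.
have sq : tends (at_right 0) (fun s : R => s%:C * q) 0.
  rewrite -(mul0r q); apply: tendsM; last exact: tends_cst.
  by rewrite -(rmorph0 (real_complex R)); apply/tends_real; apply: cvg_at_right_filter; exact: cvg_id.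
apply: (tends_unique _ (F := at_right 0) (f := fun s : R => f (s%:C * q))).
  apply: (@tends_near R _ _ _ (fun=> f q)); last exact: tends_cst.
  near=> s; rewrite ray //; apply/andP; split; first by near: s; exact: nbhs_right_gt.
  by near: s; exact: nbhs_right_le.
apply: (@tends_near R _ _ _ (fun s : R => g (s%:C * q))); last exact: tends_comp sq gl.
have h := tends_cnbhs sq fg.
near=> s; symmetry.
have : s%:C * q != 0 -> f (s%:C * q) = g (s%:C * q) by near: s; exact: h.
apply; rewrite mulf_neq0 // fmorph_eq0 gt_eqF //; near: s; exact: nbhs_right_gt.
Unshelve. all: by end_near. Qed.

End QDerivative.

(** * Eisenstein series and their differential equations *)

Section EisensteinSeries.
Context {R : realType}.
Implicit Types (q w z : R[i]) (k n : nat).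

(** The difference quotient of the n-th power, written as a polynomial so that it also makes sense
    at w = z. *)
Definition dquot w z n : R[i] := \sum_(i < n) w ^+ (n.-1 - i) * z ^+ i.

Lemma dquotE w z n : w ^+ n - z ^+ n = (w - z) * dquot w z n.
Proof. exact: subrXX. Qed.

Lemma dquot_diag z n : z * dquot z z n = n%:R * z ^+ n.
Proof.
rewrite /dquot mulr_sumr (eq_bigr (fun=> z ^+ n)).
  by rewrite sumr_const card_ord mulr_natl.
by move=> i _; rewrite -exprD -exprS; congr (_ ^+ _); have := ltn_ord i; lia.
Qed.

Lemma dquot_cont z n : tends (cnbhs z) (fun w => dquot w z n) (dquot z z n).
Proof.
apply: tends_sum => i _; apply: tendsM; last exact: tends_cst.
by apply: tendsX; exact: tends_id.
Qed.

Lemma dquot_bound w z n (r : R) : 0 < r -> nm w <= r -> nm z <= r ->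
  nm (dquot w z n) <= r^-1 * (n%:R * r ^+ n).
Proof.
move=> r0 wr zr; apply: le_trans (nm_sum _ _ _) _.
apply: (@le_trans _ _ (\sum_(i < n) r^-1 * r ^+ n)).
  apply: ler_sum => i _; rewrite nmM !nmX.
  apply: (@le_trans _ _ (r ^+ (n.-1 - i) * r ^+ i)).
    by apply: ler_pM; rewrite ?exprn_ge0 ?nm_ge0 // lerXn2r ?nnegrE ?nm_ge0 // ltW.
  have ni := ltn_ord i.
  rewrite -exprD -[X in r ^+ X](_ : n.-1 = _)%N; last by lia.
  by rewrite -[n in leRHS](prednK (n := n)) ?exprS ?mulKf ?gt_eqF //; lia.
by rewrite sumr_const card_ord -[leLHS]mulr_natl mulrCA lexx.
Qed.

Lemma cnbhs_disc z (r : R) : nm z < r -> \forall w \near cnbhs z, nm w < r.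
Proof.
move=> zr; exists (r - nm z); first by rewrite subr_gt0.
move=> w hw; rewrite -(subrK z w); apply: le_lt_trans (nmD _ _) _.
by rewrite -ltrBrDr.
Qed.

(** At q = 0 the equation q d = psi leaves [d] undetermined; the third clause supplies it, and [y4E]
    takes its leading coefficient from there. *)
Lemma cdif_phi k q : nm q < 1 -> exists d, [/\ cdif (phi k) q d, q * d = psi k q &
  q = 0 -> d = 1].
Proof.
move=> q1.
(* From u / (1 - u) - v / (1 - v) = (u - v) / ((1 - u) (1 - v)). *)
pose g n w : R[i] := n%:R ^+ k * (dquot w q n / ((1 - w ^+ n) * (1 - q ^+ n))).
(* Any radius strictly between |q| and 1 would do: on that disc one majorant serves all w. *)
have rq : nm q < (1 + nm q) / 2 by lra.
have r1 : (1 + nm q) / 2 < 1 by lra.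
have r0 : 0 < (1 + nm q) / 2 by have := nm_ge0 q; lra.
move: ((1 + nm q) / 2) rq r1 r0 => r rq r1 r0.
have g_bound w n : nm w < r -> nm (g n w) <= (r^-1 * (1 - r) ^- 2) * (n%:R ^+ k.+1 * r ^+ n).
  move=> wr; have [->|n0] := posnP n.
    by rewrite /g /dquot big_ord0 mul0r mulr0 nm0 expr0n mul0r mulr0.
  rewrite /g !nmM nmX nm_nat nmV nmM.
  have -> : r^-1 * (1 - r) ^- 2 * (n%:R ^+ k.+1 * r ^+ n) =
     n%:R ^+ k * (r^-1 * (n%:R * r ^+ n) * (1 - r) ^- 2) by rewrite [_ ^+ k.+1]exprS; ring.
  rewrite ler_wpM2l ?exprn_ge0 //; apply: ler_pM; rewrite ?nm_ge0 ?invr_ge0 ?mulr_ge0 ?nm_ge0 //.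
    by apply: dquot_bound => //; exact: ltW.
  have d0 : 0 < 1 - r by rewrite subr_gt0.
  have h1 : 1 - r <= nm (1 - w ^+ n) by apply: nm_1subX_ge => //; exact: ltW.
  have h2 : 1 - r <= nm (1 - q ^+ n) by apply: nm_1subX_ge => //; exact: ltW.
  rewrite lef_pV2 ?posrE ?exprn_gt0 ?mulr_gt0 ?(lt_le_trans d0) //.
  by rewrite expr2 ler_pM // ltW.
have Mc : cvgn (series (fun n => (r^-1 * (1 - r) ^- 2) * (n%:R ^+ k.+1 * r ^+ n))).
  by apply/cvg_series_scale/cvg_polygeometric; rewrite (ltW r0).
exists (csum (g ^~ q)); split.
- have -> : phi k = (fun w => csum ((fun n w => n%:R ^+ k * lam w n) ^~ w)).
    by apply/funext => w; rewrite phiE.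
  apply: (@cdif_csum R (fun n w => n%:R ^+ k * lam w n) g) Mc _.
  + near=> w; apply: phi_summable; apply: (lt_trans _ r1); near: w; exact: cnbhs_disc.
  + near=> w; move=> n.
    have [->|n0] := posnP n; first by rewrite !lam0 /g /dquot big_ord0 mul0r !mulr0 subr0.
    have w1 : nm w < 1 by apply: (lt_trans _ r1); near: w; exact: cnbhs_disc.
    have h1 := oneBX_neq0 w1 n0; have h2 := oneBX_neq0 q1 n0.
    rewrite /g [RHS]mulrCA -mulrBr [X in _ = _ * X]mulrA -dquotE /lam; congr (_ * _).
    by field; apply/andP.
  + near=> w; move=> n; apply: g_bound; near: w; exact: cnbhs_disc.
  + move=> n; apply: tendsM; first exact: tends_cst.
    apply: tendsM; first exact: dquot_cont.
    have [->|n0] := posnP n.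
      by apply: tends_near (tends_cst _); near=> w; rewrite !expr0.
    have h2 := oneBX_neq0 q1 n0.
    apply: tendsV; first by rewrite mulf_neq0.
    apply: tendsM; last exact: tends_cst.
    apply: tendsB; first exact: tends_cst.
    by apply: tendsX; exact: tends_id.
- have sg : csummable (g ^~ q) by apply: (csummable_major _ Mc) => n; exact: g_bound.
  rewrite -csumZ //; congr csum; apply/funext => n.
  have [->|n0] := posnP n; first by rewrite /g /dquot big_ord0 mul0r !mulr0 expr0n mul0r.
  rewrite /g lam_sqr // [LHS]mulrCA [q * (_ / _)]mulrA dquot_diag [_ ^+ k.+1]exprS.
  by have h2 := oneBX_neq0 q1 n0; field.
- move=> q0; apply: csumE; apply: (@tends_near R _ \oo _ (fun=> 1)); last exact: tends_cst.
  near=> n; have n2 : (1 < n)%N by near: n; exact: nbhs_infty_gt.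
  rewrite /series /= big_ltn ?(ltnW n2) // big_ltn // big_nat big1 => [|i /andP[i2 _]].
    rewrite /g /dquot big_ord0 mul0r mulr0 big_ord1 !q0 expr1n !expr0 expr1 subr0.
    by rewrite !mul1r invr1 add0r addr0.
  rewrite /g /dquot; case: i i2 => [//|[//|i]] _.
  rewrite big1 ?mul0r ?mulr0 // => j _; rewrite q0 -exprD.
  by rewrite expr0n; have -> : (i.+2.-1 - j + j == 0)%N = false by have := ltn_ord j; lia.
Unshelve. all: by end_near. Qed.

Lemma qdif_phi k q : nm q < 1 -> qdif (phi k) q (psi k q).
Proof. by move=> /(cdif_phi k)[d [h1 h2 _]]; exists d. Qed.

Lemma phi_at0 k : phi k (0 : R[i]) = 0.
Proof.
rewrite phiE; apply: csumE; apply: (@tends_near R _ \oo _ (fun=> 0)); last exact: tends_cst.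
near=> n; rewrite /series /= big1 // => -[|i] _; first by rewrite lam0 mulr0.
by rewrite /lam expr0n mul0r mulr0.
Unshelve. all: by end_near. Qed.

Definition e2 q : R[i] := 1 - 24 * phi 1 q.
Definition e4 q : R[i] := 1 + 240 * phi 3 q.
Definition e6 q : R[i] := 1 - 504 * phi 5 q.
Definition p2 q : R[i] := 2 * e2 (q ^+ 2) - e2 q.
(** It vanishes at the cusp, and together with [p2] it expresses e4 and e6 at both q and q^2. *)
Definition y4 q : R[i] := e4 q - e4 (q ^+ 2).

Lemma qdif_e2 q : nm q < 1 -> qdif e2 q ((e2 q ^+ 2 - e4 q) / 12).
Proof.
move=> q1; apply: qdif_eq (qdifB (qdif_cst 1 q) (qdifZ 24 (qdif_phi 1 q1))) _.
have h := ramanujan_phi1 q1; rewrite /e2 /e4.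
have -> : psi 1 q = (- 4 * phi 1 q * phi 1 q + 5 / 3 * phi 3 q + 1 / 3 * phi 1 q) / 2.
  by rewrite h; field.
by field.
Qed.

Lemma qdif_e4 q : nm q < 1 -> qdif e4 q ((e2 q * e4 q - e6 q) / 3).
Proof.
move=> q1; apply: qdif_eq (qdifD (qdif_cst 1 q) (qdifZ 240 (qdif_phi 3 q1))) _.
have h := ramanujan_phi3 q1; rewrite /e2 /e4 /e6.
have -> : psi 3 q = (- 16 * phi 1 q * phi 3 q + 7 / 5 * phi 5 q + 2 / 3 * phi 3 q - 1 / 15 * phi 1 q) / 2.
  by rewrite h; field.
by field.
Qed.

(** [ramanujan_sphi1] involves [psi 1] at q and q^2; [ramanujan_phi1] at both arguments eliminates
    them and leaves a relation of weight four. *)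
Lemma p2_sqr q : nm q < 1 -> p2 q ^+ 2 = (e4 q + 4 * e4 (q ^+ 2)) / 5.
Proof.
move=> q1; have q2 := nm_sqr_lt1 q1; have := ramanujan_sphi1 q1.
rewrite !sphiE // spsiE //.
have -> : psi 1 q = (- 4 * phi 1 q * phi 1 q + 5 / 3 * phi 3 q + 1 / 3 * phi 1 q) / 2.
  by rewrite ramanujan_phi1 //; field.
have -> : psi 1 (q ^+ 2) = (- 4 * phi 1 (q ^+ 2) * phi 1 (q ^+ 2) + 5 / 3 * phi 3 (q ^+ 2) + 1 / 3 * phi 1 (q ^+ 2)) / 2.
  by rewrite ramanujan_phi1 //; field.
rewrite /p2 /e2 /e4.
move: (phi 1 q) (phi 3 q) (phi 1 (q ^+ 2)) (phi 3 (q ^+ 2)) => a b a' b'.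
move/eqP; rewrite -subr_eq0 => /eqP h.
(* The difference of the two sides is -72 times the relation [h]. *)
apply/eqP; rewrite -subr_eq0; apply/eqP; rewrite -[RHS](mulr0 (-72)) -h; by field.
Qed.

Lemma e4E q : nm q < 1 -> e4 q = p2 q ^+ 2 + 4 / 5 * y4 q.
Proof. by move=> q1; rewrite p2_sqr // /y4; move: (e4 q) (e4 (q ^+ 2)) => a b; field. Qed.

Lemma qdif_p2 q : nm q < 1 ->
  qdif p2 q (p2 q * ((e2 q - p2 q) / 6) + 2 / 15 * y4 q).
Proof.
move=> q1; have q2 := nm_sqr_lt1 q1.
apply: qdif_eq (qdifB (qdifZ 2 (qdif_sqr (qdif_e2 q2))) (qdif_e2 q1)) _.
have h : e4 (q ^+ 2) = p2 q ^+ 2 - y4 q / 5 by rewrite p2_sqr // /y4; move: (e4 q) (e4 (q ^+ 2)) => a b; field.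
rewrite h e4E //; clear h.
have -> : e2 (q ^+ 2) = (p2 q + e2 q) / 2 by rewrite /p2; move: (e2 q) (e2 (q ^+ 2)) => a b; field.
by field.
Qed.

Lemma lincomb2_eq0 (K : pzRingType) (x y a b : K) : x = 0 -> y = 0 -> a * x + b * y = 0.
Proof. by move=> -> ->; rewrite !mulr0 addr0. Qed.

(** Two linear equations in the unknowns E6 and E6', solved by elimination; the numbers given to
    [lincomb2_eq0] are the multipliers. *)
Lemma eisenstein_weight6_aux (K : numFieldType) (e P y E6 E6' : K) :
  2 * P * (P * ((e - P) / 6) + 2 / 15 * y) =
    (e * (P ^+ 2 + 4 / 5 * y) - E6) / 15 + 8 / 15 * ((P + e) / 2 * (P ^+ 2 - y / 5) - E6') ->
  - 16 * ((3 - 4 * ((P + e) / 2) + e) / 24) * ((16 * (P ^+ 2 - y / 5) - (P ^+ 2 + 4 / 5 * y) - 15) / 240) =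
   2 * (32 * (((P + e) / 2 * (P ^+ 2 - y / 5) - E6') / 720) - (e * (P ^+ 2 + 4 / 5 * y) - E6) / 720)
   - (63 - 64 * E6' + E6) / 504 - 2 * ((16 * (P ^+ 2 - y / 5) - (P ^+ 2 + 4 / 5 * y) - 15) / 240)
   + (3 - 4 * ((P + e) / 2) + e) / 24 ->
  E6 = P ^+ 3 - 12 / 5 * P * y /\ E6' = P ^+ 3 - 3 / 10 * P * y.
Proof.
move=> /eqP + /eqP; rewrite -subr_eq0 => /eqP h1; rewrite -subr_eq0 => /eqP h2.
split; apply/eqP; rewrite -subr_eq0; apply/eqP.
  rewrite -[RHS](lincomb2_eq0 18 252 h1 h2).
  by field.
rewrite -[RHS](lincomb2_eq0 (- (3 / 8)) (- (63 / 2)) h1 h2).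
by field.
Qed.

(** One equation comes from differentiating [p2_sqr] in two ways, the other from
    [ramanujan_sphi3]. *)
Lemma eisenstein_weight6 q : nm q < 1 ->
  e6 q = p2 q ^+ 3 - 12 / 5 * p2 q * y4 q /\
  e6 (q ^+ 2) = p2 q ^+ 3 - 3 / 10 * p2 q * y4 q.
Proof.
move=> q1; have q2 := nm_sqr_lt1 q1.
have h4' : e4 (q ^+ 2) = p2 q ^+ 2 - y4 q / 5 by rewrite p2_sqr // /y4; move: (e4 q) (e4 (q ^+ 2)) => a b; field.
have h2' : e2 (q ^+ 2) = (p2 q + e2 q) / 2 by rewrite /p2; move: (e2 q) (e2 (q ^+ 2)) => a b; field.
have weight6_sqr : 2 * p2 q * (p2 q * ((e2 q - p2 q) / 6) + 2 / 15 * y4 q) =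
    (e2 q * e4 q - e6 q) / 15 + 8 / 15 * (e2 (q ^+ 2) * e4 (q ^+ 2) - e6 (q ^+ 2)).
  have dl : qdif (fun w => p2 w ^+ 2) q (2 * p2 q * (p2 q * ((e2 q - p2 q) / 6) + 2 / 15 * y4 q)).
    by apply: qdif_eq (qdifX 2 (qdif_p2 q1)) _; rewrite /= expr1.
  have dr : qdif (fun w => p2 w ^+ 2) q ((e2 q * e4 q - e6 q) / 15 + 8 / 15 * (e2 (q ^+ 2) * e4 (q ^+ 2) - e6 (q ^+ 2))).
    apply: (@qdif_near R (fun w => (1 / 5) * (e4 w + 4 * e4 (w ^+ 2)))).
      near=> w; rewrite p2_sqr ?mul1r 1?mulrC //; near: w; exact: cnbhs_disc.
    apply: qdif_eq (qdifZ (1 / 5) (qdifD (qdif_e4 q1) (qdifZ 4 (qdif_sqr (qdif_e4 q2))))) _.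
    by move: (e2 q) (e4 q) (e6 q) (e2 (q ^+ 2)) (e4 (q ^+ 2)) (e6 (q ^+ 2)) => a b c x y z; field.
  have [d hd <-] := dl; have [d' hd' <-] := dr.
  by rewrite (cdif_unique hd hd').
rewrite h2' h4' e4E // in weight6_sqr.
apply: (@eisenstein_weight6_aux _ (e2 q) (p2 q) (y4 q) (e6 q) (e6 (q ^+ 2)) weight6_sqr); clear weight6_sqr.
have hpsi w : nm w < 1 -> psi 3 w = (e2 w * e4 w - e6 w) / 720.
  move=> w1; rewrite /e2 /e4 /e6.
  have -> : psi 3 w = (- 16 * phi 1 w * phi 3 w + 7 / 5 * phi 5 w + 2 / 3 * phi 3 w - 1 / 15 * phi 1 w) / 2.
    by rewrite ramanujan_phi3 //; field.
  by field.
have f1 w : phi 1 w = (1 - e2 w) / 24 by rewrite /e2; field.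
have f3 w : phi 3 w = (e4 w - 1) / 240 by rewrite /e4; field.
have f5 w : phi 5 w = (1 - e6 w) / 504 by rewrite /e6; field.
have := ramanujan_sphi3 q1; rewrite !sphiE // spsiE // !hpsi // !f1 !f3 !f5 h2' h4' e4E //; clear.
move/eqP; rewrite -subr_eq0 => /eqP h; apply/eqP; rewrite -subr_eq0; apply/eqP.
rewrite -[RHS]h; move: (e2 q) (p2 q) (y4 q) (e6 q) (e6 (q ^+ 2)) => a b c x y; by field.
Unshelve. all: by end_near. Qed.

Lemma qdif_y4 q : nm q < 1 -> qdif y4 q (y4 q * ((2 * p2 q + e2 q) / 3)).
Proof.
move=> q1; have q2 := nm_sqr_lt1 q1.
have h4' : e4 (q ^+ 2) = p2 q ^+ 2 - y4 q / 5 by rewrite p2_sqr // /y4; move: (e4 q) (e4 (q ^+ 2)) => a b; field.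
have h2' : e2 (q ^+ 2) = (p2 q + e2 q) / 2 by rewrite /p2; move: (e2 q) (e2 (q ^+ 2)) => a b; field.
have [h6 h6'] := eisenstein_weight6 q1.
apply: qdif_eq (qdifB (qdif_e4 q1) (qdif_sqr (qdif_e4 q2))) _.
by rewrite h2' h4' h6 h6' e4E //; clear; move: (e2 q) (p2 q) (y4 q) => a b c; field.
Qed.

End EisensteinSeries.

(** * The Euler product and its logarithmic derivative *)

Section EulerProduct.
Context {R : realType}.
Implicit Types (q w z : R[i]) (k n m : nat).

Definition pochq q m : R[i] := \prod_(1 <= n < m) (1 - q ^+ n).

End EulerProduct.

HB.lock Definition euler {R : realType} (q : R[i]) : R[i] := clim (pochq q).

Section EulerProductTheory.
Context {R : realType}.
Implicit Types (q w z : R[i]) (k n m : nat).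

Lemma eulerE q : euler q = clim (pochq q).
Proof. by rewrite euler.unlock. Qed.

Lemma pochqS q m : pochq q m.+2 = pochq q m.+1 * (1 - q ^+ m.+1).
Proof. by rewrite /pochq big_nat_recr. Qed.

Lemma pochq0 q : pochq q 0 = 1. Proof. by rewrite /pochq big_geq. Qed.
Lemma pochq1 q : pochq q 1 = 1. Proof. by rewrite /pochq big_geq. Qed.

Lemma pochq_neq0 q m : nm q < 1 -> pochq q m != 0.
Proof.
move=> q1; rewrite /pochq big_nat; elim/big_ind: _ => [||i /andP[i1 _]].
- exact: oner_neq0.
- by move=> x y x0 y0; rewrite mulf_neq0.
- exact: oneBX_neq0.
Qed.

Lemma sum_geometric_le (r : R) m : 0 <= r < 1 -> \sum_(1 <= n < m) r ^+ n <= (1 - r)^-1.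
Proof.
move=> /andP[r0 r1]; apply: (@le_trans _ _ (\sum_(0 <= n < m) r ^+ n)).
  case: m => [|m]; first by rewrite !big_geq.
  by rewrite [leRHS]big_ltn // lerDr exprn_ge0.
rewrite -[leRHS]mul1r ler_pdivlMr ?subr_gt0 // mulrC big_mkord -opprB mulNr -subrX1.
by rewrite opprB gerBl exprn_ge0.
Qed.

Lemma prod_le_exp (f : nat -> R) m : (forall n, 0 <= f n) ->
  \prod_(1 <= n < m) (1 + f n) <= expR (\sum_(1 <= n < m) f n).
Proof.
move=> f0; rewrite expR_sum; apply: ler_prod => i _; rewrite expR_ge1Dx andbT.
by rewrite addr_ge0.
Qed.

Lemma pochq_le q m (r : R) : nm q <= r -> r < 1 -> nm (pochq q m) <= expR (1 - r)^-1.
Proof.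
move=> qr r1; have r0 : 0 <= r by apply: le_trans qr; exact: nm_ge0.
apply: (@le_trans _ _ (\prod_(1 <= n < m) (1 + r ^+ n))).
  rewrite /pochq (big_morph nm nmM nm1); apply: ler_prod => i _; rewrite nm_ge0 /=.
  apply: le_trans (nmDB _ _) _; rewrite nm1 lerD2l nmX.
  by rewrite lerXn2r ?nnegrE ?nm_ge0.
apply: le_trans (prod_le_exp _ _) _; first by move=> n; exact: exprn_ge0.
by rewrite ler_expR sum_geometric_le // r0.
Qed.

(** A bound independent of m, which keeps the infinite product away from 0. It uses 1 / (1 - r^i) =
    1 + r^i / (1 - r^i) <= 1 + r^i / (1 - r). *)
Lemma pochqV_le q m (r : R) : nm q <= r -> r < 1 ->
  nm (pochq q m)^-1 <= expR ((1 - r)^-1 * (1 - r)^-1).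
Proof.
move=> qr r1; have r0 : 0 <= r by apply: le_trans qr; exact: nm_ge0.
have d0 : 0 < 1 - r by rewrite subr_gt0.
apply: (@le_trans _ _ (\prod_(1 <= n < m) (1 + (1 - r)^-1 * r ^+ n))).
  rewrite /pochq -prodfV (big_morph nm nmM nm1).
  rewrite !big_nat; apply: ler_prod => i /andP[i1 _]; rewrite nm_ge0 /= nmV.
  have e0 : 0 < 1 - r ^+ i by rewrite subr_gt0; apply: (le_lt_trans _ r1); rewrite -[leRHS]expr1 ler_wiXn2l // ltW.
  apply: (@le_trans _ _ (1 - r ^+ i)^-1).
    have h : 1 - r ^+ i <= nm (1 - q ^+ i).
      apply: le_trans (nm_sub_ge _ _); rewrite nm1 lerD2l lerN2 nmX.
      by rewrite lerXn2r ?nnegrE ?nm_ge0.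
    by rewrite lef_pV2 ?posrE // (lt_le_trans e0).
  have -> : (1 - r ^+ i)^-1 = 1 + r ^+ i / (1 - r ^+ i) by field; rewrite gt_eqF.
  rewrite lerD2l mulrC ler_wpM2r ?exprn_ge0 // lef_pV2 ?posrE // lerD2l lerN2.
  by rewrite -[leRHS]expr1 ler_wiXn2l // ltW.
apply: le_trans (prod_le_exp _ _) _.
  by move=> n; rewrite mulr_ge0 ?exprn_ge0 // invr_ge0 ltW.
rewrite ler_expR -mulr_sumr ler_wpM2l ?invr_ge0 ?(ltW d0) //.
by rewrite sum_geometric_le // r0.
Qed.

Definition euler_quot w z n : R[i] := - pochq w n / pochq z n.+1 * dquot w z n.

Lemma euler_quotE w z n : nm z < 1 ->
  pochq w n.+1 / pochq z n.+1 - pochq w n / pochq z n = (w - z) * euler_quot w z n.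
Proof.
move=> z1; rewrite /euler_quot mulrCA -dquotE; case: n => [|n].
  by rewrite !expr0 !pochq0 !pochq1 !subrr mulr0.
have h1 := oneBX_neq0 z1 (ltn0Sn n); have h2 := pochq_neq0 n.+1 z1.
rewrite !pochqS; move: (pochq w n.+1) (pochq z n.+1) (w ^+ n.+1) (z ^+ n.+1) h1 h2 => a b c d h1 h2.
by field; apply/andP.
Qed.

Lemma euler_quot_bound w z n (r : R) : 0 < r -> r < 1 -> nm w <= r -> nm z <= r ->
  nm (euler_quot w z n) <=
  expR (1 - r)^-1 * expR ((1 - r)^-1 * (1 - r)^-1) * r^-1 * (n%:R ^+ 1 * r ^+ n).
Proof.
move=> r0 r1 wr zr; rewrite /euler_quot !nmM nmN -mulrA -[leRHS]mulrA -[leRHS]mulrA.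
apply: ler_pM; rewrite ?nm_ge0 ?mulr_ge0 ?nm_ge0 ?pochq_le //.
apply: ler_pM; rewrite ?nm_ge0 ?pochqV_le //.
by rewrite expr1; exact: dquot_bound.
Qed.

Lemma cvg_euler_major (c r : R) : 0 <= r < 1 -> cvgn (series (fun n => c * (n%:R ^+ 1 * r ^+ n))).
Proof. by move=> r01; apply/cvg_series_scale/cvg_polygeometric. Qed.

Lemma euler_ratio w z : nm w < 1 -> nm z < 1 ->
  tends \oo (fun m => pochq w m / pochq z m) (1 + csum (fun n => (w - z) * euler_quot w z n)).
Proof.
move=> w1 z1.
have [r /andP[r0 r1] [wr zr]] : exists2 r : R, 0 < r < 1 & nm w <= r /\ nm z <= r.
  exists ((1 + Num.max (nm w) (nm z)) / 2).
    have : Num.max (nm w) (nm z) < 1 by rewrite gt_max w1.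
    have : 0 <= Num.max (nm w) (nm z) by rewrite le_max nm_ge0.
    by move=> ? ?; apply/andP; split; lra.
  have hw : nm w <= Num.max (nm w) (nm z) by rewrite le_max lexx.
  have hz : nm z <= Num.max (nm w) (nm z) by rewrite le_max lexx orbT.
  have : Num.max (nm w) (nm z) < 1 by rewrite gt_max w1.
  by move=> ?; split; lra.
have s : csummable (euler_quot w z).
  apply: (csummable_major (fun n => euler_quot_bound n r0 r1 wr zr)).
  by apply: cvg_euler_major; rewrite (ltW r0) r1.
have s' := csummable_tends (csummableZ (w - z) s).
apply: tends_near (tendsD (tends_cst 1) s'); near=> m.
rewrite /series /= (eq_bigr (fun n => pochq w n.+1 / pochq z n.+1 - pochq w n / pochq z n)).
  by rewrite telescope_sumr // !pochq0 divr1 subrKC.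
by move=> n _; rewrite euler_quotE.
Unshelve. all: by end_near. Qed.

(** The case z = 0 of [euler_ratio], where every partial product in the denominator is 1. *)
Lemma euler_tends q : nm q < 1 -> tends \oo (pochq q) (euler q).
Proof.
move=> q1; have z1 : nm (0 : R[i]) < 1 by rewrite nm0.
have h := euler_ratio q1 z1.
have h' : tends \oo (pochq q) (1 + csum (fun n => (q - 0) * euler_quot q 0 n)).
  apply: tends_near h; near=> m; rewrite [X in _ / X](_ : _ = 1) ?divr1 //.
  rewrite /pochq big_nat big1 // => i /andP[i1 _]; rewrite expr0n.
  by case: i i1 => //= i _; rewrite subr0.
by rewrite eulerE (climE h').
Unshelve. all: by end_near. Qed.

Lemma euler_neq0 q : nm q < 1 -> euler q != 0.
Proof.
move=> q1; rewrite -nm_gt0 lt_neqAle nm_ge0 andbT eq_sym; apply/eqP => e0.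
have /eqP E0 : euler q == 0 by rewrite -nm_eq0 e0.
have h := euler_tends q1; rewrite E0 in h.
pose C := expR ((1 - nm q)^-1 * (1 - nm q)^-1).
have C0 : 0 < C^-1 by rewrite invr_gt0 expR_gt0.
have [N _ /(_ N (leqnn N))] := h _ C0.
rewrite /= subr0 => hN.
have := pochqV_le N (lexx (nm q)) q1; rewrite nmV -/C => h2.
have : C^-1 <= nm (pochq q N).
  by rewrite -[leRHS]invrK lef_pV2 ?posrE ?expR_gt0 // invr_gt0 nm_gt0 pochq_neq0.
by rewrite leNgt hN.
Qed.

(** By [euler_ratio], euler w / euler q is 1 + (w - q) S(w). At w = q the partial products in S
    cancel, and q S(q) is minus the Lambert series. *)
Lemma qdif_euler q : nm q < 1 -> qdif euler q (- phi 1 q * euler q).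
Proof.
move=> q1.
have rq : nm q < (1 + nm q) / 2 by lra.
have r1 : (1 + nm q) / 2 < 1 by lra.
have r0 : 0 < (1 + nm q) / 2 by have := nm_ge0 q; lra.
move: ((1 + nm q) / 2) rq r1 r0 => r rq r1 r0.
have e0 := euler_neq0 q1.
have ratio w : nm w < 1 -> euler w = euler q * (1 + csum (fun n => (w - q) * euler_quot w q n)).
  move=> w1; have h := euler_ratio w1 q1.
  have h' : tends \oo (fun m => pochq w m / pochq q m) (euler w / euler q).
    by apply: tendsM; [exact: euler_tends|apply: tendsV => //; exact: euler_tends].
  by rewrite (tends_unique _ h h') mulrC divfK.
have qc n : tends (cnbhs q) (fun w => euler_quot w q n) (euler_quot q q n).
  apply: tendsM; last exact: dquot_cont.
  apply: tendsM; last exact: tends_cst.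
  apply: tendsN; rewrite /pochq; elim: n => [|n ih].
    by under eq_fun do rewrite big_geq //; rewrite big_geq //; exact: tends_cst.
  case: n ih => [|n] ih.
    by under eq_fun do rewrite big_geq //; rewrite big_geq //; exact: tends_cst.
  rewrite big_nat_recr //=; under eq_fun do rewrite big_nat_recr //=.
  apply: tendsM => //; apply: tendsB; first exact: tends_cst.
  by apply: tendsX; exact: tends_id.
have major := fun r01 => @cvg_euler_major (expR (1 - r)^-1 * expR ((1 - r)^-1 * (1 - r)^-1) * r^-1) r r01.
have Mc : 0 <= r < 1 by rewrite (ltW r0).
have bound w n : nm w < r -> nm (euler_quot w q n) <=
  expR (1 - r)^-1 * expR ((1 - r)^-1 * (1 - r)^-1) * r^-1 * (n%:R ^+ 1 * r ^+ n).
  by move=> wr; apply: euler_quot_bound => //; exact: ltW.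
have sq w : nm w < r -> csummable (euler_quot w q).
  by move=> wr; apply: csummable_major (major Mc) => n; exact: bound.
exists (euler q * csum (euler_quot q q)); last first.
  rewrite mulrCA -csumZ; last exact: sq.
  rewrite [RHS]mulrC; congr (_ * _); rewrite phiE -[RHS]mulN1r -csumZ; last exact: phi_summable.
  congr csum; apply/funext => n; rewrite /euler_quot.
  case: n => [|n]; first by rewrite /dquot big_ord0 lam0 !mulr0.
  rewrite mulrCA dquot_diag pochqS /lam.
  have h1 := oneBX_neq0 q1 (ltn0Sn n); have h2 := pochq_neq0 n.+1 q1.
  move: (pochq q n.+1) (q ^+ n.+1) h1 h2 => b c h1 h2.
  by field; apply/andP.
exists (fun w => euler q * csum (euler_quot w q)).
  apply: tendsM; first exact: tends_cst.
  apply: (tends_csum _ (major Mc) qc).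
  by near=> w; move=> n; apply: bound; near: w; exact: cnbhs_disc.
near=> w; have wr : nm w < r by near: w; exact: cnbhs_disc.
rewrite ratio ?(lt_trans wr) // csumZ; last exact: sq.
by move: (csum _) (euler q) => a b; ring.
Unshelve. all: by end_near. Qed.

Lemma euler_at0 : euler (0 : R[i]) = 1.
Proof.
rewrite eulerE; apply: climE; apply: (@tends_near R _ \oo _ (fun=> 1)); last exact: tends_cst.
near=> m; rewrite /pochq big_nat big1 // => i /andP[i1 _]; rewrite expr0n.
by case: i i1 => //= i _; rewrite subr0.
Unshelve. all: by end_near. Qed.

End EulerProductTheory.

(** * Eta quotients, the Hauptmodul and the variable z *)

Section LevelTwo.
Context {R : realType}.
Implicit Types (q w : R[i]).

(** This is eta(tau)^16 / eta(2 tau)^8, in which the powers of q cancel; [q * etaB q] is eta(2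
    tau)^16 / eta(tau)^8. *)
Definition etaA q : R[i] := euler q ^+ 16 / euler (q ^+ 2) ^+ 8.
Definition etaB q : R[i] := euler (q ^+ 2) ^+ 16 / euler q ^+ 8.

Lemma etaA_neq0 q : nm q < 1 -> etaA q != 0.
Proof.
move=> q1; have q2 := nm_sqr_lt1 q1.
by rewrite mulf_neq0 ?invr_eq0 ?expf_neq0 ?euler_neq0.
Qed.

Lemma etaB_neq0 q : nm q < 1 -> etaB q != 0.
Proof.
move=> q1; have q2 := nm_sqr_lt1 q1.
by rewrite mulf_neq0 ?invr_eq0 ?expf_neq0 ?euler_neq0.
Qed.

Lemma etaA_div_etaB q : nm q < 1 -> etaA q / etaB q = (euler q / euler (q ^+ 2)) ^+ 24.
Proof.
move=> q1; have q2 := nm_sqr_lt1 q1.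
have := euler_neq0 q1; have := euler_neq0 q2; rewrite /etaA /etaB.
by move: (euler q) (euler (q ^+ 2)) => a b b0 a0; field; apply/andP.
Qed.

Lemma phi1E q : phi 1 q = (1 - e2 q) / 24 :> R[i].
Proof. by rewrite /e2; move: (phi 1 q) => a; field. Qed.

Lemma e2_sqrE q : e2 (q ^+ 2) = (p2 q + e2 q) / 2 :> R[i].
Proof. by rewrite /p2; move: (e2 q) (e2 (q ^+ 2)) => a b; field. Qed.

Lemma qdif_etaA q : nm q < 1 -> qdif etaA q (etaA q * ((e2 q - p2 q) / 3)).
Proof.
move=> q1; have q2 := nm_sqr_lt1 q1.
have a0 := euler_neq0 q1; have b0 := euler_neq0 q2.
have b8 : euler (q ^+ 2) ^+ 8 != 0 by exact: expf_neq0 b0.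
have h := @qdif_div R (fun w => euler w ^+ 16) (fun w => euler (w ^+ 2) ^+ 8) q _ _ b8
  (qdifX 16 (qdif_euler q1)) (qdifX 8 (qdif_sqr (qdif_euler q2))).
apply: (qdif_eq h); clear h.
rewrite !phi1E e2_sqrE /etaA /=.
move: (euler q) (euler (q ^+ 2)) (e2 q) (p2 q) a0 b0 {b8} => a b e p a0 b0.
by field.
Qed.

Lemma qdif_etaB q : nm q < 1 ->
  qdif (fun w => w * etaB w) q (q * etaB q * ((e2 q + 2 * p2 q) / 3)).
Proof.
move=> q1; have q2 := nm_sqr_lt1 q1.
have a0 := euler_neq0 q1; have b0 := euler_neq0 q2.
have a8 : euler q ^+ 8 != 0 by exact: expf_neq0 a0.
have h := @qdif_div R (fun w => euler (w ^+ 2) ^+ 16) (fun w => euler w ^+ 8) q _ _ a8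
  (qdifX 16 (qdif_sqr (qdif_euler q2))) (qdifX 8 (qdif_euler q1)).
apply: (qdif_eq (qdifM (qdif_id q) h)); clear h.
rewrite !phi1E e2_sqrE /etaB /=.
move: (euler q) (euler (q ^+ 2)) (e2 q) (p2 q) a0 b0 {a8} => a b e p a0 b0.
by field.
Qed.

Lemma e2_at0 : e2 (0 : R[i]) = 1. Proof. by rewrite /e2 phi_at0 mulr0 subr0. Qed.
Lemma p2_at0 : p2 (0 : R[i]) = 1.
Proof. by rewrite /p2 expr0n /= e2_at0; ring. Qed.
Lemma y4_at0 : y4 (0 : R[i]) = 0.
Proof. by rewrite /y4 expr0n /= subrr. Qed.
Lemma etaA_at0 : etaA (0 : R[i]) = 1.
Proof. by rewrite /etaA expr0n /= euler_at0 !expr1n divr1. Qed.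
Lemma etaB_at0 : etaB (0 : R[i]) = 1.
Proof. by rewrite /etaB expr0n /= euler_at0 !expr1n divr1. Qed.

Lemma nm0_lt1 : nm (0 : R[i]) < 1. Proof. by rewrite nm0. Qed.

Lemma etaB_cont0 : tends (cnbhs 0) etaB (1 : R[i]).
Proof.
have h1 := qdif_cont (qdif_euler nm0_lt1).
have q2 : nm ((0 : R[i]) ^+ 2) < 1 by rewrite expr0n nm0.
have h2 := qdif_cont (qdif_sqr (qdif_euler q2)); rewrite /= in h2.
rewrite -etaB_at0; apply: tendsM; first exact: tendsX.
apply: tendsV; last exact: tendsX.
by rewrite expf_neq0 // euler_neq0 // nm0_lt1.
Qed.

(** By [qdif_y4] and [qdif_etaB] both sides have logarithmic q-derivative (e2 + 2 p2) / 3. The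
    constant 240 is the derivative of [y4] at 0. *)
Lemma y4E q : nm q < 1 -> y4 q = 240 * (q * etaB q).
Proof.
move=> q1; have [->|q0] := eqVneq q 0; first by rewrite y4_at0 !mul0r mulr0.
have [d [hd _ /(_ erefl) d1]] := cdif_phi 3 nm0_lt1; rewrite {}d1 in hd.
have hs : cdif (fun w => phi 3 (w ^+ 2)) (0 : R[i]) 0.
  have h0 : cdif (phi 3) ((0 : R[i]) ^+ 2) 1 by rewrite expr0n.
  by apply: cdif_eq (cdif_comp (cdifX 2 (cdif_id 0)) h0) _; rewrite /= !(mulr0, mul0r).
have hy : cdif (fun w => 240 * (phi 3 w - phi 3 (w ^+ 2))) (0 : R[i]) 240.
  by apply: cdif_eq (cdifZ 240 (cdifB hd hs)) _; rewrite subr0 mulr1.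
have y4phi w : y4 w = 240 * (phi 3 w - phi 3 (w ^+ 2)).
  by rewrite /y4 /e4; move: (phi 3 w) (phi 3 (w ^+ 2)) => a b; ring.
case: hy => g g1 hg.
suff h : y4 q / (q * etaB q) = 240 by rewrite -h divfK // mulf_neq0 ?etaB_neq0.
apply: (@punctured_disc_cst R (fun w => y4 w / (w * etaB w)) (fun w => g w / etaB w)) => //.
- move=> w w0 w1; apply: qdif0_cdif => //.
  have b0 : w * etaB w != 0 by rewrite mulf_neq0 // etaB_neq0.
  have h := @qdif_div R y4 (fun w => w * etaB w) w _ _ b0 (qdif_y4 w1) (qdif_etaB w1).
  apply: (qdif_eq h); clear h.
  move: (w * etaB w) (y4 w) (e2 w) (p2 w) b0 => a b c p a0.
  by field.
- rewrite -[X in tends _ _ X]divr1; apply: tendsM => //; apply: tendsV; first exact: oner_neq0.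
  exact: etaB_cont0.
- have h1 := cnbhs_disc nm0_lt1.
  near=> w => w0.
  have w1 : nm w < 1 by near: w; exact: h1.
  have hw : 240 * (phi 3 w - phi 3 (w ^+ 2)) - 240 * (phi 3 0 - phi 3 (0 ^+ 2)) = (w - 0) * g w.
    by near: w; exact: hg.
  have e0 : 240 * (phi 3 (0 : R[i]) - phi 3 (0 ^+ 2)) = 0 by rewrite expr0n /= subrr mulr0.
  move: hw; rewrite e0 -y4phi; move: (y4 w) => y; rewrite !subr0 => ->.
  have := etaB_neq0 w1; move: (etaB w) (g w) => a b a0; by field; apply/andP.
Unshelve. all: by end_near. Qed.

(** The combination p2^2 - (4 / 15) y4 has the logarithmic derivative of [etaA], and both are 1 at q
    = 0; then 64 = 240 * 4 / 15. *)
Lemma p2_sqrE q : nm q < 1 -> p2 q ^+ 2 = etaA q + 64 * (q * etaB q).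
Proof.
move=> q1.
have q2 : nm ((0 : R[i]) ^+ 2) < 1 by rewrite expr0n nm0.
pose a4 w : R[i] := p2 w ^+ 2 - 4 / 15 * y4 w.
suff h : a4 q = etaA q.
  by rewrite -h /a4 (y4E q1); move: (p2 q) (q * etaB q) => a b; field.
have a40 : a4 0 = 1 by rewrite /a4 p2_at0 y4_at0 mulr0 subr0 expr1n.
have [->|q0] := eqVneq q 0; first by rewrite a40 etaA_at0.
have da w : nm w < 1 -> qdif a4 w (a4 w * ((e2 w - p2 w) / 3)).
  move=> w1; apply: qdif_eq (qdifB (qdifX 2 (qdif_p2 w1)) (qdifZ (4 / 15) (qdif_y4 w1))) _.
  by rewrite /a4 /= expr1; move: (p2 w) (y4 w) (e2 w) => a b c; field.
suff h : a4 q / etaA q = 1 by rewrite -[RHS]mul1r -h divfK // etaA_neq0.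
apply: (@punctured_disc_cst R (fun w => a4 w / etaA w) (fun w => a4 w / etaA w)) => //.
- move=> w w0 w1; apply: qdif0_cdif => //.
  have b0 := etaA_neq0 w1.
  have h := @qdif_div R a4 etaA w _ _ b0 (da _ w1) (qdif_etaA w1).
  apply: (qdif_eq h); clear h.
  by move: (a4 w) (etaA w) (e2 w) (p2 w) b0 => a b c p a0; field.
- have c1 := qdif_cont (da _ nm0_lt1); have c2 := qdif_cont (qdif_etaA nm0_lt1).
  rewrite -[X in tends _ _ X]divr1 -{1}a40 -etaA_at0; apply: tendsM => //.
  by apply: tendsV => //; rewrite etaA_neq0 // nm0_lt1.
- by near=> w.
Unshelve. all: by end_near. Qed.

(* [tmod] is the Hauptmodul and [zmod] is [1 / (1 - t)], as functions of [q]. *)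
Definition tmod q : R[i] := - (1 / 64) * (etaA q / (q * etaB q)).
Definition zmod q : R[i] := 64 * (q * etaB q) / p2 q ^+ 2.

Lemma one_sub_tmod q : nm q < 1 -> q != 0 -> 1 - tmod q = p2 q ^+ 2 / (64 * (q * etaB q)).
Proof.
move=> q1 q0; rewrite p2_sqrE // /tmod; have := etaB_neq0 q1.
by move: (etaA q) (etaB q) => a b b0; field; apply/andP.
Qed.

Lemma p2_neq0 q : nm q < 1 -> q != 0 -> tmod q != 1 -> p2 q != 0.
Proof.
move=> q1 q0; apply: contraNneq => p0.
have := one_sub_tmod q1 q0; rewrite p0 expr0n mul0r => /eqP.
by rewrite subr_eq0 eq_sym.
Qed.

Lemma zmodE q : nm q < 1 -> q != 0 -> zmod q = (1 - tmod q)^-1.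
Proof. by move=> q1 q0; rewrite one_sub_tmod // invf_div. Qed.

(* Half the logarithmic derivative [q d/dq log p2], see [qdif_p2_y2]. *)
Definition y2 q : R[i] := (e2 q - p2 q * (1 - 3 * zmod q)) / 12.

Section Nonvanishing.
Variable q : R[i].
Hypotheses (q1 : nm q < 1) (p0 : p2 q != 0).

Lemma y4_zmod : y4 q = 15 / 4 * (p2 q ^+ 2 * zmod q).
Proof.
rewrite y4E // /zmod; move: (p2 q) (q * etaB q) p0 => a b a0.
by field.
Qed.

Lemma e4_zmod : e4 q = p2 q ^+ 2 * (1 + 3 * zmod q).
Proof. by rewrite e4E // y4_zmod; move: (p2 q) (zmod q) => a b; field. Qed.

Lemma e6_zmod : e6 q = p2 q ^+ 3 * (1 - 9 * zmod q).
Proof.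
have [-> _] := eisenstein_weight6 q1.
by rewrite y4_zmod; move: (p2 q) (zmod q) => a b; field.
Qed.

Lemma qdif_p2_y2 : qdif p2 q (2 * p2 q * y2 q).
Proof.
apply: qdif_eq (qdif_p2 q1) _.
by rewrite y4_zmod /y2; move: (p2 q) (zmod q) (e2 q) => a b c; field.
Qed.

Lemma qdif_zmod : qdif zmod q (p2 q * (zmod q * (1 - zmod q))).
Proof.
have p20 : p2 q ^+ 2 != 0 by exact: expf_neq0 p0.
have h := @qdif_div R (fun w => 64 * (w * etaB w)) (fun w => p2 w ^+ 2) q _ _ p20
  (qdifZ 64 (qdif_etaB q1)) (qdifX 2 qdif_p2_y2).
apply: (qdif_eq h); clear h.
rewrite /y2 /= expr1 /zmod; move: (p2 q) (q * etaB q) (e2 q) p0 => a b c a0.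
by field.
Qed.

(** A Riccati equation. With [qdif_p2_y2] it says that a square root f of [p2] satisfies (z (1 - z)
    f')' = (3 / 16) f in the variable z, the hypergeometric equation with parameters 1/4, 3/4; 1. *)
Lemma qdif_y2 : qdif y2 q (y2 q ^+ 2 + 3 / 16 * (zmod q * (1 - zmod q)) * p2 q ^+ 2).
Proof.
have h := qdifZ (1 / 12) (qdifB (qdif_e2 q1) (qdifM qdif_p2_y2 (qdifB (qdif_cst 1 q) (qdifZ 3 qdif_zmod)))).
apply: qdif_near (qdif_eq h _).
  by near=> w; rewrite /y2 mulrC mulrA mulr1.
rewrite e4_zmod /y2; move: (p2 q) (zmod q) (e2 q) => a b c.
by field.
Unshelve. all: by end_near. Qed.

End Nonvanishing.
End LevelTwo.

(** * Power series on the unit disc *)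

Section PowerSeries.
Context {R : realType}.
Implicit Types (w z : R[i]) (a b : nat -> R[i]).

(** Polynomial growth ensures convergence on the open unit disc and is stable under formal
    differentiation; [n.+1] keeps the bound useful at n = 0. *)
Definition polybounded a := exists k, exists2 C : R, 0 <= C &
  forall n, nm (a n) <= C * n.+1%:R ^+ k.

Lemma polyboundedD a b : polybounded a -> polybounded b -> polybounded (fun n => a n + b n).
Proof.
move=> [k [C C0 ha]] [l [D D0 hb]]; exists (k + l)%N; exists (C + D); first exact: addr_ge0.
have mono (p q : nat) n : n.+1%:R ^+ p <= n.+1%:R ^+ (p + q) :> R.
  by rewrite ler_weXn2l ?leq_addr // ler1n.
move=> n; apply: le_trans (nmD _ _) _; rewrite mulrDl; apply: lerD.
  by apply: le_trans (ha n) _; rewrite ler_wpM2l.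
by apply: le_trans (hb n) _; rewrite ler_wpM2l // addnC.
Qed.

Lemma polyboundedZ c a : polybounded a -> polybounded (fun n => c * a n).
Proof.
move=> [k [C C0 ha]]; exists k; exists (nm c * C); first by rewrite mulr_ge0 ?nm_ge0.
by move=> n; rewrite nmM -mulrA ler_wpM2l ?nm_ge0.
Qed.

Lemma polyboundedM_nat a : polybounded a -> polybounded (fun n => n%:R * a n).
Proof.
move=> [k [C C0 ha]]; exists k.+1; exists C => // n; rewrite nmM nm_nat exprS mulrCA.
by apply: ler_pM; rewrite ?nm_ge0 // ler_nat.
Qed.

Lemma polybounded_succ a : polybounded a -> polybounded (fun n => a n.+1).
Proof.
move=> [k [C C0 ha]]; exists k; exists (C * 2 ^+ k); first by rewrite mulr_ge0 ?exprn_ge0.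
move=> n; apply: le_trans (ha _) _; rewrite -mulrA -exprMn ler_wpM2l //.
by rewrite lerXn2r ?nnegrE ?mulr_ge0 // -natrM ler_nat; lia.
Qed.

Definition pshift a (n : nat) : R[i] := if n is m.+1 then a m else 0.

Lemma polybounded_shift a : polybounded a -> polybounded (pshift a).
Proof.
move=> [k [C C0 ha]]; exists k; exists C => // -[|n] /=.
  by rewrite nm0 mulr_ge0 // exprn_ge0.
apply: le_trans (ha n) _; rewrite ler_wpM2l // lerXn2r ?nnegrE // ler_nat; lia.
Qed.

Definition psum a z : R[i] := csum (fun n => a n * z ^+ n).

Lemma cvg_succ_polygeometric k (r : R) : 0 <= r < 1 ->
  cvgn (series (fun n => n.+1%:R ^+ k * r ^+ n)).
Proof.
move=> r01; case/andP: (r01) => r0 r1.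
(* From n + 1 <= 2 n for n > 0; the second summand covers n = 0. *)
apply: (@series_le_cvg _ _ (fun n => 2 ^+ k * (n%:R ^+ k * r ^+ n) + 2 ^+ k * (n%:R ^+ 0 * r ^+ n))).
- by move=> n; rewrite mulr_ge0 ?exprn_ge0.
- by move=> n; rewrite addr_ge0 // !mulr_ge0 ?exprn_ge0.
- move=> n; rewrite -mulrDr -mulrDl mulrA ler_wpM2r ?exprn_ge0 // mulrDr -!exprMn expr0 mulr1.
  case: n => [|n].
    by rewrite expr1n ler_wpDl ?exprn_ge0 ?mulr_ge0 // exprn_ege1 // ler1n.
  apply: ler_wpDr; first by rewrite exprn_ge0.
  by rewrite lerXn2r ?nnegrE ?mulr_ge0 // -natrM ler_nat; lia.
have h (k' : nat) := @cvg_series_scale R (2 ^+ k) _ (@cvg_polygeometric R k' r r01).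
have -> : (fun n => 2 ^+ k * (n%:R ^+ k * r ^+ n) + 2 ^+ k * (n%:R ^+ 0 * r ^+ n)) =
  (fun n => 2 ^+ k * (n%:R ^+ k * r ^+ n)) + (fun n => 2 ^+ k * (n%:R ^+ 0 * r ^+ n)).
  by [].
by apply: is_cvg_seriesD; exact: h.
Qed.

Lemma psum_summable a z : polybounded a -> nm z < 1 -> csummable (fun n => a n * z ^+ n).
Proof.
move=> [k [C C0 ha]] z1.
apply: (@csummable_major _ _ (fun n => C * (n.+1%:R ^+ k * nm z ^+ n))).
  by move=> n; rewrite nmM nmX mulrA ler_wpM2r ?exprn_ge0 ?nm_ge0.
by apply/cvg_series_scale/cvg_succ_polygeometric; rewrite nm_ge0.
Qed.

Lemma psumDZ a b c z : polybounded a -> polybounded b -> nm z < 1 ->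
  psum (fun n => a n + c * b n) z = psum a z + c * psum b z.
Proof.
move=> ha hb z1; rewrite /psum -csumDZ; try exact: psum_summable.
by congr csum; apply/funext => n; rewrite mulrDl mulrA.
Qed.

Lemma psum_at0 a : psum a 0 = a 0%N.
Proof.
apply: csumE; apply: (@tends_near R _ \oo _ (fun=> a 0%N)); last exact: tends_cst.
near=> n; have n1 : (0 < n)%N by near: n; exact: nbhs_infty_gt.
rewrite /series /= big_ltn // big_nat big1 => [|i /andP[i1 _]].
  by rewrite expr0 mulr1 addr0.
by case: i i1 => // i _; rewrite expr0n mulr0.
Unshelve. all: by end_near. Qed.

Lemma csum_succ (u : nat -> R[i]) : u 0%N = 0 -> csummable u -> csum (fun n => u n.+1) = csum u.
Proof.
move=> u0 su; apply: csumE => e e0; have [N _ hN] := su e e0.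
exists N => // n /= Nn; have := hN n.+1 (leqW Nn).
by rewrite /series /= big_nat_recl //= u0 add0r.
Qed.

Lemma psum_shift a z : polybounded a -> nm z < 1 -> psum (pshift a) z = z * psum a z.
Proof.
move=> ha z1; have hs := polybounded_shift ha.
rewrite /psum -csum_succ ?mul0r //; last exact: psum_summable.
rewrite -csumZ; last exact: psum_summable.
by congr csum; apply/funext => n /=; rewrite exprS mulrCA.
Qed.

Definition pderiv a (n : nat) : R[i] := n.+1%:R * a n.+1.

Lemma polybounded_deriv a : polybounded a -> polybounded (pderiv a).
Proof. by move=> h; exact: (polybounded_succ (polyboundedM_nat h)). Qed.

Lemma cdif_psum a z : polybounded a -> nm z < 1 -> cdif (psum a) z (psum (pderiv a) z).
Proof.
move=> ha z1; have [k [C C0 hC]] := ha.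
have rz : nm z < (1 + nm z) / 2 by lra.
have r1 : (1 + nm z) / 2 < 1 by lra.
have r0 : 0 < (1 + nm z) / 2 by have := nm_ge0 z; lra.
move: ((1 + nm z) / 2) rz r1 r0 => r rz r1 r0.
have bound w n : nm w < r -> nm (a n * dquot w z n) <= (C / r) * (n.+1%:R ^+ k.+1 * r ^+ n).
  move=> wr; rewrite nmM exprSr.
  have -> : C / r * (n.+1%:R ^+ k * n.+1%:R * r ^+ n) =
            (C * n.+1%:R ^+ k) * (r^-1 * (n.+1%:R * r ^+ n)) by ring.
  apply: ler_pM; rewrite ?nm_ge0 //.
  apply: le_trans (dquot_bound n r0 (ltW wr) (ltW rz)) _.
  by rewrite ler_wpM2l ?invr_ge0 ?(ltW r0) // ler_wpM2r ?exprn_ge0 ?(ltW r0) // ler_nat.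
have Mc : cvgn (series (fun n => (C / r) * (n.+1%:R ^+ k.+1 * r ^+ n))).
  by apply/cvg_series_scale/cvg_succ_polygeometric; rewrite (ltW r0).
apply: (@cdif_eq R _ _ (csum (fun n => a n * dquot z z n))).
  apply: (@cdif_csum R (fun n w => a n * w ^+ n) (fun n w => a n * dquot w z n)) Mc _.
  + near=> w; apply: psum_summable => //; apply: (lt_trans _ r1); near: w; exact: cnbhs_disc.
  + by near=> w; move=> n; rewrite mulrCA -dquotE mulrBr.
  + by near=> w; move=> n; apply: bound; near: w; exact: cnbhs_disc.
  + by move=> n; apply: tendsM; [exact: tends_cst|exact: dquot_cont].
have s : csummable (fun n => a n * dquot z z n).
  by apply: (csummable_major _ Mc) => n; exact: bound.
rewrite -(csum_succ _ s); last by rewrite /dquot big_ord0 mulr0.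
congr csum; apply/funext => n; rewrite /pderiv mulrAC mulrC; congr (_ * _).
rewrite /dquot (eq_bigr (fun=> z ^+ n)); first by rewrite sumr_const card_ord mulr_natl.
by move=> i _; rewrite -exprD; congr (_ ^+ _); have := ltn_ord i; lia.
Unshelve. all: by end_near. Qed.

Lemma psum_real (a : nat -> R) (x : R) :
  polybounded (fun n => (a n)%:C) -> `|x| < 1 -> complex.Im (psum (fun n => (a n)%:C) x%:C) = 0.
Proof.
move=> ha x1; have xn : nm x%:C < 1 by rewrite nm_real.
have h := tends_Im (psum_summable ha xn).
have im0 : (fun n => complex.Im (series (fun n => (a n)%:C * x%:C ^+ n) n)) = (fun=> 0).
  apply/funext => n; rewrite /series /=.
  rewrite (_ : \sum_(0 <= k < n) _ = (\sum_(0 <= k < n) a k * x ^+ k)%:C) //.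
  by rewrite rmorph_sum; apply: eq_bigr => i _; rewrite rmorphM rmorphXn.
rewrite im0 in h.
have <- := cvg_lim (@Rhausdorff R) (h _).
by apply: (cvg_lim (@Rhausdorff R)); exact: cvg_cst.
Qed.

End PowerSeries.

(** * The hypergeometric series and the second solution *)

Section Hypergeometric.
Context {R : realType}.
Implicit Types (w z : R[i]) (n : nat).

(** The coefficients (1/4)_n (3/4)_n / n!^2, taken in [R] so that order arguments apply to them. *)
Definition hcoef n : R :=
  \prod_(j < n) ((j%:R + 1 / 4) * (j%:R + 3 / 4) / (j%:R + 1) ^+ 2).

Lemma hcoefS n : hcoef n.+1 = hcoef n * ((n%:R + 1 / 4) * (n%:R + 3 / 4) / (n%:R + 1) ^+ 2).
Proof. by rewrite /hcoef big_ord_recr. Qed.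

Lemma hcoef_ge0 n : 0 <= hcoef n.
Proof.
by apply: prodr_ge0 => i _; rewrite divr_ge0 ?mulr_ge0 ?exprn_ge0 ?addr_ge0 ?divr_ge0.
Qed.

Lemma hcoef_le1 n : hcoef n <= 1.
Proof.
elim: n => [|n ih]; first by rewrite /hcoef big_ord0.
rewrite hcoefS -[leRHS]mul1r; apply: ler_pM => //; first exact: hcoef_ge0.
  by rewrite divr_ge0 ?mulr_ge0 ?exprn_ge0 ?addr_ge0 ?divr_ge0.
have n0 : 0 <= n%:R :> R by [].
by rewrite ler_pdivrMr ?exprn_gt0 ?ltr_wpDl // mul1r; nra.
Qed.

(* Coefficients of [z (1 - z) F'(z)]. *)
Definition tcoef n : R := if n is m.+1 then 3 / 16 * hcoef m / m.+1%:R else 0.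

(* [F log z + H] is the second Frobenius solution of the hypergeometric equation at the origin;
   [scoef] and [xcoef] are the coefficients of [H] and of [Xi = z (1 - z) H' + (1 - z) F]. *)
Fixpoint scoef n : R := if n is m.+1 then
  ((m%:R * m.+1%:R + 3 / 16) * scoef m - m.+1%:R * (hcoef m.+1 - hcoef m) - tcoef m.+1)
   / m.+1%:R ^+ 2 else 0.

Definition xcoef n : R := if n is m.+1 then (3 / 16 * scoef m - tcoef m.+1) / m.+1%:R else 1.

(** The hypergeometric equation on coefficients: [tcoef] is defined by integrating (3 / 16) F, and
    the right side is the coefficient of z (1 - z) F'. [xcoefE] does the same for the second
    solution. *)
Lemma tcoefE n : tcoef n.+1 = n.+1%:R * hcoef n.+1 - n%:R * hcoef n.
Proof.
rewrite hcoefS /tcoef -[n.+1%:R]natr1; move: (hcoef n) => a.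
have n1 : n%:R + 1 != 0 :> R by rewrite natr1 pnatr_eq0.
by field.
Qed.

Lemma xcoefE n : xcoef n.+1 =
  n.+1%:R * scoef n.+1 - n%:R * scoef n + (hcoef n.+1 - hcoef n).
Proof.
rewrite /xcoef /scoef -/scoef; move: (hcoef n.+1) (hcoef n) (tcoef n.+1) (scoef n) => a b c d.
have n1 : n.+1%:R != 0 :> R by rewrite pnatr_eq0.
by rewrite -[n.+1%:R]natr1 in n1 *; field.
Qed.

Lemma tcoef_bound n : 0 <= tcoef n <= 1.
Proof.
case: n => [|n] /=; first by rewrite lexx ler01.
have h0 := hcoef_ge0 n; have h1 := hcoef_le1 n.
have n1 : 1 <= n.+1%:R :> R by rewrite ler1n.
have n0 : 0 < n.+1%:R :> R by rewrite (lt_le_trans ltr01).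
by rewrite ler_pdivlMr // mul0r ler_pdivrMr // mul1r; apply/andP; split; lra.
Qed.

Lemma scoef_bound n : `|scoef n| <= 2 * n%:R.
Proof.
elim: n => [|n ih]; first by rewrite /= normr0 mulr0.
have h0 := hcoef_ge0 n; have h1 := hcoef_le1 n.
have k0 := hcoef_ge0 n.+1; have k1 := hcoef_le1 n.+1.
have /andP[t0 t1] := tcoef_bound n.+1.
rewrite /scoef -/scoef.
move: (hcoef n.+1) (hcoef n) (tcoef n.+1) (scoef n) h0 h1 k0 k1 t0 t1 ih.
move=> a b c d h0 h1 k0 k1 t0 t1; rewrite ler_norml => /andP[d1 d2].
have n0 : 0 <= n%:R :> R by [].
rewrite -[n.+1%:R]natr1; move: (n%:R : R) n0 d1 d2 => x x0 d1 d2.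
have x1 : 0 < (x + 1) ^+ 2 by rewrite exprn_gt0 // ltr_wpDl.
by rewrite ler_norml ler_pdivlMr // ler_pdivrMr //; apply/andP; split; nra.
Qed.

Definition hF := psum (fun n => (hcoef n)%:C).
Definition hT := psum (fun n => (tcoef n)%:C).
Definition hH := psum (fun n => (scoef n)%:C).
Definition hX := psum (fun n => (xcoef n)%:C).
Definition hF' := psum (pderiv (fun n => (hcoef n)%:C)).
Definition hH' := psum (pderiv (fun n => (scoef n)%:C)).

Lemma hcoef_polybounded : polybounded (fun n => (hcoef n)%:C).
Proof.
exists 0%N; exists 1 => // n; rewrite nm_real expr0 mulr1 ger0_norm ?hcoef_ge0 //.
exact: hcoef_le1.
Qed.

Lemma tcoef_polybounded : polybounded (fun n => (tcoef n)%:C).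
Proof.
exists 0%N; exists 1 => // n; rewrite nm_real expr0 mulr1.
by have /andP[t0 t1] := tcoef_bound n; rewrite ger0_norm.
Qed.

Lemma scoef_polybounded : polybounded (fun n => (scoef n)%:C).
Proof.
exists 1%N; exists 2 => // n; rewrite nm_real expr1; apply: le_trans (scoef_bound n) _.
by rewrite ler_wpM2l // ler_nat.
Qed.

Lemma xcoef_polybounded : polybounded (fun n => (xcoef n)%:C).
Proof.
exists 1%N; exists 3 => // n; rewrite nm_real expr1; case: n => [|n] /=.
  by rewrite normr1 mulr1 ler1n.
have := scoef_bound n; have /andP := tcoef_bound n.+1; rewrite -/(tcoef n.+1).
move: (scoef n) (tcoef n.+1) => s t [t0 t1]; rewrite ler_norml => /andP[s1 s2].
have n1 : 1 <= n.+1%:R :> R by rewrite ler1n.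
have n0 : 0 < n.+1%:R :> R by rewrite (lt_le_trans ltr01).
rewrite ler_norml ler_pdivlMr // ler_pdivrMr // -[n.+2%:R]natr1.
rewrite -[n.+1%:R]natr1 in n1 n0 *; move: (n%:R : R) n1 n0 s1 s2 => x n1 n0 s1 s2.
by apply/andP; split; nra.
Qed.

Lemma one_sub_psum (a : nat -> R[i]) z : polybounded a -> nm z < 1 ->
  (1 - z) * psum a z = psum (fun n => a n + -1 * pshift a n) z.
Proof.
move=> ha z1; rewrite psumDZ ?psum_shift //; last exact: polybounded_shift.
by move: (psum a z) => b; ring.
Qed.

Lemma hT_shift z : nm z < 1 -> hT z = z * psum (fun n => (tcoef n.+1)%:C) z.
Proof.
move=> z1; rewrite -psum_shift //; last exact: (polybounded_succ tcoef_polybounded).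
by congr (psum _ z); apply/funext => -[|n].
Qed.

Lemma hT1E z : nm z < 1 -> psum (fun n => (tcoef n.+1)%:C) z = (1 - z) * hF' z.
Proof.
move=> z1; rewrite one_sub_psum //; last exact: (polybounded_deriv hcoef_polybounded).
congr (psum _ z); apply/funext => -[|n]; rewrite /pderiv /pshift tcoefE.
  by rewrite !mul1r mul0r subr0 mulr0 addr0.
by rewrite rmorphB !rmorphM /= !rmorph_nat mulN1r.
Qed.

Lemma hTE z : nm z < 1 -> hT z = z * (1 - z) * hF' z.
Proof. by move=> z1; rewrite hT_shift // hT1E // mulrA. Qed.

Lemma hXE z : nm z < 1 -> hX z = z * (1 - z) * hH' z + (1 - z) * hF z.
Proof.
move=> z1; have hb := hcoef_polybounded; have sb := scoef_polybounded.
have -> : z * (1 - z) * hH' z + (1 - z) * hF z = (1 - z) * (hF z + 1 * (z * hH' z)) by ring.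
have sd := polybounded_deriv sb.
have ss := polybounded_shift sd.
rewrite -psum_shift // -psumDZ // one_sub_psum //; last first.
  exact: (polyboundedD hb (polyboundedZ 1 ss)).
congr (psum _ z); apply/funext => -[|[|n]]; rewrite /pshift /pderiv.
- by rewrite /hcoef /= big_ord0 !mulr0 !addr0.
- by rewrite xcoefE mul0r subr0 rmorphD rmorphB rmorphM /= !rmorph_nat; ring.
- by rewrite xcoefE rmorphD !rmorphB !rmorphM /= !rmorph_nat; ring.
Qed.

Lemma cdif_hF z : nm z < 1 -> cdif hF z (hF' z).
Proof. by move=> z1; apply: cdif_psum => //; exact: hcoef_polybounded. Qed.

Lemma cdif_hH z : nm z < 1 -> cdif hH z (hH' z).
Proof. by move=> z1; apply: cdif_psum => //; exact: scoef_polybounded. Qed.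

Lemma cdif_hT z : nm z < 1 -> cdif hT z (3 / 16 * hF z).
Proof.
move=> z1; apply: cdif_eq (cdif_psum tcoef_polybounded z1) _.
rewrite /hF /psum -csumZ; last by apply: psum_summable => //; exact: hcoef_polybounded.
congr csum; apply/funext => n; rewrite /pderiv /tcoef mulrA; congr (_ * _).
rewrite -(rmorph_nat (real_complex R)) -rmorphM /=.
have n1 : n.+1%:R != 0 :> R by rewrite pnatr_eq0.
rewrite mulrC divfK // rmorphM; congr (_ * _).
by rewrite fmorph_div !rmorph_nat.
Qed.

Lemma cdif_hX z : nm z < 1 -> cdif hX z (3 / 16 * hH z - (1 - z) * hF' z).
Proof.
move=> z1; apply: cdif_eq (cdif_psum xcoef_polybounded z1) _.
rewrite -hT1E // addrC -mulN1r addrC.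
have -> : 3 / 16 * hH z + -1 * psum (fun n => (tcoef n.+1)%:C) z =
   psum (fun n => 3 / 16 * (scoef n)%:C + -1 * (tcoef n.+1)%:C) z.
  rewrite psumDZ //; last exact: (polybounded_succ tcoef_polybounded).
    rewrite {2}/psum -csumZ; last by apply: psum_summable => //; exact: scoef_polybounded.
    by congr (csum _ + _); apply/funext => n; rewrite mulrA.
  exact: (polyboundedZ _ scoef_polybounded).
congr (psum _ z); apply/funext => n; rewrite /pderiv /xcoef.
have n1 : n.+1%:R != 0 :> R by rewrite pnatr_eq0.
rewrite -(rmorph_nat (real_complex R)) -rmorphM /=.
have -> : n.+1%:R * ((3 / 16 * scoef n - 3 / 16 * hcoef n / n.+1%:R) / n.+1%:R) =
   3 / 16 * scoef n - tcoef n.+1 by rewrite mulrC divfK.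
rewrite -/(tcoef n.+1); move: (scoef n) (tcoef n.+1) => a b.
by rewrite rmorphB rmorphM fmorph_div !rmorph_nat mulN1r.
Qed.

Lemma hF_at0 : hF 0 = 1.
Proof. by rewrite /hF psum_at0 /hcoef big_ord0 rmorph1. Qed.

Lemma hH_at0 : hH 0 = 0.
Proof. by rewrite /hH psum_at0 rmorph0. Qed.

Lemma hX_at0 : hX 0 = 1.
Proof. by rewrite /hX psum_at0 /xcoef rmorph1. Qed.

(** The left side is z (1 - z) times the Wronskian of F and F log z + H, in which the logarithms
    cancel; it is constant by Abel's identity. *)
Lemma hyper_wronskian z : nm z < 1 -> hF z * hX z - hT z * hH z = 1.
Proof.
move=> z1.
have -> : 1 = hF 0 * hX 0 - hT 0 * hH 0 :> R[i].
  by rewrite hF_at0 hH_at0 hX_at0 mulr0 subr0 mul1r.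
rewrite -{1 2 3 4}(add0r z).
apply: (@cdif0_segment R (fun w => hF w * hX w - hT w * hH w)) => s /andP[s0 s1].
have w1 : nm (0 + s%:C * z) < 1.
  rewrite add0r nmM nm_real ger0_norm //; apply: (le_lt_trans _ z1).
  by rewrite ler_piMl ?nm_ge0.
move: (0 + s%:C * z) w1 => w w1.
apply: cdif_eq (cdifB (cdifM (cdif_hF w1) (cdif_hX w1)) (cdifM (cdif_hT w1) (cdif_hH w1))) _.
rewrite hTE // hXE //; move: (hF w) (hF' w) (hH w) (hH' w) => a b c d.
by ring.
Qed.

Lemma pochhammerE n : pochhammer (1 / 4) n * pochhammer (3 / 4) n / (pochhammer 1 n * n`!%:R) =
  (hcoef n)%:C :> R[i].
Proof.
elim: n => [|n ih].
  by rewrite /pochhammer /hcoef !big_ord0 fact0 !mulr1 invr1 rmorph1 mulr1.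
have n1 : n%:R + 1 != 0 :> R[i] by rewrite natr1 pnatr_eq0.
have p0 : pochhammer (1 : R[i]) n != 0.
  rewrite /pochhammer; apply/prodf_neq0 => i _; by rewrite nat1r pnatr_eq0.
have f0 : n`!%:R != 0 :> R[i] by rewrite pnatr_eq0 -lt0n fact_gt0.
have pS a : pochhammer a n.+1 = pochhammer a n * (a + n%:R) :> R[i].
  by rewrite /pochhammer big_ord_recr.
rewrite hcoefS rmorphM /= -ih !pS factS natrM -[n.+1%:R]natr1.
have -> : ((n%:R + 1 / 4) * (n%:R + 3 / 4) / (n%:R + 1) ^+ 2)%:C =
   (n%:R + 1 / 4) * (n%:R + 3 / 4) / (n%:R + 1) ^+ 2 :> R[i].
  by rewrite fmorph_div rmorphXn rmorphM !rmorphD !fmorph_div !rmorph_nat rmorph1.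
move: (pochhammer 1 n) (pochhammer (1 / 4) n) (pochhammer (3 / 4) n) (n`!%:R : R[i]) (n%:R : R[i]) n1 p0 f0.
move=> p a b f x x1 p0 f0; by field; rewrite ?x1 ?p0 ?f0 ?[1 + x]addrC ?x1.
Qed.

Lemma hyp2F1E z : nm z < 1 -> hyp2F1 (1 / 4) (3 / 4) 1 z = hF z.
Proof.
move=> z1; apply: climE; have := psum_summable hcoef_polybounded z1.
rewrite /csummable -/(psum _ _) -/(hF z); apply: tends_near; near=> m.
by rewrite /series /=; apply: eq_bigr => n _; rewrite pochhammerE.
Unshelve. all: by end_near. Qed.

End Hypergeometric.

(** * The complex exponential, and 1 / sinh^2 at dyadic subdivisions of its period *)

Section ComplexExponential.
Context {R : realType}.
Implicit Types (w z : R[i]) (k n : nat).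

Lemma cexpD z w : cexp (z + w) = cexp z * cexp w.
Proof.
case: z => a b; case: w => c d; rewrite /cexp /= expRD cosD sinD.
by apply/eqP; rewrite eq_complex /=; apply/andP; split; apply/eqP; ring.
Qed.

Lemma cexp0 : cexp 0 = 1 :> R[i].
Proof.
by apply/eqP; rewrite eq_complex /= expR0 cos0 sin0; apply/andP; split; apply/eqP; ring.
Qed.

Lemma nm_cexp z : nm (cexp z) = expR (complex.Re z).
Proof.
rewrite /cexp nmM nm_real gtr0_norm ?expR_gt0 // /nm normc_def /= cos2Dsin2 sqrtr1.
by rewrite mulr1.
Qed.

Lemma cexp_neq0 z : cexp z != 0.
Proof. by rewrite -nm_gt0 nm_cexp expR_gt0. Qed.

Lemma cexpMn z n : cexp (n%:R * z) = cexp z ^+ n.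
Proof.
elim: n => [|n ih]; first by rewrite mul0r cexp0 expr0.
by rewrite -[n.+1%:R]natr1 mulrDl mul1r cexpD ih exprSr.
Qed.

Lemma cexp_real (x : R) : cexp x%:C = (expR x)%:C.
Proof. by rewrite /cexp /= cos0 sin0 mulr1. Qed.

Lemma cexp_ipi : cexp (0 +i* pi) = -1 :> R[i].
Proof.
by apply/eqP; rewrite eq_complex /= expR0 cospi sinpi; apply/andP; split; apply/eqP; ring.
Qed.

Lemma cexp_2ipi : cexp (0 +i* (2 * pi)) = 1 :> R[i].
Proof.
rewrite (_ : _ +i* _ = (0 +i* pi) + (0 +i* pi)) ?cexpD ?cexp_ipi ?mulrNN ?mulr1 //.
by apply/eqP; rewrite eq_complex /=; apply/andP; split; apply/eqP; ring.
Qed.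

Lemma first_order (f : R -> R) (d : R) : is_derive (0 : R) 1 f d ->
  forall e : R, 0 < e -> exists2 r : R, 0 < r &
    forall x, `|x| < r -> `|f x - f 0 - d * x| <= e * `|x|.
Proof.
move=> [df vf] e e0.
have : (fun h : R => h^-1 *: (f (h *: 1 + 0) - f 0)) @ 0^' --> d.
  by rewrite -vf; exact: df.
move/cvgrPdist_lt => /(_ _ e0) [r r0 hr]; exists r => // x xr.
have [->|x0] := eqVneq x 0; first by rewrite subrr mulr0 subr0 normr0 mulr0.
have := hr x; rewrite /= sub0r normrN => /(_ xr x0).
rewrite /GRing.scale /= mulr1 addr0 distrC => h.
have -> : f x - f 0 - d * x = (x^-1 * (f x - f 0) - d) * x.
  by rewrite mulrBl mulrAC mulVf // mul1r.
by rewrite normrM ler_wpM2r // ltW.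
Qed.

Lemma cdif_cexp0 : cdif (@cexp R) 0 1.
Proof.
exists (fun h => if h == 0 then 1 else (cexp h - 1) / h); last first.
  near=> w; rewrite subr0 cexp0; have [->|w0] := eqVneq w 0; first by rewrite cexp0 subrr mul0r.
  by rewrite mulrC divfK.
(* In units of [nm h] the real part will cost at most 4 e' and the imaginary part 3 e', so e / 8
   suffices. *)
move=> e e0; pose e' := Num.min (e / 8) 1.
have e'0 : 0 < e' by rewrite lt_min ltr01 andbT divr_gt0.
have e'8 : e' <= e / 8 by rewrite ge_min lexx.
have e'1 : e' <= 1 by rewrite ge_min lexx orbT.
have [r1 r10 h1] := first_order (is_derive_expR 0) e'0.
have [r2 r20 h2] := first_order (is_derive_sin 0) e'0.
have [r3 r30 h3] := first_order (is_derive_cos 0) e'0.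
pose r := Num.min (Num.min r1 r2) (Num.min r3 (e' / 2)).
have r0 : 0 < r by rewrite !lt_min r10 r20 r30 divr_gt0.
exists r => // h; rewrite subr0 !lt_min => /andP[/andP[hr1 hr2] /andP[hr3 hr4]].
have [h0|hn0] /= := eqVneq h 0; first by rewrite subrr nm0.
have hh : 0 < nm h by rewrite nm_gt0.
have -> : (cexp h - 1) / h - 1 = (cexp h - 1 - h) / h by field.
rewrite nmM nmV ltr_pdivrMr //.
have ha := nm_Re h; have hb := nm_Im h.
have := h1 _ (le_lt_trans ha hr1); have := h2 _ (le_lt_trans hb hr2).
have := h3 _ (le_lt_trans hb hr3).
rewrite expR0 sin0 cos0 oppr0 !mul0r !subr0 !mul1r /cexp.
have -> : (expR (complex.Re h))%:C * (cos (complex.Im h) +i* sin (complex.Im h)) - 1 - h =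
  ((expR (complex.Re h) - 1 - complex.Re h) + expR (complex.Re h) * (cos (complex.Im h) - 1)) +i*
  ((sin (complex.Im h) - complex.Im h) + (expR (complex.Re h) - 1) * sin (complex.Im h)).
  case: (h) => a b; apply/eqP; rewrite eq_complex /=; apply/andP; split; apply/eqP; ring.
move: (complex.Re h) (complex.Im h) ha hb (expR _) (sin _) (cos _) => a b ha hb E S C hC; rewrite addr0 => hS hE.
apply: le_lt_trans (nm_ReIm _) _; rewrite /=.
have H : nm h < 1 by apply: (lt_le_trans hr4); lra.
have ea : e' * `|a| <= nm h by apply: (le_trans _ ha); rewrite ler_piMl.
have eb : e' * `|b| <= nm h by apply: (le_trans _ hb); rewrite ler_piMl.
have hE1 : `|E - 1| <= 2 * nm h.
  have -> : E - 1 = (E - 1 - a) + a by ring.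
  by apply: le_trans (ler_normD _ _) _; lra.
have hE2 : `|E| <= 3.
  have -> : E = (E - 1) + 1 by ring.
  by apply: le_trans (ler_normD _ _) _; rewrite normr1; lra.
have hS1 : `|S| <= 2 * nm h.
  have -> : S = (S - b) + b by ring.
  by apply: le_trans (ler_normD _ _) _; lra.
have t1 : `|E * (C - 1)| <= 3 * (e' * nm h).
  rewrite normrM; apply: ler_pM => //; apply: le_trans hC _; rewrite ler_wpM2l // ltW //.
have t2 : `|(E - 1) * S| <= (2 * nm h) * (2 * nm h) by rewrite normrM; apply: ler_pM.
have t3 : `|E - 1 - a + E * (C - 1)| <= e' * nm h + 3 * (e' * nm h).
  apply: le_trans (ler_normD _ _) _; apply: lerD => //; apply: le_trans hE _.
  by rewrite ler_wpM2l // ltW.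
have t4 : `|S - b + (E - 1) * S| <= e' * nm h + (2 * nm h) * (2 * nm h).
  apply: le_trans (ler_normD _ _) _; apply: lerD => //; apply: le_trans hS _.
  by rewrite ler_wpM2l // ltW.
have t5 : (2 * nm h) * (2 * nm h) <= 2 * (e' * nm h) by nra.
have : e' * nm h <= e / 8 * nm h by rewrite ler_wpM2r // ltW.
have : 0 < e * nm h by rewrite mulr_gt0.
lra.
Unshelve. all: by end_near. Qed.

Lemma cdif_cexp z : cdif (@cexp R) z (cexp z).
Proof.
have h : cdif (fun w => w - z) z 1.
  by apply: cdif_eq (cdifB (cdif_id z) (cdif_cst z z)) _; rewrite subr0.
have h0 : cdif (@cexp R) ((fun w => w - z) z) 1 by rewrite subrr; exact: cdif_cexp0.
apply: (@cdif_near _ (fun w => cexp z * cexp (w - z))).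
  by near=> w; rewrite -cexpD subrKC.
by apply: cdif_eq (cdifZ _ (cdif_comp h h0)) _; rewrite !mulr1.
Unshelve. all: by end_near. Qed.

(* [csq s = 1 / (4 sinh^2 (s / 2))] *)
Definition csq z : R[i] := cexp z / (1 - cexp z) ^+ 2.

Lemma sqr_nm_one_sub_cexp (r t : R) :
  nm (1 - cexp (r +i* t)) ^+ 2 = (1 - expR r) ^+ 2 + 4 * expR r * sin (t / 2) ^+ 2.
Proof.
rewrite nm_sqr /cexp /=; have : cos t = 1 - 2 * sin (t / 2) ^+ 2.
  by rewrite {1}(splitr t) cosD -!expr2 cos2sin2; ring.
have := cos2Dsin2 t; move: (sin t) (cos t) (sin (t / 2)) (expR r) => a b c e h1 h2.
have -> : (1 - (e * b - 0 * a)) ^+ 2 + (0 - (e * a + 0 * b)) ^+ 2 = 1 - 2 * e * b + e ^+ 2 * (b ^+ 2 + a ^+ 2).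
  by ring.
by rewrite h1 h2; ring.
Qed.

Lemma one_sub_cexp_neq0 (r t : R) : sin (t / 2) != 0 -> 1 - cexp (r +i* t) != 0.
Proof.
move=> s0; apply/eqP => h; have := sqr_nm_one_sub_cexp r t.
rewrite h nm0 expr0n /= => /esym/eqP; apply/negP; rewrite gt_eqF //.
have s2 : 0 < sin (t / 2) ^+ 2 by rewrite lt_neqAle sqr_ge0 eq_sym expf_neq0.
apply: ltr_wpDl; first exact: sqr_ge0.
by rewrite mulr_gt0 // mulr_gt0 // expR_gt0.
Qed.

Lemma csq_bound (r t : R) : sin (t / 2) != 0 -> nm (csq (r +i* t)) <= (4 * sin (t / 2) ^+ 2)^-1.
Proof.
move=> s0; have s2 : 0 < sin (t / 2) ^+ 2 by rewrite lt_neqAle sqr_ge0 eq_sym expf_neq0.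
rewrite /csq nmM nmV nmX sqr_nm_one_sub_cexp nm_cexp /=.
have e0 := expR_gt0 r.
have d0 : 0 < (1 - expR r) ^+ 2 + 4 * expR r * sin (t / 2) ^+ 2.
  by apply: ltr_wpDl; [exact: sqr_ge0|rewrite mulr_gt0 // mulr_gt0].
rewrite ler_pdivrMr // mulrC ler_pdivlMr; last by rewrite mulr_gt0.
rewrite mulrA [expR r * 4]mulrC lerDr; exact: sqr_ge0.
Qed.

Lemma csqD2pi (r t : R) : csq (r +i* (t + 2 * pi)) = csq (r +i* t).
Proof.
have -> : r +i* (t + 2 * pi) = (r +i* t) + (0 +i* (2 * pi)).
  by apply/eqP; rewrite eq_complex /= addr0 !eqxx.
by rewrite /csq cexpD cexp_2ipi mulr1.
Qed.

(** The shift by pi changes E = [cexp] into -E, and E / (1 - E)^2 - E / (1 + E)^2 = 4 E^2 / (1 -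
    E^2)^2. Iterated, it spreads [csq] over 2^n points of the period. *)
Lemma csq_double (r t : R) : 1 - cexp ((2 * r) +i* (2 * t)) != 0 ->
  csq (r +i* t) + csq (r +i* (t + pi)) = 4 * csq ((2 * r) +i* (2 * t)).
Proof.
have -> : r +i* (t + pi) = (r +i* t) + (0 +i* pi).
  by apply/eqP; rewrite eq_complex /= addr0 !eqxx.
have -> : (2 * r) +i* (2 * t) = (r +i* t) + (r +i* t).
  by apply/eqP; rewrite eq_complex /=; apply/andP; split; apply/eqP; ring.
rewrite /csq !cexpD cexp_ipi; move: (cexp _) => E h.
have : (1 - E) * (1 + E) != 0 by apply: contra_neq h => <-; ring.
rewrite mulf_eq0 negb_or => /andP[h1 h2].
have -> : 1 - E * -1 = 1 + E by ring.
field; by rewrite h h1 h2.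
Qed.

Lemma le_cos_pi (x y : R) : 0 <= x -> x <= y -> y <= pi -> cos y <= cos x.
Proof.
move=> x0 xy yp; have [<-|xn] := eqVneq x y; first exact: lexx.
have xy' : x < y by rewrite lt_neqAle xn.
have hx : x \in `[0, pi] by rewrite in_itv /= x0 (le_trans xy).
have hy : y \in `[0, pi] by rewrite in_itv /= yp (le_trans x0).
by rewrite ltW // (ltr_cos hx hy).
Qed.

(** A weak Jordan inequality: sin x = 2 sin (x / 2) cos (x / 2), the mean value theorem bounds sin
    (x / 2) below by (x / 2) cos (pi / 4), and cos^2 (pi / 4) = 1/2. *)
Lemma sin_ge_half (x : R) : 0 <= x <= pi / 2 -> x / 2 <= sin x.
Proof.
move=> /andP[x0 x1]; have p0 := pi_gt0 R.
have sin_mvt (y : R) : 0 <= y <= pi / 4 -> y * cos (pi / 4) <= sin y.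
  move=> /andP[y0 y1].
  have [c] := @MVT_segment R sin cos 0 y y0 (fun u _ => is_derive_sin u)
    (continuous_subspaceT (@continuous_sin R)).
  rewrite in_itv /= sin0 !subr0 mulrC => /andP[c0 cy] ->.
  by rewrite ler_wpM2l //; apply: le_cos_pi => //; lra.
have c4 : cos (pi / 4) ^+ 2 = 1 / 2 :> R.
  have : cos (pi / 4 + pi / 4) = 0 :> R.
    by rewrite -[RHS](@cos_pihalf R); congr cos; field.
  by rewrite cosD -!expr2 sin2cos2; lra.
have cx : cos (pi / 4) <= cos (x / 2) by apply: le_cos_pi; lra.
have c40 : 0 <= cos (pi / 4) :> R by rewrite cos_ge0_pihalf //; apply/andP; split; lra.
have hx := sin_mvt (x / 2); have {}hx : x / 2 * cos (pi / 4) <= sin (x / 2) by apply: hx; apply/andP; split; lra.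
have -> : sin x = 2 * (sin (x / 2) * cos (x / 2)).
  by rewrite {1}(splitr x) sinD; ring.
have : x / 2 * cos (pi / 4) * cos (pi / 4) <= sin (x / 2) * cos (x / 2).
  by apply: ler_pM => //; rewrite mulr_ge0 // divr_ge0.
rewrite -mulrA -expr2 c4; lra.
Qed.

(** The value at (s + 2 pi i k) / 2^n. Divided by 4^n it tends to 1 / (s + 2 pi i k)^2. *)
Definition node (s : R) n k : R[i] := csq ((s / 2 ^+ n) +i* (2 * pi * k%:R / 2 ^+ n)).

Lemma pow2_gt0 n : 0 < 2 ^+ n :> R. Proof. by rewrite exprn_gt0. Qed.

Lemma node_sin n k : (0 < k)%N -> (k < 2 ^ n)%N -> 0 < sin (2 * pi * k%:R / 2 ^+ n / 2) :> R.
Proof.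
move=> k0 kn; have p0 := pi_gt0 R; have n0 := pow2_gt0 n.
apply: sin_gt0_pi; have -> : 2 * pi * k%:R / 2 ^+ n / 2 = pi * (k%:R / 2 ^+ n) :> R.
  by field; rewrite gt_eqF.
rewrite mulr_gt0 ?divr_gt0 ?ltr0n //= -[ltRHS]mulr1 ltr_pM2l // ltr_pdivrMr // mul1r.
by rewrite -natrX ltr_nat.
Qed.

Lemma node_double (s : R) n k : (0 < k)%N -> (k < 2 ^ n)%N ->
  node s n.+1 k + node s n.+1 (k + 2 ^ n) = 4 * node s n k.
Proof.
move=> k0 kn; have n0 := pow2_gt0 n.
rewrite /node natrD natrX.
have -> : 2 * pi * (k%:R + 2 ^+ n) / 2 ^+ n.+1 = 2 * pi * k%:R / 2 ^+ n.+1 + pi :> R.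
  by rewrite exprS; field; rewrite gt_eqF.
have e1 : s / 2 ^+ n = 2 * (s / 2 ^+ n.+1) by rewrite exprS; field; rewrite gt_eqF.
have e2 : 2 * pi * k%:R / 2 ^+ n = 2 * (2 * pi * k%:R / 2 ^+ n.+1) :> R.
  by rewrite exprS; field; rewrite gt_eqF.
rewrite csq_double -?e1 -?e2 //; apply: one_sub_cexp_neq0.
by rewrite gt_eqF // node_sin.
Qed.

Lemma node_half (s : R) n : node s n.+1 (2 ^ n) = csq ((s / 2 ^+ n.+1) +i* pi).
Proof.
rewrite /node natrX; congr (csq (_ +i* _)).
by rewrite exprS; field; rewrite gt_eqF // pow2_gt0.
Qed.

(** The node k = 0 is left out, so that s = 0 is admissible. *)
Definition node_sum (s : R) n : R[i] := \sum_(1 <= k < 2 ^ n) node s n k.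

(** The nodes k and k + 2^n of the finer level merge into node k of the coarser one. Only the middle
    node 2^n, the partner of the omitted k = 0, stays alone. *)
Lemma node_sumS (s : R) n :
  node_sum s n.+1 = 4 * node_sum s n + csq ((s / 2 ^+ n.+1) +i* pi).
Proof.
have n0 : (0 < 2 ^ n)%N by rewrite expn_gt0.
have e : (2 ^ n.+1 = 2 ^ n + 2 ^ n)%N by rewrite expnS mul2n addnn.
rewrite /node_sum e (@big_cat_nat _ _ _ (2 ^ n)) ?leq_addr //=.
rewrite [X in _ + X]big_ltn ?node_half; last by rewrite -[ltnLHS]addn0 ltn_add2l.
rewrite -[(2 ^ n).+1]add1n.
rewrite big_addn addnK mulr_sumr addrCA [RHS]addrC -big_split /=; congr (_ + _).
rewrite !big_nat; apply: eq_bigr => k /andP[k0 kn].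
by rewrite node_double.
Qed.

Lemma csq_half_step (s : R) n : s < 0 ->
  csq ((s / 2 ^+ n.+1) +i* pi) = 4 * csq ((s / 2 ^+ n) +i* 0) - csq ((s / 2 ^+ n.+1) +i* 0).
Proof.
move=> s0; have n0 := pow2_gt0 n.
have e1 : s / 2 ^+ n = 2 * (s / 2 ^+ n.+1) by rewrite exprS; field; rewrite gt_eqF.
have := @csq_double (s / 2 ^+ n.+1) 0; rewrite add0r mulr0 -e1 => <-; first by rewrite addrC addKr.
rewrite -nm_gt0; apply: lt_le_trans (nm_sub_ge _ _).
by rewrite nm1 nm_cexp /= subr_gt0 expR_lt1 pmulr_llt0 // invr_gt0.
Qed.

Lemma node_sum_neg (s : R) n : s < 0 ->
  node_sum s n = 4 ^+ n * csq (s +i* 0) - csq ((s / 2 ^+ n) +i* 0).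
Proof.
move=> s0; elim: n => [|n ih].
  by rewrite /node_sum big_geq // expr0 divr1 mul1r subrr.
by rewrite node_sumS ih csq_half_step // [4 ^+ n.+1]exprS; ring.
Qed.

(** Here [csq] at i pi is -1/4, so the recursion is explicit. The resulting limit -1/12 yields the
    sum of the inverse squares. *)
Lemma node_sum0 n : node_sum 0 n = - (4 ^+ n - 1) / 12.
Proof.
elim: n => [|n ih]; first by rewrite /node_sum big_geq // expr0 subrr oppr0 mul0r.
rewrite node_sumS ih mul0r /csq cexp_ipi [4 ^+ n.+1]exprS.
by move: (4 ^+ n) => x; field.
Qed.

Lemma node_rev (s : R) n k : (k <= 2 ^ n)%N ->
  node s n (2 ^ n - k) = csq ((s / 2 ^+ n) +i* (- (2 * pi * k%:R / 2 ^+ n))).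
Proof.
move=> kn; rewrite /node natrB // natrX -[RHS]csqD2pi; congr (csq (_ +i* _)).
by field; rewrite gt_eqF // pow2_gt0.
Qed.

(** The majorant for Tannery's theorem: after division by 4^(n + 1) it depends neither on n nor on
    s. The condition k <= 2^n keeps the half angle at most pi / 2, where [sin_ge_half] applies. *)
Lemma node_bound (s : R) n k : (0 < k)%N -> (k <= 2 ^ n)%N ->
  nm (node s n.+1 k) <= 4 ^+ n.+1 / k%:R ^+ 2 /\
  nm (node s n.+1 (2 ^ n.+1 - k)) <= 4 ^+ n.+1 / k%:R ^+ 2.
Proof.
move=> k0 kn; have p0 := pi_gt0 R; have n0 := pow2_gt0 n; have p2 := pi_ge2 R.
have kn1 : (k < 2 ^ n.+1)%N by rewrite expnS mul2n -addnn; have := expn_gt0 2 n; lia.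
have s0 := node_sin k0 kn1.
have k0' : 0 < k%:R :> R by rewrite ltr0n.
set t := 2 * pi * k%:R / 2 ^+ n.+1 in s0 *.
have key : (4 * sin (t / 2) ^+ 2)^-1 <= 4 ^+ n.+1 / k%:R ^+ 2.
  rewrite -[leRHS]invf_div lef_pV2 ?posrE ?mulr_gt0 ?invr_gt0 ?exprn_gt0 //.
  have tE : t / 2 = pi * (k%:R / 2 ^+ n.+1) by rewrite /t; field; rewrite expf_neq0 // pnatr_eq0.
  have h : k%:R / 2 ^+ n.+1 <= sin (t / 2).
    apply: (@le_trans _ _ (t / 2 / 2)).
      rewrite tE -mulrA mulrCA ler_pMr ?divr_gt0 ?exprn_gt0 //; lra.
    apply: sin_ge_half; rewrite tE mulr_ge0 ?divr_ge0 ?exprn_ge0 ?(ltW p0) //=.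
    have h2 : k%:R <= 2 ^+ n :> R by rewrite -natrX ler_nat.
    by rewrite ler_wpM2l ?(ltW p0) // exprS ler_pdivrMr ?mulr_gt0 //; lra.
  have -> : k%:R ^+ 2 / 4 ^+ n.+1 = (k%:R / 2 ^+ n.+1) ^+ 2 :> R.
    rewrite expr_div_n -exprM mulnC exprM; congr (_ / _ ^+ _); ring.
  apply: (@le_trans _ _ (sin (t / 2) ^+ 2)).
    by rewrite lerXn2r ?nnegrE ?divr_ge0 ?exprn_ge0 // ltW.
  by have := sqr_ge0 (sin (t / 2)); lra.
split; first by apply: le_trans (csq_bound _ _) key; rewrite gt_eqF.
rewrite node_rev ?(ltnW kn1) //; apply: le_trans (csq_bound _ _) _; rewrite mulNr sinN.
  by rewrite oppr_eq0 gt_eqF.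
by rewrite sqrrN.
Qed.

Lemma csq_limit (a b : R) : a +i* b != 0 ->
  tends \oo (fun n => csq ((a / 2 ^+ n) +i* (b / 2 ^+ n)) / 4 ^+ n) ((a +i* b) ^+ 2)^-1.
Proof.
move=> w0; set w := a +i* b in w0 *.
have vE n : (a / 2 ^+ n) +i* (b / 2 ^+ n) = w * ((2^-1) ^+ n)%:C.
  by rewrite /w exprVn; apply/eqP; rewrite eq_complex /=; apply/andP; split; apply/eqP; ring.
have v0 : tends \oo (fun n => w * ((2^-1) ^+ n)%:C) 0.
  rewrite -(mulr0 w); apply: tendsM; first exact: tends_cst.
  rewrite -(rmorph0 (real_complex R)); apply/tends_real; apply: cvg_expr.
  by rewrite ger0_norm; lra.
have [g g1 hg] := cdif_cexp0.
have gv := tends_comp v0 g1; have hgv := tends_cnbhs v0 hg.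
have cc := tends_comp v0 (cdif_cont cdif_cexp0); rewrite cexp0 in cc.
apply: (@tends_near R _ \oo _ (fun n => cexp (w * ((2^-1) ^+ n)%:C) / (w ^+ 2 * g (w * ((2^-1) ^+ n)%:C) ^+ 2))).
  near=> n; rewrite /csq vE.
  have : cexp (w * ((2^-1) ^+ n)%:C) - cexp 0 = (w * ((2^-1) ^+ n)%:C - 0) * g (w * ((2^-1) ^+ n)%:C).
    by near: n; exact: hgv.
  rewrite cexp0 subr0 => h.
  have -> : (1 - cexp (w * ((2^-1) ^+ n)%:C)) ^+ 2 = (w * ((2^-1) ^+ n)%:C * g (w * ((2^-1) ^+ n)%:C)) ^+ 2.
    by rewrite -h -sqrrN opprB.
  rewrite !exprMn rmorphXn /= fmorphV rmorph_nat.
  have -> : ((2^-1 : R[i]) ^+ n) ^+ 2 = (4 ^+ n)^-1.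
    by rewrite -exprM mulnC exprM exprVn -natrX -[in RHS](exprVn _ 1) ?expr1 exprVn.
  have p4 : 4 ^+ n != 0 :> R[i] by rewrite expf_neq0 // pnatr_eq0.
  move: (cexp _) (g _) (4 ^+ n) p4 => E G Q Q0.
  have -> : (w ^+ 2 * Q^-1 * G ^+ 2)^-1 = (w ^+ 2 * G ^+ 2)^-1 * Q.
    by rewrite !invfM invrK; move: (w ^- 2) (G ^- 2) => x y; ring.
  by rewrite [E * (_ * Q)]mulrA mulfK.
have -> : (w ^+ 2)^-1 = 1 / (w ^+ 2 * 1 ^+ 2) by rewrite expr1n mulr1 mul1r.
have den : tends \oo (fun n => w ^+ 2 * g (w * ((2^-1) ^+ n)%:C) ^+ 2) (w ^+ 2 * 1 ^+ 2).
  exact: tendsM (tends_cst (w ^+ 2)) (tendsX 2 (gv _)).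
have d0 : w ^+ 2 * 1 ^+ 2 != 0 by rewrite expr1n mulr1 expf_neq0.
exact: tendsM (cc _) (tendsV d0 den).
Unshelve. all: by end_near. Qed.

End ComplexExponential.

(** * Partial fractions of 1 / sinh^2 and the sum of inverse squares *)

Section PartialFractions.
Context {R : realType}.
Implicit Types (w z : R[i]) (k n m j : nat).

Lemma tends_succ (f : nat -> R[i]) l : tends \oo f l -> tends \oo (fun n => f n.+1) l.
Proof. by move=> h e /h[N _ hN]; exists N => // n /= Nn; apply: hN => /=; exact: leqW. Qed.

Lemma csum_finite (u : nat -> R[i]) N : (forall n, (N <= n)%N -> u n = 0) ->
  csum u = \sum_(0 <= n < N) u n.
Proof.
move=> h; apply: csumE; apply: (@tends_near R _ \oo _ (fun=> \sum_(0 <= n < N) u n)); last exact: tends_cst.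
near=> n; have Nn : (N <= n)%N by near: n; exact: nbhs_infty_ge.
have tail : \sum_(N <= i < n) u i = 0 by rewrite big_nat big1 // => i /andP[/h].
by rewrite /series /= [RHS](@big_cat_nat _ _ _ N) //= tail addr0.
Unshelve. all: by end_near. Qed.

Lemma cvg_inv_sqr : cvgn (series (fun n => (n.+1%:R ^+ 2)^-1 : R)).
Proof.
apply: nondecreasing_is_cvgn.
  by apply: nondecreasing_series => n _ _; rewrite invr_ge0 exprn_ge0.
exists 2 => _ [[|n] _ <-]; rewrite /series /=; first by rewrite big_geq.
(* The bound telescopes, as 1 / (x + 1)^2 <= 1 / x - 1 / (x + 1). *)
suff h : \sum_(0 <= k < n.+1) (k.+1%:R ^+ 2)^-1 <= 2 - 1 / n.+1%:R :> R.
  by apply: le_trans h _; rewrite gerBl divr_ge0.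
elim: n => [|n ih]; first by rewrite big_nat1 expr1n invr1; lra.
rewrite big_nat_recr //=; apply: le_trans (lerD ih (lexx _)) _.
have n0 : 0 < n.+1%:R :> R by rewrite ltr0n.
rewrite -[n.+2%:R]natr1; move: (n.+1%:R : R) n0 => x x0.
have -> : 2 - 1 / (x + 1) = 2 - 1 / x + (x * (x + 1))^-1.
  by field; rewrite !gt_eqF ?addr_gt0.
rewrite lerD2l lef_pV2 ?posrE ?exprn_gt0 ?mulr_gt0 ?addr_gt0 // expr2 ler_pM2r ?addr_gt0 //.
by rewrite lerDl.
Qed.

Definition pf_term (s : R) k : R[i] :=
  ((s +i* (2 * pi * k.+1%:R)) ^+ 2)^-1 + ((s +i* (- (2 * pi * k.+1%:R))) ^+ 2)^-1.

(** By periodicity the nodes near the far end of the period stand for negative k. Pairing k with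
    2^(n + 1) - k gives the two halves of [pf_term], and the middle node vanishes in the limit. *)
Lemma node_sum_limit (s : R) : s <= 0 ->
  tends \oo (fun n => node_sum s n / 4 ^+ n) (csum (pf_term s)).
Proof.
move=> s0; have p0 := pi_gt0 R.
pose f n k : R[i] := if (k.+1 < 2 ^ n)%N then
  (node s n.+1 k.+1 + node s n.+1 (2 ^ n.+1 - k.+1)) / 4 ^+ n.+1 else 0.
have fE n : csum (f n) = (node_sum s n.+1 - node s n.+1 (2 ^ n)) / 4 ^+ n.+1.
  have n0 : (0 < 2 ^ n)%N by rewrite expn_gt0.
  rewrite (@csum_finite _ (2 ^ n).-1); last first.
    by move=> k kn; rewrite /f; case: ifP => //; lia.
  have e : (2 ^ n.+1 = 2 ^ n + 2 ^ n)%N by rewrite expnS mul2n addnn.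
  have -> : node_sum s n.+1 = \sum_(1 <= k < 2 ^ n) node s n.+1 k +
     (node s n.+1 (2 ^ n) + \sum_(1 <= i < 2 ^ n) node s n.+1 (i + 2 ^ n)).
    rewrite /node_sum e (@big_cat_nat _ _ _ (2 ^ n)) ?leq_addr //=.
    rewrite [X in _ + X]big_ltn; last by rewrite -[ltnLHS]addn0 ltn_add2l.
    by rewrite -[(2 ^ n).+1]add1n big_addn addnK.
  have -> : \sum_(1 <= i < 2 ^ n) node s n.+1 (i + 2 ^ n) =
            \sum_(1 <= i < 2 ^ n) node s n.+1 (2 ^ n.+1 - i).
    rewrite big_nat_rev /= !big_nat; apply: eq_bigr => i /andP[i1 iN].
    by congr (node s n.+1 _); lia.
  rewrite [X in X / _](_ : _ = \sum_(1 <= k < 2 ^ n) (node s n.+1 k + node s n.+1 (2 ^ n.+1 - k))); last first.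
    by rewrite big_split /=; ring.
  rewrite mulr_suml [RHS](_ : _ = \sum_(0 <= k < (2 ^ n).-1)
     (node s n.+1 k.+1 + node s n.+1 (2 ^ n.+1 - k.+1)) / 4 ^+ n.+1); last first.
    by rewrite -{1}(prednK n0) big_add1.
  rewrite !big_nat.
  by apply: eq_bigr => k /andP[_ kn]; rewrite /f ifT //; lia.
have p4 n : 4 ^+ n != 0 :> R[i] by rewrite expf_neq0 // pnatr_eq0.
have nm4 n : nm (4 ^+ n : R[i])^-1 = (4 ^+ n)^-1 by rewrite nmV nmX nm_nat.
have r4 n : 0 < 4 ^+ n :> R by rewrite exprn_gt0.
have lim1 : tends \oo (fun n => csum (f n)) (csum (pf_term s)).
  apply: (@tends_csum R _ \oo _ f (pf_term s) (fun k => 2 * (k.+1%:R ^+ 2)^-1)).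
  - near=> n; move=> k; rewrite /f; case: ifP => [kn|_]; last first.
      by rewrite nm0 mulr_ge0 // invr_ge0 exprn_ge0.
    have [h1 h2] := @node_bound R s n k.+1 (ltn0Sn k) (ltnW kn).
    rewrite nmM nm4 ler_pdivrMr //; apply: le_trans (nmD _ _) _.
    have -> : 2 * (k.+1%:R ^+ 2)^-1 * 4 ^+ n.+1 =
       4 ^+ n.+1 / k.+1%:R ^+ 2 + 4 ^+ n.+1 / k.+1%:R ^+ 2 :> R.
      by move: (4 ^+ n.+1) (_^-1) => x y; ring.
    exact: lerD.
  - exact: cvg_series_scale cvg_inv_sqr.
  - move=> k; have t0 : 0 < 2 * pi * k.+1%:R :> R by rewrite !mulr_gt0 // ltr0n.
    have w1 : s +i* (2 * pi * k.+1%:R) != 0.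
      by rewrite eq_complex /= negb_and (gt_eqF t0) orbT.
    have w2 : s +i* (- (2 * pi * k.+1%:R)) != 0.
      by rewrite eq_complex /= negb_and oppr_eq0 (gt_eqF t0) orbT.
    apply: (tends_near _ (tendsD (tends_succ (csq_limit w1)) (tends_succ (csq_limit w2)))).
    have N0 := nbhs_infty_gt k.+1.
    near=> n; have kn : (k.+1 < n)%N by near: n; exact: N0.
    have kn2 : (k.+1 < 2 ^ n)%N by apply: (ltn_trans kn); exact: ltn_expl.
    have kn3 : (k.+1 <= 2 ^ n.+1)%N by apply: leq_trans (ltnW kn2) _; rewrite leq_exp2l.
    by rewrite /f kn2 [RHS]mulrDl node_rev // mulNr.
have lim2 : tends \oo (fun n => node s n.+1 (2 ^ n) / 4 ^+ n.+1) 0.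
  apply: (@tends_squeeze R _ \oo _ _ _ (fun n => geometric 1 4^-1 n)).
    near=> n; rewrite subr0 nmM nm4 /geometric /= mul1r exprVn exprS invfM mulrA.
    have [h1 _] := @node_bound R s n (2 ^ n) ltac:(by rewrite expn_gt0) (leqnn _).
    rewrite ler_piMl ?invr_ge0 ?(ltW (r4 _)) // ler_pdivrMr // mul1r; apply: le_trans h1 _.
    have -> : (2 ^ n)%:R ^+ 2 = 4 ^+ n :> R by rewrite natrX -exprM mulnC exprM -natrX.
    by rewrite exprS mulfK // gt_eqF.
  by apply: cvg_geometric; rewrite ger0_norm; lra.
have lim3 : tends \oo (fun n => csum (f n) + node s n.+1 (2 ^ n) / 4 ^+ n.+1) (csum (pf_term s)).
  by rewrite -[csum (pf_term s)]addr0; exact: tendsD.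
have lim4 : tends \oo (fun n => node_sum s n.+1 / 4 ^+ n.+1) (csum (pf_term s)).
  apply: tends_near lim3; near=> n; rewrite fE.
  by move: (node_sum s n.+1) (node s n.+1 (2 ^ n)) => x y; ring.
move=> e /lim4[N _ hN]; exists N.+1 => // -[//|n] /= Nn.
exact: hN.
Unshelve. all: by end_near. Qed.

Lemma sum_inv_sqr : csum (fun k => ((k.+1%:R ^+ 2)^-1)%:C) = (pi ^+ 2 / 6)%:C :> R[i].
Proof.
have p0 := pi_gt0 R.
have h := node_sum_limit (lexx 0).
have h2 : tends \oo (fun n => node_sum (0 : R) n / 4 ^+ n) (- (1 / 12)).
  have g4 : tends \oo (fun n => ((4^-1) ^+ n)%:C) (0 : R[i]).
    rewrite -(rmorph0 (real_complex R)); apply/tends_real; apply: cvg_expr.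
    by rewrite ger0_norm; lra.
  have -> : - (1 / 12) = (- (1 / 12) + (1 / 12) * 0 : R[i]) by ring.
  apply: (tends_near _ (tendsD (tends_cst _) (tendsM (tends_cst (1 / 12)) g4))).
  near=> n; rewrite node_sum0 rmorphXn fmorphV rmorph_nat exprVn.
  by field; rewrite expf_neq0 // pnatr_eq0.
have e : csum (pf_term 0) = - (1 / 12) := tends_unique _ h h2.
have sm : csummable (fun k => ((k.+1%:R ^+ 2)^-1)%:C : R[i]).
  apply: (csummable_major _ cvg_inv_sqr) => n.
  by rewrite nm_real ger0_norm ?invr_ge0 ?exprn_ge0.
have tE : pf_term 0 = (fun k => (- (2 * pi ^+ 2)^-1)%:C * ((k.+1%:R ^+ 2)^-1)%:C).
  apply/funext => k; have k0 : k.+1%:R != 0 :> R by rewrite pnatr_eq0.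
  rewrite /pf_term -rmorphM; have -> : (0 +i* (2 * pi * k.+1%:R)) ^+ 2 = (- (2 * pi * k.+1%:R) ^+ 2)%:C :> R[i].
    by apply/eqP; rewrite eq_complex /=; apply/andP; split; apply/eqP; ring.
  have -> : (0 +i* (- (2 * pi * k.+1%:R))) ^+ 2 = (- (2 * pi * k.+1%:R) ^+ 2)%:C :> R[i].
    by apply/eqP; rewrite eq_complex /=; apply/andP; split; apply/eqP; ring.
  rewrite -fmorphV -rmorphD; congr (_%:C).
  move: (pi : R) (gt_eqF p0) (k.+1%:R : R) k0 => p pn x k0.
  by field; rewrite k0 pn.
move: e; rewrite tE csumZ // => e.
have p2 : (- (2 * pi ^+ 2)^-1 : R) != 0 by rewrite oppr_eq0 invr_eq0 mulf_neq0 ?expf_neq0 // gt_eqF.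
have p2C : (- (2 * pi ^+ 2)^-1 : R)%:C != 0 by rewrite fmorph_eq0.
apply: (mulfI p2C); rewrite e -rmorphM.
have -> : - (1 / 12) = (- (1 / 12))%:C :> R[i] by rewrite rmorphN fmorph_div rmorph1 rmorph_nat.
congr (_%:C); move: (pi : R) (gt_eqF p0) => p pn.
by field; rewrite pn.
Unshelve. all: by end_near. Qed.

(* The real part of [1 / (a + i j) ^ 2]. *)
Definition Kf (a j : R) : R := (a ^+ 2 - j ^+ 2) / (a ^+ 2 + j ^+ 2) ^+ 2.

Lemma Kf_summable (x : R) : 0 < x -> csummable (fun j => (Kf x j.+1%:R)%:C : R[i]).
Proof.
move=> x0; apply: (csummable_major _ cvg_inv_sqr) => n; rewrite nm_real /Kf.
have n0 : 0 < n.+1%:R :> R by rewrite ltr0n.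
move: (n.+1%:R : R) n0 => j j0.
have x2 : 0 < x ^+ 2 by rewrite exprn_gt0.
have j2 : 0 < j ^+ 2 by rewrite exprn_gt0.
move: (x ^+ 2) (j ^+ 2) x2 j2 => a b a0 b0.
have ab : 0 < (a + b) ^+ 2 by rewrite exprn_gt0 // addr_gt0.
rewrite normrM normfV (gtr0_norm ab) ler_pdivrMr // mulrC ler_pdivlMr //.
rewrite -[X in _ * X](gtr0_norm b0) -normrM ler_norml; apply/andP; split; nra.
Qed.

(** The expansion of pi^2 / sinh^2 (pi x) as the sum of 1 / (x + i j)^2 over all integers j;
    opposite j combine to twice the real part [Kf]. *)
Lemma csq_partial_fraction (x : R) : 0 < x ->
  (4 * pi ^+ 2)%:C * csq ((- (2 * pi * x)) +i* 0) =
  ((x ^+ 2)^-1)%:C + 2 * csum (fun j => (Kf x j.+1%:R)%:C).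
Proof.
move=> x0; have p0 := pi_gt0 R.
set s := - (2 * pi * x); have s0 : s < 0 by rewrite oppr_lt0 !mulr_gt0.
have h := node_sum_limit (ltW s0).
have w0 : s +i* 0 != 0 by rewrite eq_complex /= lt_eqF.
have h2 : tends \oo (fun n => node_sum s n / 4 ^+ n) (csq (s +i* 0) - ((s +i* 0) ^+ 2)^-1).
  apply: (tends_near _ (tendsB (tends_cst _) (csq_limit w0))).
  near=> n; rewrite node_sum_neg // mul0r.
  by field; rewrite expf_neq0 // pnatr_eq0.
have e : csum (pf_term s) = csq (s +i* 0) - ((s +i* 0) ^+ 2)^-1 := tends_unique _ h h2.
have sm := Kf_summable x0.
have tE : pf_term s = (fun k => ((2 * pi ^+ 2)^-1)%:C * (Kf x k.+1%:R)%:C).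
  apply/funext => k; have k0 : 0 < k.+1%:R :> R by rewrite ltr0n.
  rewrite /pf_term -rmorphM /Kf /s; move: (k.+1%:R : R) k0 => j j0.
  have d0 : x ^+ 2 + j ^+ 2 != 0 by rewrite gt_eqF // addr_gt0 ?exprn_gt0.
  have e1 (t : R) : t != 0 -> (((- (2 * pi * x)) +i* t) ^+ 2)^-1 =
    (((2 * pi * x) ^+ 2 - t ^+ 2) / ((2 * pi * x) ^+ 2 + t ^+ 2) ^+ 2) +i*
    ((2 * (2 * pi * x) * t) / ((2 * pi * x) ^+ 2 + t ^+ 2) ^+ 2).
    move=> t0; have q0 : 0 < (2 * pi * x) ^+ 2 by rewrite exprn_gt0 // !mulr_gt0.
    have c0 : (2 * pi * x) ^+ 2 + t ^+ 2 != 0 by rewrite gt_eqF // ltr_wpDr // sqr_ge0.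
    have wn : ((- (2 * pi * x)) +i* t) ^+ 2 != 0.
      by rewrite expf_neq0 // eq_complex /= negb_and t0 orbT.
    apply: (mulfI wn); rewrite mulfV //; move: (2 * pi * x) c0 => u c0.
    by apply/esym/eqP; rewrite eq_complex /=; apply/andP; split; apply/eqP; field.
  have t0 : 2 * pi * j != 0 by rewrite gt_eqF // !mulr_gt0.
  rewrite !e1 ?oppr_eq0 //.
  have d1 : (2 * pi * x) ^+ 2 + (2 * pi * j) ^+ 2 != 0.
    by rewrite !exprMn -mulrDr mulf_neq0 // mulf_neq0 // expf_neq0 ?pnatr_eq0 // gt_eqF.
  have pn := gt_eqF p0; move: (pi : R) pn {p0 t0 e1 w0 h h2 e s0 s} d1 => p pn d1.
  by apply/eqP; rewrite eq_complex /= sqrrN; apply/andP; split; apply/eqP; field; rewrite ?d0 ?d1 ?pn.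
have -> : csq (s +i* 0) = csum (pf_term s) + ((s +i* 0) ^+ 2)^-1 by rewrite e subrK.
rewrite tE csumZ //.
have -> : (s +i* 0) ^+ 2 = (4 * pi ^+ 2 * x ^+ 2)%:C.
  by rewrite /s; apply/eqP; rewrite eq_complex /=; apply/andP; split; apply/eqP; ring.
rewrite mulrDr mulrA -rmorphM -fmorphV -rmorphM addrC; congr (_%:C + _ * _).
  by move: (pi : R) (gt_eqF p0) (gt_eqF x0) => p pn xn; field; rewrite pn xn.
rewrite -(rmorph_nat (real_complex R) 2); congr (_%:C).
by move: (pi : R) (gt_eqF p0) => p pn; field; rewrite pn.
Unshelve. all: by end_near. Qed.

End PartialFractions.

(** * Inversion of E_2 on the imaginary axis *)

Section EisensteinInversion.
Context {R : realType}.
Implicit Types (q w z : R[i]) (k n m j : nat).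

Section Fubini.
Variables (f : nat -> nat -> R[i]) (p s : nat -> R).
Hypotheses (fps : forall m n, nm (f m n) <= p m * s n).
Hypotheses (p0 : forall m, 0 <= p m) (s0 : forall m, 0 <= s m).
Hypotheses (pc : cvgn (series p)) (sc : cvgn (series s)).

Lemma fubini_row_summable m : csummable (f m).
Proof. by apply: (csummable_major (fps m)); exact: cvg_series_scale. Qed.

Lemma fubini_col_summable n : csummable (f ^~ n).
Proof.
apply: (@csummable_major R (f ^~ n) (fun m => s n * p m)); last exact: cvg_series_scale.
by move=> m; rewrite mulrC; exact: fps.
Qed.

Lemma series_lim_bound N : series s N <= limn (series s).
Proof.
apply: nondecreasing_cvgn_le => //.
by apply: nondecreasing_series => k _ _; exact: s0.
Qed.

Lemma fubini_partial_bound m N : nm (series (f m) N) <= p m * limn (series s).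
Proof.
apply: le_trans (nm_sum _ _ _) _; apply: (@le_trans _ _ (p m * series s N)).
  by rewrite /series /= mulr_sumr; apply: ler_sum.
by rewrite ler_wpM2l // series_lim_bound.
Qed.

Lemma fubini_total_cvg : cvgn (series (fun m => p m * limn (series s))).
Proof.
have := @cvg_series_scale R (limn (series s)) _ pc.
by under eq_fun do rewrite mulrC.
Qed.

Lemma fubini_summable : csummable (fun m => csum (f m)).
Proof.
apply: (csummable_major _ fubini_total_cvg) => m.
apply: (tends_nm_le _ (fubini_row_summable m)); near=> N; exact: fubini_partial_bound.
Unshelve. all: by end_near. Qed.

Lemma fubini_finite N : csummable (fun m => series (f m) N) /\
  csum (fun m => series (f m) N) = \sum_(0 <= n < N) csum (f ^~ n).
Proof.
elim: N => [|N [ih1 ih2]].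
  have h : tends \oo (series (fun m => series (f m) 0)) 0.
    apply: (@tends_near R _ \oo _ (fun=> 0)); last exact: tends_cst.
    by near=> n; rewrite /series /= big1 // => i _; rewrite big_geq.
  by rewrite big_geq // (csumE h); split => //; exact: csummable_tends h.
have e : (fun m => series (f m) N.+1) = (fun m => series (f m) N + f m N).
  by apply/funext => m; rewrite seriesSr.
rewrite e; have h := csummableD ih1 (fubini_col_summable N).
by rewrite (csumE h) ih2 big_nat_recr //=; split => //; exact: csummable_tends h.
Unshelve. all: by end_near. Qed.

Lemma fubini : tends \oo (series (fun n => csum (f ^~ n))) (csum (fun m => csum (f m))).
Proof.
apply: (@tends_near R _ \oo _ (fun N => csum (fun m => series (f m) N))).
  by near=> N; have [_ ->] := fubini_finite N.
apply: (tends_csum _ fubini_total_cvg).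
  by near=> N; move=> m; exact: fubini_partial_bound.
exact: fubini_row_summable.
Unshelve. all: by end_near. Qed.

End Fubini.

Lemma geometric_psum z : nm z < 1 -> (1 - z) * psum (fun=> 1) z = 1.
Proof.
move=> z1; have pb : polybounded (fun=> 1 : R[i]).
  by exists 0%N; exists 1 => // n; rewrite nm1 expr0 mulr1.
rewrite one_sub_psum // /psum (@csum_finite _ _ 1); last first.
  by move=> [//|n] _; rewrite /pshift mulN1r subrr mul0r.
by rewrite big_nat1 /pshift mulr0 addr0 mul1r expr0.
Qed.

Lemma geometric_deriv_psum z : nm z < 1 -> psum (fun n => n.+1%:R) z = ((1 - z) ^+ 2)^-1.
Proof.
move=> z1; have pb : polybounded (fun n => n.+1%:R : R[i]).
  by exists 1%N; exists 1 => // n; rewrite nm_nat mul1r expr1.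
have z0 : 1 - z != 0.
  by rewrite -nm_gt0; apply: lt_le_trans (nm_sub_ge _ _); rewrite nm1 subr_gt0.
have e : (1 - z) * psum (fun n => n.+1%:R) z = psum (fun=> 1) z.
  rewrite one_sub_psum //; congr (psum _ z); apply/funext => -[|n]; rewrite /pshift.
    by rewrite mulr0 addr0.
  by rewrite mulN1r -natr1 addrAC subrr add0r.
have := geometric_psum z1; rewrite -e mulrA -expr2 => h.
by apply: (mulfI (expf_neq0 2 z0)); rewrite h mulfV // expf_neq0.
Qed.

(** Expand each Lambert term as a geometric series and sum the double series n q^(m n) in the other
    order. *)
Lemma phi1_sum q : nm q < 1 ->
  tends \oo (series (fun m => q ^+ m.+1 / (1 - q ^+ m.+1) ^+ 2)) (phi 1 q).
Proof.
move=> q1; have q0 := nm_ge0 q.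
pose f n m : R[i] := n.+1%:R * q ^+ (m.+1 * n.+1).
have hf : forall n m, nm (f n m) <= (n.+1%:R ^+ 1 * nm q ^+ n) * (m.+1%:R ^+ 0 * nm q ^+ m).
  move=> n m; rewrite /f nmM nm_nat nmX expr1 expr0 mul1r -mulrA -exprD ler_wpM2l //.
  by rewrite ler_wiXn2l ?(ltW q1) //; nia.
have pc k : cvgn (series (fun n => n.+1%:R ^+ k * nm q ^+ n)).
  by apply: cvg_succ_polygeometric; rewrite q0.
have p0 k n : 0 <= n.+1%:R ^+ k * nm q ^+ n by rewrite mulr_ge0 ?exprn_ge0.
have := fubini hf (p0 1%N) (p0 0%N) (pc 1%N) (pc 0%N).
have qn n : nm (q ^+ n.+1) < 1 by apply: (le_lt_trans _ q1); exact: nm_expr_lt1.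
have -> : (fun m => csum (f ^~ m)) = (fun m => q ^+ m.+1 / (1 - q ^+ m.+1) ^+ 2).
  apply/funext => m; rewrite -geometric_deriv_psum // -csumZ; last first.
    by apply: psum_summable => //; exists 1%N; exists 1 => // n; rewrite nm_nat mul1r expr1.
  by congr csum; apply/funext => n; rewrite /f exprM exprS; ring.
have -> : csum (fun n => csum (f n)) = phi 1 q.
  rewrite phiE -[RHS]csum_succ; last exact: phi_summable.
    congr csum; apply/funext => n.
    have e : f n = (fun m => (n.+1%:R * q ^+ n.+1) * (1 * (q ^+ n.+1) ^+ m)).
      apply/funext => m; rewrite /f mulnC exprM exprS; ring.
    rewrite e csumZ; last first.
      by apply: psum_summable => //; exists 0%N; exists 1 => // k; rewrite nm1 expr0 mulr1.
    rewrite -/(psum (fun=> 1) _) expr1 -mulrA; congr (_ * _).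
    have h := oneBX_neq0 q1 (ltn0Sn n).
    by apply: (mulfI h); rewrite mulrCA geometric_psum // /lam mulr1 mulrC divfK.
  by rewrite lam0 mulr0.
exact.
Qed.

(* [b |-> gf a b] is a primitive of [Kf a]. The midpoint error [df] is summable in both variables,
   unlike [Kf], so Fubini applies to it, and the telescoping part carries the whole defect of the exchange. *)
Definition gf (a b : R) : R := b / (a ^+ 2 + b ^+ 2).
Definition df (a j : R) : R := Kf a j - (gf a (j + 1 / 2) - gf a (j - 1 / 2)).

Lemma df_bound (a j : R) : 0 < a -> 1 <= j -> `|df a j| <= (a ^+ 2)^-1 * (j ^+ 2)^-1.
Proof.
move=> a0 j1; have j0 : 0 < j by rewrite (lt_le_trans ltr01).
have a2 : 0 < a ^+ 2 by rewrite exprn_gt0.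
have j2 : 0 < j ^+ 2 by rewrite exprn_gt0.
(* D is the product of the denominators of [gf] at j + 1/2 and j - 1/2. Over the denominator s^2 D,
   the numerator of [df] is at most s^2 in absolute value. *)
pose s := a ^+ 2 + j ^+ 2; pose D := (s + 1 / 4) ^+ 2 - j ^+ 2.
have s0 : 1 <= s by rewrite /s; nra.
have d1 : a ^+ 2 + (j + 1 / 2) ^+ 2 != 0 by rewrite gt_eqF // ltr_wpDr // sqr_ge0.
have d2 : a ^+ 2 + (j - 1 / 2) ^+ 2 != 0 by rewrite gt_eqF // ltr_wpDr // sqr_ge0.
have sj : j ^+ 2 <= s by rewrite /s lerDr ltW.
have D0 : a ^+ 2 * j ^+ 2 <= D.
  have -> : D = (a ^+ 2 + (j - 1 / 2) ^+ 2) * (a ^+ 2 + (j + 1 / 2) ^+ 2).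
    by rewrite /D /s; field.
  apply: ler_pM; rewrite ?(ltW a2) ?(ltW j2) //.
    by rewrite lerDl sqr_ge0.
  by nra.
have D1 : 0 < D by apply: lt_le_trans D0; rewrite mulr_gt0.
have dE : df a j = ((a ^+ 2 - j ^+ 2) ^+ 2 / 2 + (a ^+ 2 - j ^+ 2) / 16 - s ^+ 2 / 4) / (s ^+ 2 * D).
  have s1 : a ^+ 2 + j ^+ 2 != 0 by rewrite gt_eqF // addr_gt0.
  have D2 : D = (a ^+ 2 + (j - 1 / 2) ^+ 2) * (a ^+ 2 + (j + 1 / 2) ^+ 2) by rewrite /D /s; field.
  rewrite /df /Kf /gf D2 /s; field.
  by rewrite s1 !gt_eqF // ltr_wpDr ?sqr_ge0 ?mulr_gt0.
have s00 : 0 < s by rewrite (lt_le_trans ltr01).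
have sq : 0 < s ^+ 2 by rewrite exprn_gt0.
rewrite dE normrM normfV [`|s ^+ 2 * D|]gtr0_norm ?mulr_gt0 //.
rewrite -[leRHS]invfM.
apply: (@le_trans _ _ (s ^+ 2 / (s ^+ 2 * D))).
  apply: ler_wpM2r; first by rewrite invr_ge0 mulr_ge0 // ltW.
  have h1 : a ^+ 2 - j ^+ 2 <= s by rewrite /s; lra.
  have h2 : - s <= a ^+ 2 - j ^+ 2 by rewrite /s; lra.
  move: (a ^+ 2 - j ^+ 2) h1 h2 => d h1 h2.
  have h3 : d ^+ 2 <= s ^+ 2 by nra.
  have h4 : s <= s ^+ 2 by nra.
  have h5 := sqr_ge0 d.
  rewrite ler_norml; apply/andP; split; lra.
have -> : s ^+ 2 / (s ^+ 2 * D) = D^-1.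
  by move: (s ^+ 2) sq D D1 {D0 dE} => u u0 v v0; field; rewrite !gt_eqF.
by rewrite lef_pV2 ?posrE ?mulr_gt0.
Qed.

Lemma gf_sum (a : R) : 0 < a ->
  tends \oo (series (fun j => (gf a (j.+1%:R + 1 / 2) - gf a (j.+1%:R - 1 / 2))%:C))
    (- gf a (1 / 2))%:C.
Proof.
move=> a0.
have a2 : 0 < a ^+ 2 by rewrite exprn_gt0.
have g0 : (fun n => gf a (n%:R + 1 / 2)) @ \oo --> (0 : R).
  apply/cvgrPdist_lt => e e0; have N0 := nbhs_infty_gtr (e^-1).
  near=> n; have nb : e^-1 < n%:R :> R by near: n; exact: N0.
  have en : 1 < e * n%:R by rewrite mulrC -ltr_pdivrMr // mul1r.
  have n0 : 0 <= n%:R :> R by [].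
  have d0 : 0 < a ^+ 2 + (n%:R + 1 / 2) ^+ 2 by rewrite ltr_wpDr // sqr_ge0.
  have b0 : 0 < n%:R + 1 / 2 :> R by lra.
  rewrite sub0r normrN /gf ger0_norm; last by rewrite divr_ge0 // ltW.
  rewrite ltr_pdivrMr //; set b := n%:R + 1 / 2 in b0 *.
  have h : b < e * n%:R * b by rewrite ltr_pMl.
  have nb' : n%:R <= b by rewrite /b; lra.
  apply: lt_le_trans h _; rewrite -mulrA ler_wpM2l ?(ltW e0) //.
  apply: (@le_trans _ _ (b ^+ 2)); first by rewrite expr2 ler_wpM2r // ltW.
  by rewrite lerDr ltW.
apply: (@tends_near R _ \oo _ (fun n => (gf a (n%:R + 1 / 2))%:C - (gf a (1 / 2))%:C)).
  near=> n; rewrite /series /= (eq_bigr (fun j => (gf a (j.+1%:R + 1 / 2))%:C - (gf a (j%:R + 1 / 2))%:C)).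
    by rewrite (telescope_sumr (fun j => (gf a (j%:R + 1 / 2))%:C)) // mulr0n add0r.
  move=> j _; rewrite -rmorphB; congr ((_ - gf a _)%:C).
  by rewrite -natr1; field.
have -> : (- gf a (1 / 2))%:C = 0 - (gf a (1 / 2))%:C :> R[i] by rewrite rmorphN sub0r.
have g0C : tends \oo (fun n => (gf a (n%:R + 1 / 2))%:C) (0 : R[i]).
  by rewrite -(rmorph0 (real_complex R)); apply/tends_real.
exact: tendsB g0C (tends_cst _).
Unshelve. all: by end_near. Qed.

Section ArctanSum.
Variable y : R.
Hypothesis y0 : 0 < y.

Lemma gf_bound (b : R) m : 0 < b -> `|gf (y * m.+1%:R) b| <= (b / y ^+ 2) * (m.+1%:R ^+ 2)^-1.
Proof.
move=> b0; have y2 : 0 < y ^+ 2 by rewrite exprn_gt0.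
have m2 : 0 < m.+1%:R ^+ 2 :> R by rewrite exprn_gt0 // ltr0n.
have b2 : 0 < b ^+ 2 by rewrite exprn_gt0.
rewrite /gf exprMn ger0_norm; last by rewrite divr_ge0 ?addr_ge0 ?mulr_ge0 ?ltW.
rewrite -mulrA -invfM ler_wpM2l ?(ltW b0) // lef_pV2 ?posrE ?addr_gt0 ?mulr_gt0 //.
by rewrite lerDl ltW.
Qed.

Lemma gf_summable (b : R) : 0 < b -> csummable (fun m => (gf (y * m.+1%:R) b)%:C : R[i]).
Proof.
move=> b0; apply: (@csummable_major R _ (fun m => (b / y ^+ 2) * (m.+1%:R ^+ 2)^-1)).
  by move=> m; rewrite nm_real; exact: gf_bound.
by apply: cvg_series_scale; exact: cvg_inv_sqr.
Qed.

Lemma atan_diff_bound (u v : R) : 0 <= u -> u <= v ->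
  (v - u) / (1 + v ^+ 2) <= atan v - atan u <= (v - u) / (1 + u ^+ 2).
Proof.
move=> u0 uv.
have [c] := @MVT_segment R atan (fun x => (1 + x ^+ 2)^-1) u v uv
  (fun x _ => is_derive1_atan x) (continuous_subspaceT (@continuous_atan R)).
rewrite in_itv /= => /andP[uc cv] ->; have c0 : 0 <= c by apply: le_trans uc.
have p x : 0 < 1 + x ^+ 2 :> R by rewrite ltr_wpDr // sqr_ge0.
rewrite [_^-1 * (v - u)]mulrC.
apply/andP; split; apply: ler_wpM2l; rewrite ?subr_ge0 // lef_pV2 ?posrE //.
  by rewrite lerD2l lerXn2r ?nnegrE // (le_trans c0).
by rewrite lerD2l lerXn2r ?nnegrE.
Qed.

Lemma atan_le_id (u : R) : 0 <= u -> atan u <= u.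
Proof.
move=> u0; have /andP[_] := atan_diff_bound (lexx 0) u0.
by rewrite atan0 !subr0 expr0n addr0 divr1.
Qed.

(** Comparison of sum and integral: x |-> [gf (y * x) b] is the derivative of atan (y x / b) / y and
    decreases for x >= 0. *)
Lemma gf_series_bounds (b : R) M : 0 < b ->
  y^-1 * (atan (y * M.+1%:R / b) - atan (y / b)) <=
    \sum_(0 <= m < M) gf (y * m.+1%:R) b <= y^-1 * atan (y * M%:R / b).
Proof.
move=> b0.
have gE x : gf (y * x) b = y^-1 * ((y / b) / (1 + (y * x / b) ^+ 2)).
  have d1 : (y * x) ^+ 2 + b ^+ 2 != 0 by rewrite gt_eqF // ltr_wpDl ?sqr_ge0 // exprn_gt0.
  have d2 : b ^+ 2 + (y * x) ^+ 2 != 0 by rewrite addrC.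
  by rewrite /gf; field; rewrite ?d1 ?d2 ?gt_eqF.
have stepE n : y * n.+1%:R / b - y * n%:R / b = y / b.
  by rewrite -natr1; field; rewrite gt_eqF.
have nn n : 0 <= y * n%:R / b.
  by rewrite divr_ge0 ?(ltW b0) // mulr_ge0 // ltW.
have mono n : y * n%:R / b <= y * n.+1%:R / b.
  by rewrite -subr_ge0 stepE divr_ge0 ?ltW.
have yV : 0 <= y^-1 by rewrite invr_ge0 ltW.
elim: M => [|M /andP[ih1 ih2]].
  by rewrite big_geq // mulr0 mul0r atan0 mulr1 subrr mulr0 lexx.
rewrite big_nat_recr //= gE; apply/andP; split.
  have /andP[_] := atan_diff_bound (nn M.+1) (mono M.+1); rewrite stepE => h.
  apply: le_trans (lerD ih1 (ler_wpM2l yV h)).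
  by rewrite le_eqVlt; apply/orP; left; apply/eqP; move: (atan _) (atan _) (atan _) => u v t; ring.
have /andP[h _] := atan_diff_bound (nn M) (mono M); rewrite stepE in h.
apply: le_trans (lerD ih2 (ler_wpM2l yV h)) _.
by rewrite le_eqVlt; apply/orP; left; apply/eqP; move: (atan _) (atan _) => u v; ring.
Qed.

Definition Gsum (b : R) : R[i] := csum (fun m => (gf (y * m.+1%:R) b)%:C).

(** A Riemann sum of arctan, with error at most 1 / b. Its nonzero limit is what separates the two
    orders of summation and makes E_2 only quasimodular. *)
Lemma Gsum_limit : tends \oo (fun J => Gsum (J%:R + 1 / 2)) (pi / (2 * y))%:C.
Proof.
apply: (@tends_squeeze R _ \oo _ _ _ (fun J => 2 * J.+1%:R^-1)); last first.
  by rewrite -(mulr0 2); apply: cvgM; [exact: cvg_cst|exact: cvg_harmonic].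
near=> J; set b := J%:R + 1 / 2.
have j0 : 0 <= J%:R :> R by [].
have b0 : 0 < b by rewrite /b; lra.
have bJ : b^-1 <= 2 * J.+1%:R^-1.
  have j1 : 0 < J%:R + 1 :> R by rewrite ltr_wpDl.
  rewrite -natr1 -[leLHS]mul1r ler_pdivrMr // mulrAC ler_pdivlMr // mul1r /b.
  by lra.
apply: le_trans bJ.
have yV : 0 < y^-1 by rewrite invr_gt0.
apply/ler_addgt0Pr => e e0.
apply: (@tends_nm_le R _ \oo _ (fun M => series (fun m => (gf (y * m.+1%:R) b)%:C) M - (pi / (2 * y))%:C)).
  by apply: tendsB; [exact: gf_summable|exact: tends_cst].
have ey : 0 < e * y by rewrite mulr_gt0.
have /cvgrPdist_lt/(_ _ ey)[A [_ hA]] := @cvgy_atan R.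
have N0 := nbhs_infty_gtr (A * b / y).
near=> M; have nb : A * b / y < M%:R by near: M; exact: N0.
rewrite /series /= -rmorph_sum -rmorphB nm_real /=.
have /andP[h1 h2] := gf_series_bounds M b0.
have hM : A < y * M.+1%:R / b.
  rewrite ltr_pdivlMr // mulrC [y * _]mulrC -ltr_pdivrMr // mulrC; apply: lt_trans nb _.
  by rewrite ltr_nat.
have := hA _ hM => /= h3.
have h4 : atan (y / b) <= y / b by apply: atan_le_id; rewrite divr_ge0 // ltW.
have h5 := atan_ltpi2 (y * M%:R / b).
have -> : pi / (2 * y) = y^-1 * (pi / 2) by rewrite invfM; ring.
have h6 : y^-1 * atan (y * M%:R / b) <= y^-1 * (pi / 2) by rewrite ler_wpM2l ?(ltW yV) // ltW.
have h7 : y^-1 * (pi / 2) - y^-1 * atan (y * M.+1%:R / b) <= e.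
  rewrite -mulrBr mulrC ler_pdivrMr //; apply/ltW; apply: le_lt_trans h3; exact: ler_norm.
have h8 : y^-1 * atan (y / b) <= b^-1.
  apply: le_trans (ler_wpM2l (ltW yV) h4) _.
  by rewrite mulrA mulVf ?gt_eqF // mul1r.
rewrite mulrBr in h1; rewrite ler_norml; apply/andP; split; last first.
  have : 0 < b^-1 by rewrite invr_gt0.
  lra.
lra.
Unshelve. all: by end_near. Qed.

End ArctanSum.

Definition kap (y : R) m : R[i] := csum (fun j => (Kf (y * m.+1%:R) j.+1%:R)%:C).
(** An iterated sum, over j first: the double series does not converge absolutely. *)
Definition Tsum (y : R) : R[i] := csum (kap y).

Section Inversion.
Variable y : R.
Hypothesis y0 : 0 < y.

Let dfm m j : R[i] := (df (y * m.+1%:R) j.+1%:R)%:C.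

Let ym m : 0 < y * m.+1%:R. Proof. by rewrite mulr_gt0 // ltr0n. Qed.

Let dfm_bound m j : nm (dfm m j) <= ((y ^+ 2)^-1 * (m.+1%:R ^+ 2)^-1) * (j.+1%:R ^+ 2)^-1.
Proof.
rewrite /dfm nm_real -invfM -exprMn; apply: df_bound; first exact: ym.
by rewrite ler1n.
Qed.

Let p_ge0 m : 0 <= (y ^+ 2)^-1 * (m.+1%:R ^+ 2)^-1 :> R.
Proof. by rewrite mulr_ge0 // invr_ge0 exprn_ge0 // ltW. Qed.
Let s_ge0 j : 0 <= (j.+1%:R ^+ 2)^-1 :> R.
Proof. by rewrite invr_ge0 exprn_ge0. Qed.
Let p_cvg : cvgn (series (fun m => (y ^+ 2)^-1 * (m.+1%:R ^+ 2)^-1 : R)).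
Proof. by apply: cvg_series_scale; exact: cvg_inv_sqr. Qed.

Lemma dfm_row m : csum (dfm m) = kap y m + (gf (y * m.+1%:R) (1 / 2))%:C.
Proof.
have h := gf_sum (ym m).
have -> : dfm m = (fun j => (Kf (y * m.+1%:R) j.+1%:R)%:C + -1 *
   (gf (y * m.+1%:R) (j.+1%:R + 1 / 2) - gf (y * m.+1%:R) (j.+1%:R - 1 / 2))%:C).
  by apply/funext => j; rewrite /dfm /df rmorphB mulN1r.
rewrite csumDZ ?(csumE h); first by rewrite rmorphN mulN1r opprK.
  exact: Kf_summable.
exact: csummable_tends h.
Qed.

Lemma kap_summable : csummable (kap y).
Proof.
have -> : kap y = (fun m => csum (dfm m) + -1 * (gf (y * m.+1%:R) (1 / 2))%:C).
  by apply/funext => m; rewrite dfm_row mulN1r addrK.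
apply: csummable_addZ; last by apply: gf_summable => //; lra.
exact: fubini_summable dfm_bound p_ge0 s_ge0 p_cvg cvg_inv_sqr.
Qed.

(** Real part of 1 / (y m + i j)^2 = - y^(-2) / (j / y - i m)^2: exchanging rows and columns
    replaces y by 1 / y. *)
Lemma Kf_swap (m j : R) : 0 < m -> 0 < j -> Kf (y * m) j = - (y ^+ 2)^-1 * Kf (y^-1 * j) m.
Proof.
move=> m0 j0; rewrite /Kf.
have d1 : (y * m) ^+ 2 + j ^+ 2 != 0 by rewrite gt_eqF // addr_gt0 ?exprn_gt0 ?mulr_gt0.
have d2 : j ^+ 2 + (m * y) ^+ 2 != 0 by rewrite gt_eqF // addr_gt0 ?exprn_gt0 ?mulr_gt0.
have d3 : j ^+ 2 + (y * m) ^+ 2 != 0 by rewrite gt_eqF // addr_gt0 ?exprn_gt0 ?mulr_gt0.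
have d4 : (m * y) ^+ 2 + j ^+ 2 != 0 by rewrite gt_eqF // addr_gt0 ?exprn_gt0 ?mulr_gt0.
by field; rewrite ?d1 ?d2 ?d3 ?d4 ?gt_eqF.
Qed.

Lemma dfm_col j : csum (dfm ^~ j) =
  - ((y ^+ 2)^-1)%:C * kap y^-1 j - (Gsum y (j.+1%:R + 1 / 2) - Gsum y (j%:R + 1 / 2)).
Proof.
have j0 : 0 <= j%:R :> R by [].
have b1 : 0 < j.+1%:R + 1 / 2 :> R by rewrite -natr1; lra.
have b2 : 0 < j%:R + 1 / 2 :> R by lra.
have jy : 0 < y^-1 * j.+1%:R by rewrite mulr_gt0 ?invr_gt0 // ltr0n.
have -> : dfm ^~ j = (fun m => (- ((y ^+ 2)^-1)%:C * (Kf (y^-1 * j.+1%:R) m.+1%:R)%:C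
    + -1 * (gf (y * m.+1%:R) (j.+1%:R + 1 / 2))%:C) + 1 * (gf (y * m.+1%:R) (j%:R + 1 / 2))%:C).
  apply/funext => m; rewrite /dfm /df Kf_swap ?ltr0n //.
  have -> : j.+1%:R - 1 / 2 = j%:R + 1 / 2 :> R by rewrite -natr1; field.
  move: (gf _ _) (gf _ _) (Kf _ _) => a b c.
  by rewrite !rmorphB rmorphM rmorphN /= mulN1r mul1r opprD opprK addrA.
have k1 := csummable_tends (csummableZ (- ((y ^+ 2)^-1)%:C) (Kf_summable jy)).
rewrite csumDZ; [|apply: csummable_addZ => //; exact: gf_summable|exact: gf_summable].
rewrite csumDZ //; last exact: gf_summable.
rewrite csumZ; last exact: Kf_summable.
rewrite -/(kap y^-1 j) -/(Gsum y _) -/(Gsum y _).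
by move: (Gsum _ _) (Gsum _ _) (_ * _) => a b c; ring.
Qed.

Lemma csum_dfm_rows : csum (fun m => csum (dfm m)) = Tsum y + Gsum y (1 / 2).
Proof.
have -> : (fun m => csum (dfm m)) = (fun m => kap y m + (gf (y * m.+1%:R) (1 / 2))%:C).
  by apply/funext => m; exact: dfm_row.
by rewrite csumD //; [exact: kap_summable|apply: gf_summable => //; lra].
Qed.

Lemma fubini_dfm : tends \oo (series (fun j => csum (dfm ^~ j))) (Tsum y + Gsum y (1 / 2)).
Proof.
rewrite -csum_dfm_rows.
exact: fubini dfm_bound p_ge0 s_ge0 p_cvg cvg_inv_sqr.
Qed.

End Inversion.

(** Sum [df] by rows and by columns. The boundary term [Gsum y (1 / 2)] occurs in both and cancels,
    leaving the limit of [Gsum]. *)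
Lemma Tsum_inversion (y : R) : 0 < y ->
  Tsum y + ((y ^+ 2)^-1)%:C * Tsum y^-1 = - (pi / (2 * y))%:C.
Proof.
move=> y0; have yV : 0 < y^-1 by rewrite invr_gt0.
have h1 := fubini_dfm y0.
have h2 : tends \oo (series (fun j => - ((y ^+ 2)^-1)%:C * kap y^-1 j -
    (Gsum y (j.+1%:R + 1 / 2) - Gsum y (j%:R + 1 / 2))))
   (- ((y ^+ 2)^-1)%:C * Tsum y^-1 - ((pi / (2 * y))%:C - Gsum y (1 / 2))).
  have a1 := csummableZ (- ((y ^+ 2)^-1)%:C) (kap_summable yV).
  have a2 : tends \oo (fun N => Gsum y (N%:R + 1 / 2) - Gsum y (1 / 2))
      ((pi / (2 * y))%:C - Gsum y (1 / 2)).
    exact: tendsB (Gsum_limit y0) (tends_cst (Gsum y (1 / 2))).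
  apply: tends_near (tendsB a1 a2); near=> N.
  rewrite /series /= sumrB (telescope_sumr (fun j => Gsum y (j%:R + 1 / 2))) //.
  by rewrite mulr0n add0r.
have e12 : - ((y ^+ 2)^-1)%:C * Tsum y^-1 - ((pi / (2 * y))%:C - Gsum y (1 / 2)) =
   - ((y ^+ 2)^-1)%:C * Tsum y^-1 - (pi / (2 * y))%:C + Gsum y (1 / 2) by ring.
rewrite e12 in h2.
have e : Tsum y + Gsum y (1 / 2) =
   - ((y ^+ 2)^-1)%:C * Tsum y^-1 - (pi / (2 * y))%:C + Gsum y (1 / 2).
  apply: (tends_unique _ h1 _); apply: tends_near h2; near=> N.
  by rewrite /series /=; apply: eq_bigr => j _; rewrite dfm_col.
move/addIr : e => ->; move: (Tsum _) (_%:C) (_%:C) => a b c; ring.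
Unshelve. all: by end_near. Qed.

Definition qy (y : R) : R[i] := (expR (- (2 * pi * y)))%:C.

Lemma nm_qy (y : R) : 0 < y -> nm (qy y) < 1.
Proof.
move=> y0; rewrite /qy nm_real ger0_norm ?expR_ge0 // expR_lt1 oppr_lt0.
by rewrite !mulr_gt0 // pi_gt0.
Qed.

Lemma phi1_qy (y : R) : 0 < y ->
  (4 * pi ^+ 2)%:C * phi 1 (qy y) = ((y ^+ 2)^-1 * (pi ^+ 2 / 6))%:C + 2 * Tsum y.
Proof.
move=> y0; have h := phi1_sum (nm_qy y0).
have sm := csummable_tends h.
have s2 : csummable (fun k => ((k.+1%:R ^+ 2)^-1)%:C : R[i]).
  apply: (csummable_major _ cvg_inv_sqr) => n.
  by rewrite nm_real ger0_norm ?invr_ge0 ?exprn_ge0.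
have eC : ((y ^+ 2)^-1 * (pi ^+ 2 / 6))%:C = ((y ^+ 2)^-1)%:C * (pi ^+ 2 / 6)%:C :> R[i].
  by rewrite rmorphM.
rewrite -(csumE h) -csumZ // eC -sum_inv_sqr -csumZ //.
rewrite /Tsum -csumDZ; [|exact: csummable_tends (csummableZ _ s2)|exact: kap_summable].
congr csum; apply/funext => m.
have ym : 0 < y * m.+1%:R by rewrite mulr_gt0 // ltr0n.
have -> : qy y ^+ m.+1 / (1 - qy y ^+ m.+1) ^+ 2 = csq ((- (2 * pi * (y * m.+1%:R))) +i* 0).
  have -> : qy y ^+ m.+1 = cexp ((- (2 * pi * (y * m.+1%:R))) +i* 0).
    rewrite /qy -cexp_real -cexpMn -(rmorph_nat (real_complex R)) -rmorphM /=.
    rewrite -[RHS]/(cexp (- (2 * pi * (y * m.+1%:R)))%:C); congr (cexp _%:C); ring.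
  by [].
rewrite csq_partial_fraction //; congr (_ + _).
by rewrite exprMn invfM rmorphM.
Qed.

Lemma e2_inversion (y : R) : 0 < y ->
  e2 (qy y) + ((y ^+ 2)^-1)%:C * e2 (qy y^-1) = (6 / (pi * y))%:C.
Proof.
move=> y0; have yV : 0 < y^-1 by rewrite invr_gt0.
have h1 := phi1_qy y0; have h2 := phi1_qy yV; have h3 := Tsum_inversion y0.
have p0 := pi_gt0 R.
have pC : (4 * pi ^+ 2)%:C != 0 :> R[i] by rewrite fmorph_eq0 gt_eqF // mulr_gt0 // exprn_gt0.
apply: (mulfI pC); rewrite /e2.
have -> : (4 * pi ^+ 2)%:C * (1 - 24 * phi 1 (qy y) + ((y ^+ 2)^-1)%:C * (1 - 24 * phi 1 (qy y^-1)))
  = (4 * pi ^+ 2)%:C * (1 + ((y ^+ 2)^-1)%:C) - 24 * ((4 * pi ^+ 2)%:C * phi 1 (qy y)) -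
    24 * ((y ^+ 2)^-1)%:C * ((4 * pi ^+ 2)%:C * phi 1 (qy y^-1)) by ring.
rewrite h1 h2.
have -> : (4 * pi ^+ 2)%:C * (1 + ((y ^+ 2)^-1)%:C)
  - 24 * (((y ^+ 2)^-1 * (pi ^+ 2 / 6))%:C + 2 * Tsum y)
  - 24 * ((y ^+ 2)^-1)%:C * (((y^-1 ^+ 2)^-1 * (pi ^+ 2 / 6))%:C + 2 * Tsum y^-1) =
  ((4 * pi ^+ 2)%:C * (1 + ((y ^+ 2)^-1)%:C)
  - 24 * ((y ^+ 2)^-1 * (pi ^+ 2 / 6))%:C
  - 24 * ((y ^+ 2)^-1)%:C * (((y^-1 ^+ 2)^-1 * (pi ^+ 2 / 6))%:C))
  - 48 * (Tsum y + ((y ^+ 2)^-1)%:C * Tsum y^-1) by ring.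
rewrite h3 -!(rmorph_nat (real_complex R)) -(rmorph1 (real_complex R)) -!(rmorphM, rmorphD, rmorphB, rmorphN).
congr (_%:C); move: (pi : R) (gt_eqF p0) (gt_eqF y0) => p pn yn.
by field; rewrite pn yn.
Unshelve. all: by end_near. Qed.

End EisensteinInversion.

(** * Values of the Eisenstein series at tau = i *)

Section LemniscaticPoint.
Context {R : realType}.
Implicit Types (q w z D : R[i]).

(** [qy] extended to a complex argument, so that inversion formulas known for real y > 0 can be
    differentiated through [cdif_real_unique]. *)
Definition qexp w : R[i] := cexp (- (2 * pi)%:C * w).

Lemma qexp_real (y : R) : qexp y%:C = qy y.
Proof. by rewrite /qexp -rmorphN -rmorphM cexp_real /qy mulNr. Qed.

Lemma cdif_qexp w : cdif qexp w (- (2 * pi)%:C * qexp w).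
Proof.
have h := cdifZ (- (2 * pi)%:C) (cdif_id w).
by apply: cdif_eq (cdif_comp h (cdif_cexp _)) _; rewrite /qexp; ring.
Qed.

Lemma cdif_qdif_qexp f w D : qdif f (qexp w) D ->
  cdif (fun v => f (qexp v)) w (- (2 * pi)%:C * D).
Proof.
move=> [d fd <-]; apply: cdif_eq (cdif_comp (cdif_qexp w) fd) _.
by move: (qexp w) (_%:C) => a b; ring.
Qed.

Lemma near_real_pos (y : R) : 0 < y -> \forall w \near cnbhs y%:C,
  complex.Im w = 0 -> exists2 x : R, 0 < x & w = x%:C.
Proof.
move=> y0; exists y => // w hw wi; exists (complex.Re w); last first.
  by move: wi; case: (w) => a b /= ->.
have := le_lt_trans (nm_Re _) hw; rewrite cRe_sub /= => h.
by move: (ler_norm (complex.Re w - y)) (ler_norm (- (complex.Re w - y))); rewrite normrN; lra.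
Qed.

Lemma pi_neq0C : (pi : R)%:C != 0.
Proof. by rewrite fmorph_eq0 gt_eqF // pi_gt0. Qed.

Lemma pi2C : (2 * pi)%:C = 2 * pi%:C :> R[i].
Proof. by rewrite rmorphM rmorph_nat. Qed.

Lemma cdif_inversion f (y : R) D n : 0 < y -> qdif f (qy y^-1) D ->
  cdif (fun w => (w ^+ n)^-1 * f (qexp w^-1)) y%:C
    (- n%:R * (y%:C ^+ n.+1)^-1 * f (qy y^-1) + 2 * pi%:C * (y%:C ^+ n.+2)^-1 * D).
Proof.
move=> y0 fd.
have yC : y%:C != 0 :> R[i] by rewrite fmorph_eq0 gt_eqF.
have yn : y%:C ^+ n != 0 :> R[i] by rewrite expf_neq0.
have e1 : qexp (y%:C)^-1 = qy y^-1 by rewrite -qexp_real fmorphV.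
have h1 := @cdifV R id y%:C _ yC (cdif_id y%:C).
have fd' : qdif f (qexp ((fun w : R[i] => w^-1) y%:C)) D by rewrite e1.
have h2 := cdif_comp h1 (cdif_qdif_qexp fd').
have h3 := @cdifV R (fun w => w ^+ n) y%:C _ yn (cdifX n (cdif_id y%:C)).
apply: cdif_eq (cdifM h3 h2) _; rewrite e1 pi2C.
case: n yn {h3} => [|n] yn.
  by move: (pi%:C) (y%:C) yC (f _) => p x x0 g; rewrite /= !expr0 !mulr0n; field.
by move: (pi%:C) (y%:C) yC (f _) (n.+1%:R) => p x x0 g k; rewrite !exprS; field; rewrite x0 expf_neq0.
Qed.

(** Differentiate [e2_inversion]: the derivative of [e2] brings in [e4], and the terms in [e2]
    cancel by [e2_inversion] itself. *)
Lemma e4_inversion (y : R) : 0 < y -> e4 (qy y) = ((y ^+ 4)^-1)%:C * e4 (qy y^-1).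
Proof.
move=> y0; have yV : 0 < y^-1 by rewrite invr_gt0.
have q1 := nm_qy y0; have q2 := nm_qy yV.
have yC : y%:C != 0 :> R[i] by rewrite fmorph_eq0 gt_eqF.
have pC := pi_neq0C.
have d1 : cdif (fun w => e2 (qexp w)) y%:C (- (2 * pi)%:C * ((e2 (qy y) ^+ 2 - e4 (qy y)) / 12)).
  by apply: cdif_qdif_qexp; rewrite qexp_real; exact: qdif_e2.
have d2 := cdifB (cdifZ (6 / pi%:C) (@cdifV R id y%:C _ yC (cdif_id y%:C))) (cdif_inversion 2 y0 (qdif_e2 q2)).
have nr : \forall w \near cnbhs y%:C, complex.Im w = 0 ->
    e2 (qexp w) = 6 / pi%:C * w^-1 - (w ^+ 2)^-1 * e2 (qexp w^-1).
  apply: filterS (near_real_pos y0) => w hw wi; have [x x0 ->] := hw wi.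
  have xV : (x%:C)^-1 = (x^-1)%:C :> R[i] by rewrite fmorphV.
  rewrite xV !qexp_real; have := e2_inversion x0 => h.
  have -> : 6 / pi%:C * (x^-1)%:C = (6 / (pi * x))%:C :> R[i].
    by rewrite fmorph_div rmorphM rmorph_nat invfM mulrA fmorphV.
  by rewrite -h fmorphV rmorphXn addrK.
have := cdif_real_unique nr d1 d2.
have h := e2_inversion y0.
have {h} h : e2 (qy y) = 6 / (pi%:C * y%:C) - (y%:C ^+ 2)^-1 * e2 (qy y^-1).
  have -> : 6 / (pi%:C * y%:C) = (6 / (pi * y))%:C :> R[i] by rewrite fmorph_div rmorphM rmorph_nat.
  by rewrite -h fmorphV rmorphXn addrK.
rewrite h pi2C fmorphV rmorphXn /=.
move: (e2 (qy y^-1)) (e4 (qy y^-1)) (e4 (qy y)) (pi%:C) (y%:C) pC yC => a b c p x p0 x0 e.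
have {e} e : p * (c - (x ^+ 4)^-1 * b) = 0.
  move/eqP: e; rewrite -subr_eq0 => /eqP e; rewrite -[RHS](mulr0 6) -e.
  by field; rewrite ?p0 ?x0.
by move/eqP: e; rewrite mulf_eq0 (negPf p0) subr_eq0 => /eqP.
Qed.

Lemma e2_qy1 : e2 (qy 1) = 3 / pi%:C :> R[i].
Proof.
have := e2_inversion (ltr01 : 0 < 1 :> R).
rewrite expr1n invr1 mulr1 rmorph1 mul1r.
have -> : (6 / pi)%:C = 6 / pi%:C :> R[i] by rewrite fmorph_div rmorph_nat.
have pC := pi_neq0C; move: (e2 _) (pi%:C) pC => a p p0 h.
have -> : a = (a + a) / 2 by field.
by rewrite h; field.
Qed.

(** Differentiate [e4_inversion] at its fixed point y = 1 and insert the value of [e2] there. *)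
Lemma e6_qy1 : e6 (qy 1) = 0 :> R[i].
Proof.
have q1 := nm_qy (ltr01 : 0 < 1 :> R).
have q2 : nm (qy (1 : R)^-1) < 1 by rewrite invr1.
have pC := pi_neq0C.
have d1 : cdif (fun w => e4 (qexp w)) 1%:C (- (2 * pi)%:C * ((e2 (qy 1) * e4 (qy 1) - e6 (qy 1)) / 3)).
  by apply: cdif_qdif_qexp; rewrite qexp_real; exact: qdif_e4.
have d2 := cdif_inversion 4 ltr01 (qdif_e4 q2).
have nr : \forall w \near cnbhs (1 : R)%:C, complex.Im w = 0 ->
    e4 (qexp w) = (w ^+ 4)^-1 * e4 (qexp w^-1).
  apply: filterS (near_real_pos ltr01) => w hw wi; have [x x0 ->] := hw wi.
  by rewrite -fmorphV !qexp_real e4_inversion // fmorphV rmorphXn.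
have := cdif_real_unique nr d1 d2.
rewrite invr1 rmorph1 !expr1n invr1 e2_qy1 pi2C.
move: (e4 (qy 1)) (e6 (qy 1)) (pi%:C) pC => a b p p0 /eqP; rewrite -subr_eq0 => /eqP e.
have {e} e : p * b = 0 by rewrite -[RHS](mulr0 (3 / 4)) -e; field.
by move/eqP: e; rewrite mulf_eq0 (negPf p0) => /eqP.
Qed.

End LemniscaticPoint.

(** * First integrals on the domain of the hypergeometric series *)

Section HypergeometricDomain.
Context {R : realType}.
Implicit Types (q w z : R[i]).

Definition hdom q := [/\ q != 0, nm q < 1 & 1 < nm (1 - tmod q)].

(* First integrals, each usable only once the previous one is known: [rho1 = 0], [rho2 = 1] and
   [rho3 = 1 / 64] amount to [p2 T = F y2], [F ^ 2 = p2] and [q = z / 64 * exp (H / F)]. *)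
Definition hV q : R[i] := p2 q * hT (zmod q) - hF (zmod q) * y2 q.
Definition rho1 q : R[i] := hV q ^+ 2 / p2 q.
Definition rho2 q : R[i] := hF (zmod q) ^+ 2 / p2 q.
Definition hK z : R[i] := hH z / hF z.
Definition rho3 q : R[i] := q * cexp (- hK (zmod q)) / zmod q.

Lemma hdom_p2_neq0 q : hdom q -> p2 q != 0.
Proof.
move=> [q0 q1 tq]; apply: p2_neq0 => //; apply: contraTneq tq => ->.
by rewrite subrr nm0 ltNge ler01.
Qed.

Lemma hdom_zmod_neq0 q : hdom q -> zmod q != 0.
Proof.
move=> h; have p0 := hdom_p2_neq0 h; case: h => q0 q1 _.
by rewrite mulf_neq0 ?invr_eq0 ?expf_neq0 // mulf_neq0 ?pnatr_eq0 // mulf_neq0 ?etaB_neq0.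
Qed.

Lemma hdom_zmod_lt1 q : hdom q -> nm (zmod q) < 1.
Proof. by move=> [q0 q1 tq]; rewrite zmodE // nmV invf_lt1 // (lt_trans ltr01). Qed.

Lemma hdom_near q : hdom q -> \forall w \near cnbhs q, hdom w.
Proof.
move=> [q0 q1 tq].
have b0 : q * etaB q != 0 by rewrite mulf_neq0 ?etaB_neq0.
have ct : tends (cnbhs q) (fun w => 1 - tmod w) (1 - tmod q).
  apply: tendsB; first exact: tends_cst.
  exact: (qdif_cont (qdifZ (- (1 / 64)) (@qdif_div R etaA (fun w => w * etaB w) q _ _ b0
    (qdif_etaA q1) (qdif_etaB q1)))).
have d0 : 0 < nm (1 - tmod q) - 1 by rewrite subr_gt0.
have h0 : \forall w \near cnbhs q, nm (w - q) < nm q by apply: cnbhs_ball; rewrite nm_gt0.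
have h1 := cnbhs_disc q1; have h2 := ct _ d0.
near=> w; split; last first.
- have : nm ((1 - tmod w) - (1 - tmod q)) < nm (1 - tmod q) - 1 by near: w; exact: h2.
  by rewrite nmB; have := nm_sub_ge (1 - tmod q) ((1 - tmod q) - (1 - tmod w)); rewrite subKr; lra.
- by near: w; exact: h1.
- have : nm (w - q) < nm q by near: w; exact: h0.
  by apply: contraTneq => ->; rewrite sub0r nmN ltxx.
Unshelve. all: by end_near. Qed.

Lemma qdif_hF q : hdom q -> qdif (fun w => hF (zmod w)) q (p2 q * hT (zmod q)).
Proof.
move=> h; have p0 := hdom_p2_neq0 h; have z1 := hdom_zmod_lt1 h; case: h => q0 q1 _.
apply: qdif_eq (qdif_comp (qdif_zmod q1 p0) (cdif_hF z1)) _; rewrite hTE //.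
by move: (hF' (zmod q)) (p2 q) (zmod q) => a b c; ring.
Qed.

Lemma qdif_hT q : hdom q ->
  qdif (fun w => hT (zmod w)) q (3 / 16 * hF (zmod q) * (p2 q * (zmod q * (1 - zmod q)))).
Proof.
move=> h; have p0 := hdom_p2_neq0 h; have z1 := hdom_zmod_lt1 h; case: h => q0 q1 _.
exact: qdif_comp (qdif_zmod q1 p0) (cdif_hT z1).
Qed.

(** The factor [y2] is half the logarithmic derivative of [p2], whence the square in [rho1]. *)
Lemma qdif_hV q : hdom q -> qdif hV q (hV q * y2 q).
Proof.
move=> h; have p0 := hdom_p2_neq0 h; case: (h) => q0 q1 _.
have d1 := qdifM (qdif_p2_y2 q1 p0) (qdif_hT h).
have d2 := qdifM (qdif_hF h) (qdif_y2 q1 p0).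
apply: qdif_eq (qdifB d1 d2) _; rewrite /hV.
by move: (hF (zmod q)) (hT (zmod q)) (p2 q) (zmod q) (y2 q) => a b c d e; ring.
Qed.

Lemma cdif_rho1 q : hdom q -> cdif rho1 q 0.
Proof.
move=> h; have p0 := hdom_p2_neq0 h; case: (h) => q0 q1 _; apply: qdif0_cdif => //.
have d := @qdif_div R (fun w => hV w ^+ 2) p2 q _ _ p0 (qdifX 2 (qdif_hV h)) (qdif_p2_y2 q1 p0).
apply: (qdif_eq d); clear d; rewrite /=.
by move: (hV q) (y2 q) (p2 q) p0 => a b c c0; field.
Qed.

Lemma rho1_locally_cst q : hdom q -> \forall w \near cnbhs q, rho1 w = rho1 q.
Proof. by move=> h; apply: cdif0_locally_cst; apply: filterS (hdom_near h) => w /cdif_rho1. Qed.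

Lemma rho1_eq0 q : hdom q -> (rho1 q == 0) = (hV q == 0).
Proof.
by move=> /hdom_p2_neq0 p0; rewrite /rho1 mulf_eq0 invr_eq0 (negPf p0) orbF expf_eq0.
Qed.

Lemma rho1_eq0_near q : hdom q -> rho1 q = 0 ->
  \forall w \near cnbhs q, hdom w /\ rho1 w = 0.
Proof.
move=> h r0; have h1 := hdom_near h; have h2 := rho1_locally_cst h.
by near=> w; split; [near: w; exact: h1|rewrite -r0; near: w; exact: h2].
Unshelve. all: by end_near. Qed.

(** The q-derivative of F^2 / p2 is 2 F [hV] / p2, so it vanishes once [hV] does. *)
Lemma cdif_rho2 q : hdom q -> rho1 q = 0 -> cdif rho2 q 0.
Proof.
move=> h /eqP; rewrite rho1_eq0 // => /eqP v0.
have p0 := hdom_p2_neq0 h; case: (h) => q0 q1 _; apply: qdif0_cdif => //.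
have d := @qdif_div R (fun w => hF (zmod w) ^+ 2) p2 q _ _ p0 (qdifX 2 (qdif_hF h)) (qdif_p2_y2 q1 p0).
apply: (qdif_eq d); clear d; rewrite /=.
rewrite -[RHS](mul0r (2 * hF (zmod q) / p2 q)) -v0 /hV.
by move: (hF (zmod q)) (hT (zmod q)) (y2 q) (p2 q) p0 => a b c d d0; field.
Qed.

Lemma rho2_locally_cst q : hdom q -> rho1 q = 0 -> \forall w \near cnbhs q, rho2 w = rho2 q.
Proof.
move=> h r0; apply: cdif0_locally_cst; apply: filterS (rho1_eq0_near h r0) => w [].
exact: cdif_rho2.
Qed.

Lemma rho2_eq1 q : hdom q -> (rho2 q == 1) = (hF (zmod q) ^+ 2 == p2 q).
Proof. by move=> /hdom_p2_neq0 p0; rewrite /rho2 -(inj_eq (mulIf p0)) divfK // mul1r. Qed.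

Lemma hF_neq0 q : hdom q -> rho2 q = 1 -> hF (zmod q) != 0.
Proof.
move=> h /eqP; rewrite rho2_eq1 // => /eqP e; have := hdom_p2_neq0 h.
by rewrite -e expf_eq0.
Qed.

(* [F X - T H = 1] is the Wronskian relation behind this derivative. *)
Lemma qdif_hK q : hdom q -> rho2 q = 1 ->
  qdif (fun w => hK (zmod w)) q (1 - (1 - zmod q) * p2 q).
Proof.
move=> h r2; have p0 := hdom_p2_neq0 h; have z1 := hdom_zmod_lt1 h; have F0 := hF_neq0 h r2.
move/eqP: r2; rewrite rho2_eq1 // => /eqP F2; case: (h) => q0 q1 _.
have d := cdif_div F0 (cdif_hH z1) (cdif_hF z1).
apply: qdif_eq (qdif_comp (qdif_zmod q1 p0) d) _; clear d.
have W := hyper_wronskian z1; rewrite hTE // hXE // in W; rewrite -F2.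
apply: (etrans _ (congr1 (fun x => x - (1 - zmod q) * hF (zmod q) ^+ 2) W)).
by move: (hF (zmod q)) (hF' (zmod q)) (hH (zmod q)) (hH' (zmod q)) (zmod q) F0 => a b c d e a0; field.
Qed.

(** The logarithmic q-derivatives of q, exp (- H / F) and 1 / z are 1, (1 - z) p2 - 1 and - (1 - z)
    p2, which add up to 0. *)
Lemma cdif_rho3 q : hdom q -> rho2 q = 1 -> cdif rho3 q 0.
Proof.
move=> h r2; have p0 := hdom_p2_neq0 h; have z0 := hdom_zmod_neq0 h; case: (h) => q0 q1 _.
apply: qdif0_cdif => //.
have d1 := qdif_comp (qdifB (qdif_cst 0 q) (qdif_hK h r2)) (cdif_cexp _).
have d2 := @qdif_div R (fun w => w * cexp (0 - hK (zmod w))) zmod q _ _ z0 (qdifM (qdif_id q) d1) (qdif_zmod q1 p0).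
have -> : rho3 = (fun w => w * cexp (0 - hK (zmod w)) / zmod w).
  by apply/funext => w; rewrite sub0r.
apply: (qdif_eq d2); clear d1 d2; cbv beta.
have aux (E z p : R[i]) : z != 0 ->
    ((q * E + q * (E * (0 - (1 - (1 - z) * p)))) * z - q * E * (p * (z * (1 - z)))) / z ^+ 2 = 0.
  by move=> zn; field.
exact: aux.
Qed.

Lemma rho3_locally_cst q : hdom q -> rho1 q = 0 -> rho2 q = 1 ->
  \forall w \near cnbhs q, rho3 w = rho3 q.
Proof.
move=> h r1 r2; apply: cdif0_locally_cst.
have h1 := rho1_eq0_near h r1; have h2 := rho2_locally_cst h r1.
near=> w; have [hw _] : hdom w /\ rho1 w = 0 by near: w; exact: h1.
by apply: cdif_rho3 => //; rewrite -r2; near: w; exact: h2.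
Unshelve. all: by end_near. Qed.

End HypergeometricDomain.

(** * Limits of the first integrals at q = 0 *)

Section Cusp.
Context {R : realType}.
Implicit Types (q w z : R[i]).

Lemma p2_at0_neq0 : p2 (0 : R[i]) != 0. Proof. by rewrite p2_at0 oner_neq0. Qed.
Lemma zmod_at0 : zmod (0 : R[i]) = 0. Proof. by rewrite /zmod mul0r mulr0 mul0r. Qed.
Lemma y2_at0 : y2 (0 : R[i]) = 0.
Proof. by rewrite /y2 e2_at0 p2_at0 zmod_at0; ring. Qed.
Lemma hT_at0 : hT (0 : R[i]) = 0. Proof. by rewrite /hT psum_at0 rmorph0. Qed.

Lemma p2_cont0 : tends (cnbhs 0) p2 (1 : R[i]).
Proof. by rewrite -p2_at0; exact: qdif_cont (qdif_p2 nm0_lt1). Qed.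
Lemma zmod_cont0 : tends (cnbhs 0) zmod (0 : R[i]).
Proof. by rewrite -[X in tends _ _ X]zmod_at0; exact: qdif_cont (qdif_zmod nm0_lt1 p2_at0_neq0). Qed.
Lemma y2_cont0 : tends (cnbhs 0) y2 (0 : R[i]).
Proof. by rewrite -[X in tends _ _ X]y2_at0; exact: qdif_cont (qdif_y2 nm0_lt1 p2_at0_neq0). Qed.

Lemma zmod_comp_cont0 (h : R[i] -> R[i]) d : cdif h 0 d ->
  tends (cnbhs 0) (fun w => h (zmod w)) (h 0).
Proof. by move=> /cdif_cont hh; exact: tends_comp zmod_cont0 hh. Qed.

Lemma rho1_cont0 : tends (cnbhs 0) rho1 (0 : R[i]).
Proof.
have h := tendsB (tendsM p2_cont0 (zmod_comp_cont0 (cdif_hT nm0_lt1)))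
  (tendsM (zmod_comp_cont0 (cdif_hF nm0_lt1)) y2_cont0).
have e : (1 * hT 0 - hF 0 * 0) ^+ 2 * 1^-1 = 0 :> R[i].
  by rewrite hT_at0 !mulr0 subr0 expr0n mul0r.
rewrite -[X in tends _ _ X]e; apply: tendsM; first exact: (tendsX 2 (h _ _ _)).
by apply: (@tendsV R _ (cnbhs 0) _ p2 1 _ p2_cont0); exact: oner_neq0.
Qed.

Lemma rho2_cont0 : tends (cnbhs 0) rho2 (1 : R[i]).
Proof.
have e : hF 0 ^+ 2 * 1^-1 = 1 :> R[i] by rewrite hF_at0 expr1n mul1r invr1.
rewrite -[X in tends _ _ X]e; apply: tendsM.
  exact: tendsX (zmod_comp_cont0 (cdif_hF nm0_lt1)).
by apply: (@tendsV R _ (cnbhs 0) _ p2 1 _ p2_cont0); exact: oner_neq0.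
Qed.

(** The factor q cancels against the one in [zmod]; the right side is the continuous extension to q
    = 0. *)
Lemma rho3_near0 q : nm q < 1 -> q != 0 ->
  rho3 q = cexp (- hK (zmod q)) * (p2 q ^+ 2 / (64 * etaB q)).
Proof.
move=> q1 q0; rewrite /rho3; move: (cexp _) => E; rewrite /zmod.
have := etaB_neq0 q1; move: (p2 q) (etaB q) => a b b0.
by rewrite !invfM invrK; field; apply/andP.
Qed.

Lemma rho3_limit0 : tends (cnbhs 0)
  (fun q => cexp (- hK (zmod q)) * (p2 q ^+ 2 / (64 * etaB q))) (1 / 64 : R[i]).
Proof.
have F0 : hF (0 : R[i]) != 0 by rewrite hF_at0 oner_neq0.
have d := cdif_div F0 (cdif_hH nm0_lt1) (cdif_hF nm0_lt1).
have K0 : hK (0 : R[i]) = 0 by rewrite /hK hH_at0 mul0r.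
have h1 := tends_comp (zmod_comp_cont0 (cdifN d)) (cdif_cont (cdif_cexp _)).
have e : cexp (- (hH 0 / hF 0)) * (1 ^+ 2 / (64 * 1)) = 1 / 64 :> R[i].
  by rewrite -/(hK 0) K0 oppr0 cexp0 expr1n mul1r mulr1.
rewrite -[X in tends _ _ X]e; apply: tendsM; first exact: h1.
apply: tendsM; first exact: tendsX p2_cont0.
apply: tendsV; first by rewrite mulr1 pnatr_eq0.
by apply: tendsM; [exact: tends_cst|exact: etaB_cont0].
Qed.

End Cusp.

(** * Back to tau: the component of the cusp *)

Section UpperHalfPlane.
Context {R : realType}.
Implicit Types (q w z tau : R[i]).

Lemma nm_qpar tau : nm (qpar tau) = expR (- (2 * pi * complex.Im tau)).
Proof.
rewrite /qpar nm_cexp; congr expR; case: tau => x y /=.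
by move: (pi : R) => p; ring.
Qed.

Lemma qpar_neq0 tau : qpar tau != 0. Proof. exact: cexp_neq0. Qed.

Lemma nm_qpar_lt1 tau : 0 < complex.Im tau -> nm (qpar tau) < 1.
Proof. by move=> t0; rewrite nm_qpar expR_lt1 oppr_lt0 !mulr_gt0 // pi_gt0. Qed.

Lemma qpar_cont tau : tends (cnbhs tau) (@qpar R) (qpar tau).
Proof.
exact: (tends_comp (cdif_cont (cdifZ (2 * pi%:C * 'i) (cdif_id tau))) (cdif_cont (cdif_cexp _))).
Qed.

Lemma qpar_double tau : qpar (2 * tau) = qpar tau ^+ 2.
Proof.
rewrite /qpar -cexpMn; congr cexp; move: (2 * pi%:C * 'i) => a; ring.
Qed.

Lemma lambertE k tau : 0 < complex.Im tau -> lambert k.+1 tau = phi k.+1 (qpar tau).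
Proof.
move=> /nm_qpar_lt1 q1; apply: climE.
have := phi_summable k.+1 q1; rewrite /csummable -phiE; apply: tends_near.
near=> m; rewrite /series /= big_ltn; last by near: m; exact: nbhs_infty_gt.
by rewrite expr0n mul0r add0r.
Unshelve. all: by end_near. Qed.

Lemma etaE tau : Defs.eta tau = cexp (2 * pi%:C * 'i * tau / 24) * euler (qpar tau).
Proof. rewrite eulerE; reflexivity. Qed.

Lemma hauptmodulE tau : 0 < complex.Im tau -> hauptmodul tau = tmod (qpar tau).
Proof.
move=> t0; have q1 := nm_qpar_lt1 t0; have q0 := qpar_neq0 tau.
rewrite /hauptmodul !etaE qpar_double /tmod; congr (_ * _).
(* The 24th power turns the factors q^(1/24) into integral powers of q, so no choice of root
   matters. *)
have e1 : cexp (2 * pi%:C * 'i * tau / 24) ^+ 24 = qpar tau.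
  by rewrite -cexpMn mulrCA divff ?mulr1 // pnatr_eq0.
have e2 : cexp (2 * pi%:C * 'i * (2 * tau) / 24) ^+ 24 = qpar tau ^+ 2.
  by rewrite -cexpMn mulrCA divff ?mulr1 -?qpar_double // pnatr_eq0.
have aux (a b x y : R[i]) : (a * x / (b * y)) ^+ 24 = a ^+ 24 / b ^+ 24 * (x / y) ^+ 24.
  by rewrite invfM mulrACA exprMn [in LHS]exprMn exprVn.
rewrite aux e1 e2 -etaA_div_etaB //; clear e1 e2 aux.
have := etaB_neq0 q1; move: (qpar tau) (etaA _) (etaB _) q0 => q x y q0 y0.
by field; apply/andP.
Qed.

Lemma F2B_large_hdom tau : F2B_large tau -> hdom (qpar tau).
Proof.
move=> [[t0 _ _ _] ht]; split; [exact: qpar_neq0|exact: nm_qpar_lt1|].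
by move: ht; rewrite hauptmodulE // nmE ltcR.
Qed.

(** [A] need not be open: constancy is asked on neighbourhoods in the plane, so a level set and its
    complement are traces of open sets on [A]. *)
Lemma connected_locally_cst (T : Type) (A : set R[i]) (f : R[i] -> T) x y :
  @connected R[i]^o A -> A x -> A y ->
  (forall w, A w -> \forall v \near cnbhs w, f v = f w) -> f y = f x.
Proof.
move=> cA Ax Ay hf.
pose B := A `&` [set w | f w = f x].
suff BA : B = A by move: Ay; rewrite -BA => -[].
apply: cA; first by exists x.
  exists [set w | \forall v \near cnbhs w, f v = f x].
    rewrite openE => w hw; apply/nbhs_cnbhs; exact: cnbhs_open hw.
  apply/seteqP; split=> w [Aw]; last by move=> /cnbhs_self.
  by move=> fw; split=> //=; rewrite -fw; exact: hf.
exists (~` [set w | \forall v \near cnbhs w, f v <> f x]).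
  apply: open_closedC; rewrite openE => w hw; apply/nbhs_cnbhs; exact: cnbhs_open hw.
apply/seteqP; split=> w [Aw] /= fw; split=> //.
  by move=> /cnbhs_self.
apply: contrapT => fn; apply: fw; apply: filterS (hf _ Aw) => v ->; exact: fn.
Qed.

Lemma component_value tau (f : R[i] -> R[i]) l : C_infty tau ->
  (forall w, @connected_component R[i]^o F2B_large tau w ->
    \forall v \near cnbhs (qpar w), f v = f (qpar w)) ->
  (forall e : R, 0 < e -> \forall v \near cnbhs 0, v != 0 -> nm (f v - l) < e) ->
  forall w, @connected_component R[i]^o F2B_large tau w -> f (qpar w) = l.
Proof.
move=> tC fc fl w Cw; apply/eqP; rewrite -subr_eq0 -nm_eq0 eq_le nm_ge0 andbT.
apply/ler_addgt0Pr => e e0; rewrite add0r; have [d d0 hd] := fl e e0.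
have p0 : 0 < 2 * pi :> R by rewrite mulr_gt0 // pi_gt0.
(* An imaginary part above this bound means |q| < d. *)
have [v Cv hv] := tC (- ln d / (2 * pi)).
have -> : f (qpar w) = f (qpar v).
  apply: (@connected_locally_cst _ (@connected_component R[i]^o F2B_large tau) (fun w => f (qpar w))) => //.
    exact: component_connected.
  by move=> u Cu; exact: (tends_cnbhs (@qpar_cont u) (fc _ Cu)).
apply: ltW; apply: hd; last exact: qpar_neq0.
rewrite subr0 nm_qpar -[ltRHS]lnK ?posrE // ltr_expR.
by move: hv; rewrite ltr_pdivrMr // => hv; rewrite ltrNl mulrC.
Qed.

Lemma component_hdom tau w : @connected_component R[i]^o F2B_large tau w -> hdom (qpar w).
Proof. by move=> /connected_component_sub; exact: F2B_large_hdom. Qed.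

Lemma C_infty_self tau : C_infty tau -> @connected_component R[i]^o F2B_large tau tau.
Proof.
move=> /(_ 0)[w /connected_component_sym /connected_component_sub h _].
exact: connected_component_refl.
Qed.

Lemma C_infty_hdom tau : C_infty tau -> hdom (qpar tau).
Proof. by move=> /C_infty_self /component_hdom. Qed.

Lemma C_infty_rho tau : C_infty tau ->
  [/\ rho1 (qpar tau) = 0, rho2 (qpar tau) = 1 & rho3 (qpar tau) = 1 / 64].
Proof.
move=> tC; have tt := C_infty_self tC.
have r1 : forall w, @connected_component R[i]^o F2B_large tau w -> rho1 (qpar w) = 0.
  apply: component_value => // [w Cw|e e0]; first exact: rho1_locally_cst (component_hdom Cw).
  by apply: filterS (rho1_cont0 e0) => v.
have r2 : forall w, @connected_component R[i]^o F2B_large tau w -> rho2 (qpar w) = 1.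
  apply: component_value => // [w Cw|e e0].
    by apply: rho2_locally_cst; [exact: component_hdom Cw|exact: r1].
  by apply: filterS (rho2_cont0 e0) => v.
split; [exact: r1|exact: r2|].
apply: (component_value tC) => // [w Cw|e e0].
  by apply: rho3_locally_cst; [exact: component_hdom Cw|exact: r1|exact: r2].
have h1 := cnbhs_disc (@nm0_lt1 R); have h2 := @rho3_limit0 R _ e0.
near=> v => v0; have v1 : nm v < 1 by near: v; exact: h1.
by rewrite rho3_near0 //; near: v; exact: h2.
Unshelve. all: by end_near. Qed.

End UpperHalfPlane.

(** * The imaginary axis and the two degenerate points *)

Section Axis.
Context {R : realType}.
Implicit Types (q w z tau : R[i]).

Lemma euler_real (x : R) : `|x| < 1 -> complex.Im (euler x%:C) = 0.
Proof.
move=> x1; have q1 : nm x%:C < 1 by rewrite nm_real.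
have h := tends_Im (euler_tends q1).
have e : (fun m => complex.Im (pochq x%:C m)) = fun=> 0.
  apply/funext => m; have -> : pochq x%:C m = (\prod_(1 <= n < m) (1 - x ^+ n))%:C.
    by rewrite rmorph_prod; apply: eq_bigr => n _; rewrite rmorphB rmorph1 rmorphXn.
  by [].
rewrite e in h; have <- := cvg_lim (@Rhausdorff R) (h _).
by apply: (cvg_lim (@Rhausdorff R)); exact: cvg_cst.
Qed.

Lemma Im0_real z : complex.Im z = 0 -> z = (complex.Re z)%:C.
Proof. by case: z => a b /= ->. Qed.

Lemma even_expr_gt0 (x : R) n : x != 0 -> ~~ odd n -> 0 < x ^+ n.
Proof. by move=> x0 n2; rewrite exprn_even_gt0 // x0 orbT. Qed.

(** The Euler products are real on the axis and 24 is even, so t is negative; hence |1 - t| > 1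
    along the whole axis. *)
Lemma tmod_qy (y : R) : 0 < y -> exists2 r : R, 0 < r & tmod (qy y) = (- r)%:C.
Proof.
move=> y0; have q1 := nm_qy y0; have q2 := nm_sqr_lt1 q1.
set x := expR (- (2 * pi * y)); have qE : qy y = x%:C by [].
have x0 : 0 < x by exact: expR_gt0.
have x1 : `|x| < 1 by rewrite -nm_real.
have x2 : `|x ^+ 2| < 1 by rewrite -nm_real rmorphXn.
have a0 := euler_neq0 q1; have b0 := euler_neq0 q2; have := etaA_div_etaB q1.
have Ea := Im0_real (euler_real x1); have Eb := Im0_real (euler_real x2).
have qE2 : qy y ^+ 2 = (x ^+ 2)%:C by rewrite rmorphXn.
have -> : tmod (qy y) = - (1 / 64) * (etaA (qy y) / etaB (qy y) / qy y).
  by rewrite /tmod -[in RHS]mulrA -invfM (mulrC (etaB _)).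
rewrite etaA_div_etaB //; move: a0 b0; rewrite qE2 qE Ea Eb !fmorph_eq0.
move: (complex.Re _) (complex.Re _) => b a a0 b0.
exists (1 / 64 * ((a / b) ^+ 24 / x)).
  apply: mulr_gt0; first by rewrite divr_gt0.
  apply: divr_gt0; last exact: x0.
  by apply: even_expr_gt0; rewrite ?mulf_neq0 ?invr_eq0.
have -> : (a%:C / b%:C) ^+ 24 = ((a / b) ^+ 24)%:C :> R[i].
  by rewrite -fmorph_div -rmorphXn.
move: ((a / b) ^+ 24) => s.
by rewrite rmorphN rmorphM fmorph_div rmorph1 rmorph_nat fmorph_div mulNr.
Qed.

Lemma hdom_qy (y : R) : 0 < y -> 1 < nm (1 - tmod (qy y)).
Proof.
move=> /tmod_qy[r r0 ->]; have -> : 1 - (- r)%:C = (1 + r)%:C.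
  by rewrite rmorphD rmorphN opprK rmorph1.
by rewrite nm_real gtr0_norm ?addr_gt0 // ltrDl.
Qed.

Lemma qpar_imaginary (y : R) : qpar (0 +i* y) = qy y.
Proof.
rewrite -qexp_real /qexp /qpar; congr cexp; apply/eqP; rewrite eq_complex /=.
by move: (pi : R) => p; apply/andP; split; apply/eqP; ring.
Qed.

Lemma half_real : 1 / 2 = (1 / 2 : R)%:C.
Proof. by rewrite fmorph_div rmorph1 rmorph_nat. Qed.

Lemma axis_F2B_large (y : R) : 1 <= y -> F2B_large (0 +i* y).
Proof.
move=> y1; have y0 : 0 < y by lra.
split; last first.
  by rewrite /= hauptmodulE //= qpar_imaginary nmE ltcR; exact: hdom_qy.
rewrite /F2B half_real; split => //=; rewrite ?nmE ?ltcR ?normr0; last by lra.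
  by have := nm_Im ((0 +i* y) + (1 / 2)%:C); rewrite /= addr0 ger0_norm; lra.
by have := nm_Im ((0 +i* y) - (1 / 2)%:C); rewrite /= oppr0 addr0 ger0_norm; lra.
Qed.

(** The vertical ray from i stays in [F2B_large]. Membership of i makes [rho3] available there, for
    comparison with tau. *)
Lemma C_infty_i : C_infty (0 +i* (1 : R)).
Proof.
move=> M; exists (0 +i* (1 + `|M|)); last by have := ler_norm M; rewrite /=; lra.
pose A := [set 0 +i* y | y in `[1, 1 + `|M|]%classic] : set R[i].
have AS : A `<=` F2B_large.
  by move=> _ [y /= + <-]; rewrite in_itv /= => /andP[y1 _]; exact: axis_F2B_large.
have n0 := normr_ge0 M.
apply: (@connected_component_max R[i]^o F2B_large A (0 +i* 1) _ AS).
- by exists 1 => //=; rewrite in_itv /=; lra.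
- apply: connected_continuous_connected; first exact: segment_connected.
  apply: continuous_subspaceT => y P /nbhs_cnbhs[d d0 hd].
  apply/nbhs_ballP; exists d => // v; rewrite /ball /= distrC => hv; apply: hd.
  by apply: le_lt_trans (nm_ReIm _) _; rewrite cRe_sub cIm_sub /= subrr normr0 add0r.
- by exists (1 + `|M|) => //=; rewrite in_itv /=; lra.
Qed.

Lemma C_infty_Im_gt0 tau : C_infty tau -> 0 < complex.Im tau.
Proof. by move=> /C_infty_self /connected_component_sub[[]]. Qed.

Lemma e6_eq0_zmod q : hdom q -> e6 q = 0 -> zmod q = 1 / 9.
Proof.
move=> h; have p0 := hdom_p2_neq0 h; case: h => q0 q1 _.
rewrite e6_zmod // => /eqP; rewrite mulf_eq0 expf_eq0 (negPf p0) andbF orFb.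
move: (zmod q) => z /eqP e; have -> : z = (1 - (1 - 9 * z)) / 9 by field.
by rewrite e subr0.
Qed.

(** Vanishing of [e6] means z = 1/9, at tau as at i. Since [rho3] is 1/64 at both, it recovers q
    from z: the two values of q agree, hence also the imaginary parts. *)
Lemma E2star_eq0 tau : C_infty tau -> e6 (qpar tau) = 0 -> E2star tau = 0.
Proof.
move=> tC e0; have t0 := C_infty_Im_gt0 tC; have h := C_infty_hdom tC.
have [_ _ r3] := C_infty_rho tC; have [_ _] := C_infty_rho C_infty_i.
have hi := C_infty_hdom C_infty_i; rewrite qpar_imaginary in hi *.
rewrite -r3 /rho3 (e6_eq0_zmod hi e6_qy1) (e6_eq0_zmod h e0) => qE.
have aux (u v E n : R[i]) : E != 0 -> n != 0 -> u * E / n = v * E / n -> v = u.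
  by move=> E0 n0 e; apply/esym/(mulIf E0)/(mulIf (invr_neq0 n0)).
have {aux}qE : qpar tau = qy 1.
  apply: (aux _ _ _ _ _ _ qE); first exact: cexp_neq0.
  by rewrite mul1r invr_eq0 pnatr_eq0.
have y1 : complex.Im tau = 1.
  have : nm (qpar tau) = nm (qpar (0 +i* (1 : R))) by rewrite qpar_imaginary qE.
  rewrite !nm_qpar => /expR_inj /oppr_inj; rewrite /= => /mulfI; apply.
  by rewrite mulf_neq0 ?pnatr_eq0 // gt_eqF // pi_gt0.
by rewrite /E2star y1 mulr1 /E2 lambertE // -/(e2 _) qE e2_qy1 subrr.
Qed.

Lemma psum_ratio_real (a b : nat -> R) (x : R) :
  polybounded (fun n => (a n)%:C) -> polybounded (fun n => (b n)%:C) -> `|x| < 1 ->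
  exists k : R, psum (fun n => (a n)%:C) x%:C / psum (fun n => (b n)%:C) x%:C = k%:C.
Proof.
move=> ha hb x1; have Ea := Im0_real (psum_real ha x1); have Eb := Im0_real (psum_real hb x1).
rewrite Ea Eb; move: (complex.Re _) (complex.Re _) => c d.
by exists (d / c); rewrite fmorph_div.
Qed.

Lemma zmod_neq_third tau : C_infty tau -> 1 + 3 * zmod (qpar tau) != 0.
Proof.
move=> tC; apply/eqP => e0; have t0 := C_infty_Im_gt0 tC.
have /connected_component_sub[[_ _ _ x12] _] := C_infty_self tC.
have ze : zmod (qpar tau) = (- (1 / 3))%:C.
  rewrite rmorphN fmorph_div rmorph1 rmorph_nat.
  move: e0; move: (zmod _) => z e; have -> : z = ((1 + 3 * z) - 1) / 3 by field.
  by rewrite e sub0r mulNr.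
have [_ _] := C_infty_rho tC; rewrite /rho3 ze.
have x1 : `|- (1 / 3)| < 1 :> R by rewrite normrN ger0_norm; lra.
(* H and F have real coefficients, so the exponent H / F is real at the real point z = -1/3. *)
have [k kE] := psum_ratio_real scoef_polybounded hcoef_polybounded x1.
have {}kE : hK (- (1 / 3))%:C = k%:C := kE.
rewrite kE -rmorphN cexp_real => r3.
have {r3} qE : qpar tau = (- ((expR (- k))^-1 / 192))%:C.
  have E0 : (expR (- k))%:C != 0 :> R[i] by rewrite fmorph_eq0 gt_eqF // expR_gt0.
  move: r3; rewrite !(rmorphN, fmorph_div, fmorphV, rmorph1, rmorph_nat) /=.
  move: (qpar tau) (expR _)%:C E0 => q E E0 r3.
  have -> : q = q * E / - (1 / 3) * - (1 / (3 * E)) by field.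
  by rewrite r3; field.
have qlt0 : complex.Re (qpar tau) < 0.
  by rewrite qE /= oppr_lt0 divr_gt0 // invr_gt0 expR_gt0.
have qim : complex.Im (qpar tau) = 0 by rewrite qE.
(* An argument of q, in (-pi, pi) because |Re tau| < 1/2; on that interval sin th = 0 forces th = 0,
   against cos th < 0. *)
pose th : R := 2 * pi * complex.Re tau.
have qpolar : qpar tau = (expR (- (2 * pi * complex.Im tau)))%:C * (cos th +i* sin th).
  rewrite /th; case: (tau) => x y; rewrite /qpar /cexp /=; congr ((expR _)%:C * (cos _ +i* sin _));
    by move: (pi : R) => p; ring.
have E0 := expR_gt0 (- (2 * pi * complex.Im tau)).
move: qlt0 qim; rewrite qpolar /= !mul0r subr0 addr0 pmulr_rlt0 // => c0 /eqP.
rewrite mulf_eq0 gt_eqF //= => /eqP s0.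
have p0 := pi_gt0 R.
have [x1' x2'] : - (1 / 2) < complex.Re tau /\ complex.Re tau < 1 / 2.
  by move: x12; rewrite ltr_norml => /andP.
have [thp|thn|th0] := ltgtP 0 th.
- have : 0 < sin th by apply: sin_gt0_pi; rewrite thp /th; nra.
  by rewrite s0 ltxx.
- have : 0 < sin (- th) by apply: sin_gt0_pi; rewrite oppr_gt0 thn /th; nra.
  by rewrite sinN s0 oppr0 ltxx.
- by move: c0; rewrite -th0 cos0 ltNge ler01.
Qed.

End Axis.

(** * Algebraic assembly *)

Section Conclusion.
Context {R : realType}.
Implicit Types (q w z t tau : R[i]).

Lemma complex_int (n : int) : n%:~R = (n%:~R)%:C :> R[i].
Proof. by rewrite rmorph_int. Qed.

(** The imaginary part of the equation gives b = -2 a Re tau; with the real part this makes d the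
    square of 2 a Im tau. *)
Lemma quadratic_Im (a b c d : int) tau : 0 < a -> 0 < complex.Im tau ->
  a%:~R * tau ^+ 2 + b%:~R * tau + c%:~R = 0 -> - d = b ^+ 2 - 4 * a * c ->
  Num.sqrt (d%:~R) = 2 * a%:~R * complex.Im tau :> R.
Proof.
move=> a0; case: tau => x y /= y0 root disc.
have aR : 0 < a%:~R :> R by rewrite ltr0z.
have {disc}disc : d%:~R = 4 * a%:~R * c%:~R - b%:~R ^+ 2 :> R.
  have -> : d = 4 * a * c - b ^+ 2 by rewrite -[d]opprK disc opprB.
  by rewrite rmorphB rmorphXn !rmorphM.
have [re im] : a%:~R * (x ^+ 2 - y ^+ 2) + b%:~R * x + c%:~R = 0 /\
    y * (2 * a%:~R * x + b%:~R) = 0 :> R.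
  move: root; rewrite !complex_int; move: (a%:~R) (b%:~R) (c%:~R) => A B C.
  by rewrite expr2 => /eqP; rewrite eq_complex /= => /andP[/eqP e1 /eqP e2]; split; [rewrite -e1|rewrite -e2]; ring.
have {im}b2 : b%:~R = - (2 * a%:~R * x) :> R.
  by apply/eqP; rewrite -addr_eq0 addrC; move/eqP: im; rewrite mulf_eq0 gt_eqF.
have -> : d%:~R = (2 * a%:~R * y) ^+ 2 :> R.
  have {re}cE : c%:~R = - (a%:~R * (x ^+ 2 - y ^+ 2) + b%:~R * x) :> R.
    by apply/eqP; rewrite -addr_eq0 addrC re.
  by rewrite disc cE b2; ring.
by rewrite sqrtr_sqr ger0_norm // ltW // !mulr_gt0.
Qed.

(** [hyp2F1] agrees with [hF] only where |1 / (1 - x)| < 1, so openness of that region is what lets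
    the derivative be computed on [hF]. *)
Lemma cderiv_hypergeometric_sqr t : 1 < nm (1 - t) ->
  cderiv (fun x => hyp2F1 (1 / 4) (3 / 4) 1 (1 / (1 - x)) ^+ 2) t =
  2 * hF (1 - t)^-1 * hF' (1 - t)^-1 * ((1 - t)^-1) ^+ 2.
Proof.
move=> t1; have u0 : 1 - t != 0 by rewrite -nm_gt0 (lt_trans ltr01).
have near1 : \forall x \near cnbhs t, 1 < nm (1 - x).
  exists (nm (1 - t) - 1); first by rewrite subr_gt0.
  move=> w; have := nm_sub_ge (1 - t) (w - t); have -> : 1 - t - (w - t) = 1 - w by ring.
  by lra.
have z1 : nm (1 - t)^-1 < 1 by rewrite nmV invf_lt1 // (lt_trans ltr01).
have du : cdif (fun x => 1 - x) t (0 - 1) by exact: cdifB (cdif_cst 1 t) (cdif_id t).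
have dv := @cdifV R (fun x => 1 - x) t _ u0 du.
have dF := cdifX 2 (cdif_comp dv (cdif_hF z1)).
apply: cderivE; apply: (cdif_near _ (cdif_eq dF _)).
  apply: filterS near1 => x x1; rewrite (div1r (1 - x)) hyp2F1E //.
  by rewrite nmV invf_lt1 // (lt_trans ltr01).
rewrite /= expr1; move: (1 - t) u0 (hF _) (hF' _) => u un a b.
by field.
Qed.

(** Cleared of denominators, the definition of [s2] survives at e6 = 0: there [s2] is 0 by division,
    and [E2star] vanishes by [E2star_eq0]. *)
Lemma s2_mul tau : C_infty tau ->
  let z := zmod (qpar tau) in
  (1 - 9 * z) * s2 tau * p2 (qpar tau) = (1 + 3 * z) * E2star tau.
Proof.
move=> tC; have h := C_infty_hdom tC; have p0 := hdom_p2_neq0 h.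
have t0 := C_infty_Im_gt0 tC; have q1 := nm_qpar_lt1 t0.
rewrite /s2 /E4 /E6 !lambertE // -/(e4 _) -/(e6 _); cbv zeta.
have [e0|n0] := eqVneq (e6 (qpar tau)) 0.
  by rewrite (E2star_eq0 tC e0) !(mulr0, mul0r).
have := n0; rewrite e6_zmod // e4_zmod //.
move: (zmod _) (p2 _) (E2star tau) p0 => z p e p0; rewrite mulf_eq0 negb_or => /andP[_ z9].
by field; apply/andP.
Qed.

(** Here p, y, e, E, s stand for [p2], [y2], [e2], [E2star], [s2], and S for 3 / (pi Im tau). The
    shape of the formula comes from t - 4 = - (1 + 3 z) / z and t + 8 = - (1 - 9 z) / z, the factors
    of E_4 and E_6. *)
Lemma algebraic_core (F F' p y e E z s S : R[i]) :
  z != 0 -> p != 0 -> 1 + 3 * z != 0 ->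
  F ^+ 2 = p -> p * (z * (1 - z) * F') = F * y -> y = (e - p * (1 - 3 * z)) / 12 ->
  (1 - 9 * z) * s * p = (1 + 3 * z) * E -> S = e - E ->
  let t := 1 - z^-1 in
  F ^+ 2 / 6 * ((t + 2) - (t - 1) * (t + 8) / (t - 4) * s) - t * (t - 1) * (2 * F * F' * z ^+ 2)
  = S / 6 * (t - 1).
Proof.
move=> z0 p0 z3 F2 hT hy hs -> t.
have t4 : t - 4 = - (1 + 3 * z) / z by rewrite /t; field.
have hF' : F * F' * (1 - z) * z = y.
  apply: (mulfI p0).
  have -> : p * (F * F' * (1 - z) * z) = F * (p * (z * (1 - z) * F')) by ring.
  by rewrite hT -F2; ring.
have hs' : (t - 1) * (t + 8) / (t - 4) * s = - E / (z * p).
  have -> : (t - 1) * (t + 8) / (t - 4) * s = - ((1 - 9 * z) * s * p) / (z * (1 + 3 * z) * p).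
    by rewrite t4 /t; field; apply/and3P.
  by rewrite hs; field; rewrite z0 p0 z3.
rewrite hs' F2.
have -> : t * (t - 1) * (2 * F * F' * z ^+ 2) = 2 * (F * F' * (1 - z) * z) / z.
  by rewrite /t; field.
by rewrite hF' hy /t; field; rewrite ?z0 ?p0.
Qed.

End Conclusion.

Theorem mainTheorem11 (R : realType) (a b c d : int) (tau : R[i])
    (a_gt0 : 0 < a)
    (coprime_abc : gcdz a (gcdz b c) = 1)
    (tau_root : a%:~R * tau ^+ 2 + b%:~R * tau + c%:~R = 0)
    (disc : - d = b ^+ 2 - 4 * a * c)
    (tauE : tau = (- b%:~R + sqrtC (- d%:~R)) / (2 * a%:~R))
    (tau_C : C_infty tau) :
  let t := hauptmodul tau in
  let F := fun x : R[i] => hyp2F1 (1 / 4) (3 / 4) 1 (1 / (1 - x)) in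
  F t ^+ 2 / 6 * ((t + 2) - (t - 1) * (t + 8) / (t - 4) * s2 tau)
    - t * (t - 1) * cderiv (fun x => F x ^+ 2) t
  = a%:~R / (pi * Num.sqrt (d%:~R))%:C * (t - 1).
Proof.
move=> t F; have h := C_infty_hdom tau_C.
have [r1 r2 _] := C_infty_rho tau_C.
have y0 := C_infty_Im_gt0 tau_C; have q1 := nm_qpar_lt1 y0.
have p0 := hdom_p2_neq0 h; have z0 := hdom_zmod_neq0 h; have z1 := hdom_zmod_lt1 h.
case: (h) => q0 _ ht.
have tq : t = tmod (qpar tau) by rewrite /t hauptmodulE.
have zE : zmod (qpar tau) = (1 - t)^-1 by rewrite zmodE // tq.
have tE : t = 1 - (zmod (qpar tau))^-1 by rewrite zE invrK subKr.
have FE : F t = hF (zmod (qpar tau)) by rewrite /F (div1r (1 - t)) -zE hyp2F1E.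
have F2 : hF (zmod (qpar tau)) ^+ 2 = p2 (qpar tau) by apply/eqP; rewrite -rho2_eq1 // r2.
have V0 : p2 (qpar tau) * (zmod (qpar tau) * (1 - zmod (qpar tau)) * hF' (zmod (qpar tau))) =
    hF (zmod (qpar tau)) * y2 (qpar tau).
  by rewrite -hTE //; apply/eqP; rewrite -subr_eq0 -/(hV _) -rho1_eq0 // r1.
have dE : cderiv (fun x => F x ^+ 2) t =
    2 * hF (zmod (qpar tau)) * hF' (zmod (qpar tau)) * zmod (qpar tau) ^+ 2.
  by rewrite cderiv_hypergeometric_sqr ?zE // tq.
have SE : (3 / (pi * complex.Im tau))%:C = e2 (qpar tau) - E2star tau :> R[i].
  by rewrite /E2star /E2 lambertE // -/(e2 _) subKr fmorph_div rmorph_nat.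
have core := algebraic_core z0 p0 (zmod_neq_third tau_C) F2 V0 erefl (s2_mul tau_C) SE.
rewrite dE FE [LHS](_ : _ = (3 / (pi * complex.Im tau))%:C / 6 * (t - 1)); last first.
  by rewrite tE; exact: core.
congr (_ * _); rewrite (quadratic_Im a_gt0 y0 tau_root disc).
have aR : a%:~R != 0 :> R by rewrite intr_eq0 gt_eqF.
have yR : complex.Im tau != 0 by rewrite gt_eqF.
have pR : pi != 0 :> R by rewrite gt_eqF // pi_gt0.
rewrite complex_int -(rmorph_nat (real_complex R) 6) -!fmorph_div; congr (_%:C).
move: (complex.Im tau) (a%:~R) (pi : R) yR aR pR => y A p yR aR pR.
by field; apply/and3P.
Qed.
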